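(* Let $X$ be a fat CW complex and $\mathcal{U}$ an open covering of $X$ (with respect to the $D$-topology). Then there is a smooth partition of unity on $X$ subordinate to $\mathcal{U}$, i.e. a family of smooth functions $\rho_U:X\to[0,1]$, $U\in\mathcal{U}$, with $\operatorname{supp}\rho_U\subset U$, the supports forming a locally finite family, and $\sum_{U\in\mathcal{U}}\rho_U=1$.
   Context: Smooth functions on a diffeological space $X$ are smooth maps $X\to\mathbb{R}$. The $D$-topology of $X$: $O\subset X$ is open iff $P^{-1}(O)$ is open for every plot $P$. Let $\ell(t)=0$ for $t\le0$, $e^{-1/t}$ for $t>0$; $\alpha_0=\int_0^1\ell(3x)\ell(3-3x)dx$; $\lambda(t)=\frac1{\alpha_0}\int_0^t\ell(3x)\ell(3-3x)dx$; $\phi(t)=\int_0^{1/2+t}\lambda(x)dx$. For integers $n,m\ge0$: $\mathbb{D}^{n,m}=\{(u,v)\in\mathbb{R}^n\times\mathbb{R}^m:\|u\|\ge1-\phi(2-\|u\|-\|v\|)\}$, $\mathbb{S}^{n-1,m}=\{(u,v):\|u\|\ge1\}$ (empty for $n=0$), with subset diffeologies. A fat CW complex is a diffeological space $X$ with subspaces $\emptyset=X^{(-1)}\subset X^{(0)}\subset\cdots$, index sets $J_n$, maps $m_n:J_n\to\mathbb{N}_0$ and smooth maps $h_n:\coprod_{j\in J_n}\mathbb{S}^{n-1,m_n(j)}\to X^{(n-1)}$ such that each $X^{(n)}$ is the pushout in diffeological spaces of the inclusion $\coprod_j\mathbb{S}^{n-1,m_n(j)}\hookrightarrow\coprod_j\mathbb{D}^{n,m_n(j)}$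 and $h_n$, and $X$ is the diffeological colimit of the $X^{(n)}$. *)

(* Defs.v *)
From HB Require Import structures.
From mathcomp Require Import all_boot all_order all_algebra.
From mathcomp Require Import all_classical all_reals all_analysis.
Unset Printing Implicit Defensive.
Import Order.TTheory GRing.Theory Num.Theory.
Import numFieldNormedType.Exports.
Local Open Scope classical_set_scope.
Local Open Scope ring_scope.

Section Diffeology.
Variable R : realType.

Definition basis_vec {n : nat} (i : 'I_n) : 'rV[R]_n := delta_mx 0 i.

Fixpoint pd {n : nat} {W : normedModType R} (f : 'rV[R]_n -> W) (l : seq 'I_n)
  : 'rV[R]_n -> W :=
  match l with
  | [::] => f
  | i :: l' => fun x => derive (pd f l') x (basis_vec i)
  end.

Definition Cinf {n : nat} {W : normedModType R} (U : set 'rV[R]_n)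
  (f : 'rV[R]_n -> W) : Prop :=
  forall l : seq 'I_n,
    (forall x, U x -> {for x, continuous (pd f l)}) /\
    (forall (i : 'I_n) x, U x -> derivable (pd f l) x (basis_vec i)).

(* a plot of dimension k is a pair (U, P) with U an open subset of R^k and
   P : U -> T; P is represented by a total function whose values outside U
   are irrelevant *)
Definition Plots (T : Type) := forall k : nat, set 'rV[R]_k -> ('rV[R]_k -> T) -> Prop.

Definition is_diffeology {T : Type} (p : Plots T) : Prop :=
  [/\ (forall k U P, p k U P -> open U),
      (forall k U P Q, p k U P -> (forall y, U y -> P y = Q y) -> p k U Q),
      (forall k (U : set 'rV[R]_k) (x : T), open U -> p k U (fun _ => x)),
      (forall k (U : set 'rV[R]_k) (P : 'rV[R]_k -> T), open U ->
         (forall y, U y -> exists V, [/\ open V, V y, V `<=` U & p k V P]) ->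
         p k U P) &
      (forall k m U P (V : set 'rV[R]_m) (F : 'rV[R]_m -> 'rV[R]_k),
         p k U P -> open V -> Cinf V F -> (forall y, V y -> U (F y)) ->
         p m V (P \o F))].

Definition smooth {T1 T2 : Type} (p1 : Plots T1) (p2 : Plots T2) (f : T1 -> T2) :=
  forall k U P, p1 k U P -> p2 k U (f \o P).

Definition real_plots : Plots R := fun k U P => open U /\ Cinf U P.

Definition eucl2_plots (n m : nat) : Plots ('rV[R]_n * 'rV[R]_m) :=
  fun k U P => [/\ open U, Cinf U (fun y => (P y).1) & Cinf U (fun y => (P y).2)].

Definition sub_plots {T : Type} (p : Plots T) (A : set T) : Plots {x : T | A x} :=
  fun k U P => p k U (fun y => sval (P y)).

Definition coprod_plots {J : Type} {T : J -> Type} (p : forall j, Plots (T j))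
  : Plots {j : J & T j} :=
  fun k U P => open U /\
    forall y, U y -> exists (V : set 'rV[R]_k) (j : J) (Q : 'rV[R]_k -> T j),
      [/\ open V, V y, V `<=` U, p j k V Q &
          forall z, V z -> P z = existT _ j (Q z)].

Definition Dopen {T : Type} (p : Plots T) (O : set T) : Prop :=
  forall k U P, p k U P -> open (U `&` P @^-1` O).

Definition Dclosure {T : Type} (p : Plots T) (A : set T) : set T :=
  fun x => forall O, Dopen p O -> O x -> exists y, O y /\ A y.

Definition Dsupport {T : Type} (p : Plots T) (f : T -> R) : set T :=
  Dclosure p [set x | f x != 0].

Definition ell (t : R) : R := if t <= 0 then 0 else expR (- t^-1).

Definition oint (f : R -> R) (a b : R) : R :=
  if a <= b then Rintegral lebesgue_measure `[a, b] f
  else - Rintegral lebesgue_measure `[b, a] f.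

Definition bump (x : R) : R := ell (3 * x) * ell (3 - 3 * x).
Definition alpha0 : R := oint bump 0 1.
Definition lam (t : R) : R := alpha0^-1 * oint bump 0 t.
Definition phi (t : R) : R := oint lam 0 (2^-1 + t).

Definition enorm {n : nat} (u : 'rV[R]_n) : R := Num.sqrt (\sum_(i < n) u 0 i ^+ 2).

Definition Dset (n m : nat) : set ('rV[R]_n * 'rV[R]_m) :=
  fun w => enorm w.1 >= 1 - phi (2 - enorm w.1 - enorm w.2).
Arguments Dset : clear implicits.

Definition Disk (n m : nat) := {w : 'rV[R]_n * 'rV[R]_m | Dset n m w}.
Definition Disk_plots (n m : nat) : Plots (Disk n m) :=
  sub_plots (eucl2_plots n m) (Dset n m).

(* S^{n-1,m} = {(u,v) : |u| >= 1}, viewed as a subset of D^{n,m}; its subset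
   diffeology coincides with the subset diffeology from R^n x R^m *)
Definition Sset (n m : nat) : set (Disk n m) := fun d => enorm (sval d).1 >= 1.
Definition Sph (n m : nat) := {d : Disk n m | Sset n m d}.
Definition Sph_plots (n m : nat) : Plots (Sph n m) :=
  sub_plots (Disk_plots n m) (Sset n m).

Definition is_pushout {A B C P : Type} (pA : Plots A) (pB : Plots B) (pC : Plots C)
  (pP : Plots P) (i : A -> B) (g : A -> C) (f1 : C -> P) (f2 : B -> P) : Prop :=
  [/\ (smooth pA pB i /\ smooth pA pC g), smooth pC pP f1, smooth pB pP f2,
      f1 \o g = f2 \o i &
      forall (Y : Type) (pY : Plots Y), is_diffeology pY ->
      forall (a : C -> Y) (b : B -> Y), smooth pC pY a -> smooth pB pY b ->
        a \o g = b \o i ->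
        exists u : P -> Y, [/\ smooth pP pY u, u \o f1 = a, u \o f2 = b &
          forall u' : P -> Y, smooth pP pY u' -> u' \o f1 = a -> u' \o f2 = b ->
            u' = u]].

Definition subincl {T : Type} {A B : set T} (H : A `<=` B) :
  {x : T | A x} -> {x : T | B x} :=
  fun x => exist _ (sval x) (H _ (svalP x)).

Definition coprod_incl {J : Type} {n : nat} {m : J -> nat} :
  {j : J & Sph n (m j)} -> {j : J & Disk n (m j)} :=
  fun s => existT _ (projT1 s) (sval (projT2 s)).

(* skel k stands for the skeleton X^{(k-1)}; thus skel 0 = X^{(-1)} = empty,
   and the n-cells (indexed by J n) are attached to skel n = X^{(n-1)}
   producing skel n.+1 = X^{(n)}. *)
Record fatCW := FatCW {
  cw_carrier : Type;
  cw_plots : Plots cw_carrier;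
  cw_diffeology : is_diffeology cw_plots;
  skel : nat -> set cw_carrier;
  skel0 : skel 0 = set0;
  skel_mono : forall n, skel n `<=` skel n.+1;
  cells : nat -> Type;
  cell_m : forall n, cells n -> nat;
  attach : forall n, {j : cells n & Sph n (cell_m n j)} -> {x | skel n x};
  charmap : forall n, {j : cells n & Disk n (cell_m n j)} -> {x | skel n.+1 x};
  attach_smooth : forall n,
    smooth (coprod_plots (fun j : cells n => Sph_plots n (cell_m n j)))
           (sub_plots cw_plots (skel n)) (attach n);
  skel_pushout : forall n,
    is_pushout (coprod_plots (fun j : cells n => Sph_plots n (cell_m n j)))
               (coprod_plots (fun j : cells n => Disk_plots n (cell_m n j)))
               (sub_plots cw_plots (skel n)) (sub_plots cw_plots (skel n.+1))
               (@coprod_incl (cells n) n (cell_m n)) (attach n)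
               (subincl (skel_mono n)) (charmap n);
  skel_colimit :
    forall (Y : Type) (pY : Plots Y), is_diffeology pY ->
    forall f : forall n, {x | skel n x} -> Y,
      (forall n, smooth (sub_plots cw_plots (skel n)) pY (f n)) ->
      (forall n x, f n.+1 (subincl (skel_mono n) x) = f n x) ->
      exists u : cw_carrier -> Y,
        [/\ smooth cw_plots pY u,
            (forall n (x : {x | skel n x}), u (sval x) = f n x) &
            forall u' : cw_carrier -> Y, smooth cw_plots pY u' ->
              (forall n (x : {x | skel n x}), u' (sval x) = f n x) -> u' = u]
}.

Definition Dopen_cover {T : Type} (p : Plots T) (UU : set (set T)) : Prop :=
  (forall U, UU U -> Dopen p U) /\ (forall x, exists U, UU U /\ U x).

Definition smooth_partition_of_unity_subordinate {T : Type} (p : Plots T)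
  (UU : set (set T)) (rho : set T -> T -> R) : Prop :=
  [/\ (forall U, UU U -> smooth p real_plots (rho U)),
      (forall U x, UU U -> 0 <= rho U x <= 1),
      (forall U, UU U -> Dsupport p (rho U) `<=` U),
      (forall x, exists O, [/\ Dopen p O, O x &
          finite_set [set U | UU U /\ exists y, O y /\ Dsupport p (rho U) y]]) &
      (forall x, exists (N : nat) (f : 'I_N -> set T),
          [/\ injective f, (forall i, UU (f i)),
              (forall U, UU U -> rho U x != 0 -> exists i, f i = U) &
              \sum_(i < N) rho (f i) x = 1])].

End Diffeology.

(* Main.v *)
Require Import Defs.
From HB Require Import structures.
From mathcomp Require Import all_boot all_order all_algebra.
From mathcomp Require Import all_classical all_reals all_analysis.
From mathcomp Require Import lra ring.
Import Order.TTheory GRing.Theory Num.Theory.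
Import numFieldNormedType.Exports.
Local Open Scope classical_set_scope.
Local Open Scope ring_scope.

(** Functions are handled in families [f : I -> X -> R] that are locally finite along
    every plot; such a family is a single smooth map into the diffeological space of
    finitely supported functions [I -> R], so the universal properties of pushouts and
    of the colimit extend whole families at once, with no topology on [X] involved.
    The crux is to extend a locally finite family from the fat sphere [|u| >= 1] to the
    fat disk.  A smooth [f] on the sphere pulls back under
    [(s, u, v) |-> (sqrt (1 + s^2) u / |u|, v)] to a function even in [s], which by
    Whitney's theorem is a smooth function of [s^2] and [(u, v)]; setting
    [s^2 = |u|^2 - 1] continues [f] to [|u| < 1].  Multiplying by a cutoff supported near
    the sphere keeps the set where the extension is large inside a prescribed D-open set
    (the D-topology of the disk is the Euclidean one, so a D-open set containing the
    sphere contains a tube [|u| >= 1 - d]).  Thus for each dimension and each of countably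
    many rational bumps on open cells there is a family on [X], one function [F_j] per
    cell, with [F_j >= 1] only inside a member of the cover.  Countably many such families
    are made jointly locally finite by the usual paracompactness trick of multiplying
    the [a]-th one by functions that vanish once [a] times an earlier one is [>= 1]. *)

(** * Smooth functions on Euclidean open sets *)

(** Superlevel sets, and not supports, are carried from one skeleton to the next: for an extension
    [E] the condition [E < e'] is D-open, whereas [E = 0] is not. If [f > e] only inside [O] and
    [e < e'], the D-open set where [O] holds or [E < e'] contains the whole sphere, hence a tube
    around it. So each skeleton costs a little of the threshold, and thresholds increasing to 1
    survive the passage to the colimit.

    The extension also has to respect local finiteness, although every member of the family receives
    its own Borel sum. At a point with [|u| < 1] the extension is built from the Taylor coefficients
    of the pulled-back function on the slice [s = 0], that is, at the radial projection of the point
    to the sphere. An index whose function vanishes near that projection therefore contributes 0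
    near the point.

    Local finiteness is known along plots only. D-open neighbourhoods that meet finitely many
    supports appear at the very end, because a union of D-closed sets that is locally finite along
    plots is again D-closed. *)

Section Lines.
Context {R : realType}.

Lemma is_derive_line {V W : normedModType R} (f : V -> W) (y e : V) (h : R) :
  derivable f (h *: e + y) e ->
  is_derive h 1 (fun k => f (k *: e + y)) ('D_e f (h *: e + y)).
Proof.
have E : (fun k : R => k^-1 *: (f ((k *: 1 + h) *: e + y) - f (h *: e + y)))
       = (fun k : R => k^-1 *: (f (k *: e + (h *: e + y)) - f (h *: e + y))).
  by apply/funext => k; rewrite scaler1 scalerDl addrA.
move=> df; split; first by rewrite /derivable /= E.
by rewrite /derive /= E.
Qed.

Lemma derive_line_mvt {V : normedModType R} (f : V -> R) (y e : V) (a : R) :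
  (forall h : R, `|h| <= `|a| -> derivable f (h *: e + y) e) ->
  exists2 h : R, `|h| <= `|a| &
    f (a *: e + y) - f y = a * 'D_e f (h *: e + y).
Proof.
move=> df.
have cts (b c : R) : (forall h : R, h \in `[b, c] -> `|h| <= `|a|) ->
    {within `[b, c], continuous (fun k => f (k *: e + y))}.
  move=> bc; apply: derivable_within_continuous => h hbc.
  by have [] := @is_derive_line _ _ f y e h (df _ (bc _ hbc)).
have [a0|a0] := leP 0 a.
  have H : forall h : R, h \in `[0, a] -> `|h| <= `|a|.
    by move=> h; rewrite in_itv /= => /andP[h0 ha]; rewrite !ger0_norm.
  have [||h hI] := @MVT_segment _ (fun k => f (k *: e + y))
      (fun k => 'D_e f (k *: e + y)) 0 a a0.
  - move=> h hI; apply: is_derive_line; apply/df/H.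
    exact: subset_itv_oo_cc hI.
  - exact: cts.
  rewrite scale0r add0r subr0 mulrC => E.
  by exists h => //; exact: H.
have H : forall h : R, h \in `[a, 0] -> `|h| <= `|a|.
  move=> h; rewrite in_itv /= => /andP[h0 ha].
  by rewrite !ler0_norm ?lerN2 // ltW.
have [||h hI] := @MVT_segment _ (fun k => f (k *: e + y))
    (fun k => 'D_e f (k *: e + y)) a 0 (ltW a0).
- move=> h hI; apply: is_derive_line; apply/df/H.
  exact: subset_itv_oo_cc hI.
- exact: cts.
rewrite scale0r add0r sub0r mulrN mulrC => E.
by exists h; [exact: H|rewrite -opprB E opprK].
Qed.

(** Only the outer map has to be differentiable. On the line through [x] the inner map is a function
    of one variable, where derivable and differentiable agree, so the ordinary chain rule applies
    there. *)
Lemma is_derive_comp_diff {U V W : normedModType R} (f : V -> W) (g : U -> V) x e :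
  differentiable f (g x) -> derivable g x e ->
  is_derive x e (f \o g) ('d f (g x) ('D_e g x)).
Proof.
move=> df dg.
pose l := fun h : R => g (h *: e + x).
have l0 : l 0 = g x by rewrite /l scale0r add0r.
have dl : differentiable l 0 by apply/derivable1_diffP; move/derivable1P: dg.
have dfl : differentiable f (l 0) by rewrite l0.
have dc : differentiable (f \o l) 0 by exact: differentiable_comp.
have El : 'D_1 l 0 = 'D_e g x.
  rewrite /derive /l /=; under eq_fun do rewrite scaler1 addr0 scale0r add0r.
  by [].
have Ec : 'D_1 (f \o l) 0 = 'D_e (f \o g) x.
  rewrite /derive /l /=; under eq_fun do rewrite scaler1 addr0 scale0r add0r.
  by [].
split; first by apply/derivable1P; move/derivable1_diffP: dc.
by rewrite -Ec -El (deriveE _ dl) (deriveE _ dc) diff_comp //= l0.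
Qed.

End Lines.

Lemma cvg_sumr {T I : Type} {K : numFieldType} {V : normedModType K}
    (F : set_system T) (r : seq I) (f : I -> T -> V) (l : I -> V) :
  Filter F -> (forall i, f i @ F --> l i) ->
  (fun x => \sum_(i <- r) f i x) @ F --> \sum_(i <- r) l i.
Proof.
move=> FF fl; elim: r => [|i r IH].
  by rewrite big_nil; under eq_fun do rewrite big_nil; exact: cvg_cst.
by rewrite big_cons; under eq_fun do rewrite big_cons; apply: cvgD.
Qed.

Section RowNorm.
Context {R : realType} {n : nat}.

Lemma rV_coord_le (x : 'rV[R]_n) j : `|x 0 j| <= `|x|.
Proof. by rewrite [leRHS]mx_normrE; apply: (le_bigmax _ (fun i => `|x i.1 i.2|) (0, j)). Qed.

Lemma rV_norm_le (x : 'rV[R]_n) (c : R) :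
  0 <= c -> (forall j, `|x 0 j| <= c) -> `|x| <= c.
Proof.
move=> c0 xc; rewrite [leLHS]mx_normrE; apply/bigmax_leP; split=> //= -[i j] _ /=.
by rewrite ord1.
Qed.

Lemma rV_nearP (x : 'rV[R]_n) (P : set 'rV[R]_n) :
  (\forall y \near x, P y) <-> exists2 d : R, 0 < d & forall y, `|x - y| < d -> P y.
Proof.
split=> [/(@nbhs_normP _ 'rV[R]_n)[d /= d0 H]|[d d0 H]]; first by exists d => // y /H.
by apply/(@nbhs_normP _ 'rV[R]_n); exists d => //= y /H.
Qed.

Lemma rV_cvgP {T : Type} (F : set_system T) {FF : Filter F} (G : T -> 'rV[R]_n)
    (l : 'rV[R]_n) :
  (G @ F --> l) <-> forall j, (fun t => G t 0 j) @ F --> l 0 j.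
Proof.
split=> [Gl j|H].
  by apply: (@cvg_comp _ _ _ G (fun y : 'rV[R]_n => y 0 j) _ _ _ Gl); exact: coord_continuous.
apply/(@cvgrPdist_lt _ 'rV[R]_n) => eps e0.
have : \forall t \near F, forall j, `|l 0 j - G t 0 j| < eps / 2.
  apply: (@filter_forall _ _ (fun j t => `|l 0 j - G t 0 j| < eps / 2) F) => j.
  by move/cvgrPdist_lt: (H j); apply; rewrite divr_gt0.
apply: filterS => t Ht; apply: (@le_lt_trans _ _ (eps / 2)).
  by apply: rV_norm_le => [|j]; rewrite ?mxE ?divr_ge0 ?ltW // ltW // Ht.
by rewrite ltr_pdivrMr // ltr_pMr // ltr1n.
Qed.

Lemma rV_continuousP {T : topologicalType} (G : T -> 'rV[R]_n) (x : T) :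
  {for x, continuous G} <-> forall j, {for x, continuous (fun t => G t 0 j)}.
Proof. exact: (@rV_cvgP _ (nbhs x)). Qed.

End RowNorm.

(** * Continuous partial derivatives imply differentiability *)

Section C1.
Context {R : realType} {n : nat}.
Local Notation e := (@basis_vec R n).

(** Vertices of the path from 0 to [h] that changes one coordinate at a time. *)
Definition trunc_row (k : nat) (h : 'rV[R]_n) : 'rV[R]_n :=
  \row_j (if (j < k)%N then h 0 j else 0).

Lemma trunc_rowS (k : 'I_n) (h : 'rV[R]_n) :
  trunc_row k.+1 h = h 0 k *: e k + trunc_row k h.
Proof.
apply/rowP => j; rewrite !mxE eqxx /= ltnS leq_eqVlt -val_eqE /=.
case: ltngtP => jk; rewrite ?mulr1 ?mulr0 ?addr0 ?add0r //.
by congr (h _ _); apply/val_inj.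
Qed.

Lemma trunc_row_small (k : 'I_n) (h : 'rV[R]_n) (c : R) : `|c| <= `|h 0 k| ->
  `|c *: e k + trunc_row k h| <= `|h|.
Proof.
move=> ck; apply: rV_norm_le => // j.
rewrite !mxE eqxx /= -val_eqE /=; case: ltngtP => jk;
  rewrite ?mulr1 ?mulr0 ?addr0 ?add0r ?normr0 ?rV_coord_le //.
exact: (le_trans ck (rV_coord_le _ _)).
Qed.

Let lin (a : 'I_n -> R) (h : 'rV[R]_n) : R := \sum_j h 0 j * a j.

Let lin_linear a : linear (lin a).
Proof.
move=> c u v; rewrite /lin scaler_sumr -big_split /=; apply: eq_bigr => j _.
by rewrite !mxE mulrDl /= -mulrA.
Qed.

HB.instance Definition _ a := GRing.isLinear.Build R 'rV[R]_n R _ (lin a) (lin_linear a).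

Let lin_continuous a : continuous (lin a).
Proof.
move=> x; rewrite /lin; apply: (@cvg_sumr _ _ _ _ (nbhs x) _ (fun j (h : 'rV[R]_n) => h 0 j * a j)) => j.
by apply: cvgMl; apply: coord_continuous.
Qed.

(** Each edge of the path through the [trunc_row k h] is a mean value step in one coordinate, and by
    continuity the partial derivative met there is close to the one at [x]. *)
Lemma C1_differentiable (f : 'rV[R]_n -> R) (x : 'rV[R]_n) :
  (forall j, \forall y \near x, derivable f y (e j)) ->
  (forall j, {for x, continuous ('D_(e j) f)}) ->
  differentiable f x /\ 'd f x = lin (fun j => 'D_(e j) f x) :> ('rV[R]_n -> R).
Proof.
move=> df cf; set df0 := lin _.
have key : f \o shift x = cst (f x) + df0 +o_ (0 : 'rV[R]_n) id.
  apply/eqaddoP => _/posnumP[eps].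
  (* The [n] errors of this size add up to at most [eps]; dividing by [n.+1] also covers [n = 0]. *)
  have ep : 0 < eps%:num / n.+1%:R by rewrite divr_gt0.
  have [d /= d0 Hd] : exists2 d : R, 0 < d & forall y j, `|x - y| < d ->
      derivable f y (e j) /\ `|'D_(e j) f x - 'D_(e j) f y| < eps%:num / n.+1%:R.
    have : \forall y \near x, forall j, derivable f y (e j) /\
       `|'D_(e j) f x - 'D_(e j) f y| < eps%:num / n.+1%:R.
      apply: (@filter_forall _ _ (fun j y => derivable f y (e j) /\
        `|'D_(e j) f x - 'D_(e j) f y| < eps%:num / n.+1%:R) (nbhs x)) => j.
      apply: filterI; first exact: df.
      by have /cvgrPdist_lt/(_ _ ep) := cf j.
    by move=> /rV_nearP[d d0 Hd]; exists d => // y j /Hd; exact.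
  near=> h => /=.
  have hd : `|h| < d.
    near: h; apply/rV_nearP; exists d => //= y; by rewrite sub0r normrN.
  have step (k : nat) : (k <= n)%N ->
      `|f (trunc_row k h + x) - f x
        - \sum_(j < n | (j < k)%N) h 0 j * 'D_(e j) f x|
      <= k%:R * (eps%:num / n.+1%:R) * `|h|.
    elim: k => [_|k IH kn].
      have -> : trunc_row 0 h = 0 by apply/rowP => j; rewrite !mxE.
      by rewrite add0r subrr big_pred0_eq subr0 normr0 !mul0r.
    pose K := Ordinal kn.
    have [|c ch Ec] := @derive_line_mvt _ _ f (trunc_row K h + x) (e K) (h 0 K).
      move=> c ch; apply: (Hd _ K _).1; rewrite addrA distrC addrK.
      exact: (le_lt_trans (trunc_row_small _ _ _ ch)).
    rewrite (bigD1 K) //= (eq_bigl (fun j : 'I_n => (j < k)%N)); last first.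
      by move=> j; rewrite -val_eqE /= ltnS; case: ltngtP.
    rewrite -[k.+1]/(K.+1) trunc_rowS -(addrA (h 0 K *: e K)).
    have -> : f (h 0 K *: e K + (trunc_row K h + x)) - f x -
       (h 0 K * 'D_(e K) f x + \sum_(i < n | (i < k)%N) h 0 i * 'D_(e i) f x)
     = (f (trunc_row k h + x) - f x - \sum_(i < n | (i < k)%N) h 0 i * 'D_(e i) f x)
       - h 0 K * ('D_(e K) f x - 'D_(e K) f (c *: e K + (trunc_row K h + x))).
      by rewrite mulrBr -Ec /=; ring.
    apply: (le_trans (ler_normB _ _)).
    rewrite -[in leRHS]natr1 mulrDl mulrDl mul1r lerD ?IH 1?ltnW // normrM mulrC.
    apply: ler_pM => //; last exact: rV_coord_le.
    apply/ltW/(Hd _ K _).2; rewrite addrA distrC addrK.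
    exact: (le_lt_trans (trunc_row_small _ _ _ ch)).
  have := step n (leqnn _).
  have -> : trunc_row n h = h by apply/rowP => j; rewrite !mxE ltn_ord.
  rewrite (eq_bigl xpredT) => [H|j]; last by rewrite ltn_ord.
  have -> : (f \o shift x - (cst (f x) + df0)) h
     = f (h + x) - f x - \sum_j h 0 j * 'D_(e j) f x.
    by rewrite /df0 /lin !fctE /= opprD addrA.
  apply: (le_trans H); apply: ler_wpM2r => //.
  rewrite mulrA mulrAC ler_piMl // ler_pdivrMr // mul1r ler_nat //.
have E : 'd f x = df0 :> ('rV[R]_n -> R).
  by apply: diff_unique; [exact: lin_continuous|exact: key].
split=> //; apply/diff_locallyP; rewrite E; split => //; exact: lin_continuous.
Unshelve. all: by end_near. Qed.
End C1.

(** * Finite orders of smoothness in several variables *)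

Section FiniteSmoothness.
Context {R : realType}.
Local Notation "'d_ i f" := ('D_(basis_vec R i) f) (at level 10, i, f at next level).

(** In [pd] the last derivative taken stands at the head of the list, which does not suit an
    induction on products or compositions. Here [f] is differentiated first, so an induction
    hypothesis applies to its partial derivatives; [pd_rcons] relates the two orders. *)
Fixpoint Ck {n : nat} (L : nat) (U : set 'rV[R]_n) (f : 'rV[R]_n -> R) : Prop :=
  (forall x, U x -> {for x, continuous f}) /\
  if L is L'.+1 then
    forall i, (forall x, U x -> derivable f x (basis_vec R i)) /\ Ck L' U ('d_i f)
  else True.

Lemma Ck_continuous {n} L (U : set 'rV[R]_n) f x :
  Ck L U f -> U x -> {for x, continuous f}.
Proof. by case: L => [|L] [H _]; apply: H. Qed.

Lemma Ck_derivable {n} L (U : set 'rV[R]_n) f i x :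
  Ck L.+1 U f -> U x -> derivable f x (basis_vec R i).
Proof. by case=> _ /(_ i) [H _]; apply: H. Qed.

Lemma Ck_le {n} L L' (U : set 'rV[R]_n) f : (L' <= L)%N -> Ck L U f -> Ck L' U f.
Proof.
elim: L' L f => [|L' IH] [|L] // f LL [cf H]; split => // i.
by split; [apply: (H i).1|apply: IH (H i).2].
Qed.

Lemma Ck_subset {n} L (U V : set 'rV[R]_n) f : V `<=` U -> Ck L U f -> Ck L V f.
Proof.
move=> VU; elim: L f => [|L IH] f [cf H]; split; try by move=> x /VU /cf.
  by [].
by move=> i; split => [x /VU|]; [apply: (H i).1|apply: IH (H i).2].
Qed.

Lemma pd_rcons {n} {W : normedModType R} (f : 'rV[R]_n -> W) l i :
  pd R f (rcons l i) = pd R ('d_i f) l.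
Proof. by elim: l => //= j l ->. Qed.

Lemma CinfP {n} (U : set 'rV[R]_n) (f : 'rV[R]_n -> R) :
  Cinf R U f <-> forall L, Ck L U f.
Proof.
split.
  move=> H L; elim: L f H => [|L IH] f H.
    by split => // x Ux; exact: (H [::]).1.
  split=> [x Ux|i]; first exact: (H [::]).1.
  split=> [x Ux|]; first exact: (H [::]).2.
  by apply: IH => l; rewrite -pd_rcons; exact: H.
move=> H l; elim/last_ind: l f H => [|l i IH] f H.
  split=> [x|i x]; first exact: (Ck_continuous _ _ _ _ (H 0%N)).
  exact: (Ck_derivable _ _ _ _ _ (H 1%N)).
by rewrite pd_rcons; apply: IH => L; have [_ /(_ i) []] := H L.+1.
Qed.

Lemma Cinf_subset {n} (U V : set 'rV[R]_n) (f : 'rV[R]_n -> R) :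
  V `<=` U -> Cinf R U f -> Cinf R V f.
Proof. by move=> VU /CinfP Uf; apply/CinfP => L; apply: Ck_subset VU (Uf L). Qed.

Lemma Cinf_continuous {n} (U : set 'rV[R]_n) (f : 'rV[R]_n -> R) x :
  Cinf R U f -> U x -> {for x, continuous f}.
Proof. by move=> H; apply: (H [::]).1. Qed.

Lemma Cinf_pd {n} (U : set 'rV[R]_n) (f : 'rV[R]_n -> R) l :
  Cinf R U f -> Cinf R U (pd R f l).
Proof.
suff E l' : pd R (pd R f l) l' = pd R f (l' ++ l) by move=> H l'; rewrite E; exact: H.
by elim: l' => //= i l' ->.
Qed.

Lemma near_eq_continuous {T U : topologicalType} (f g : T -> U) (x : T) :
  (\forall y \near x, f y = g y) -> {for x, continuous f} -> {for x, continuous g}.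
Proof.
move=> fg cf; have fgx : f x = g x by exact: nbhs_singleton fg.
rewrite /prop_for /continuous_at -fgx.
by apply: cvg_trans cf; apply: near_eq_cvg.
Qed.

Lemma Ck_ext {n} L (U : set 'rV[R]_n) f g :
  open U -> (forall x, U x -> f x = g x) -> Ck L U f -> Ck L U g.
Proof.
move=> oU; elim: L f g => [|L IH] f g fg [cf H].
  split=> // x Ux; apply: near_eq_continuous (cf x Ux).
  by apply: filterS fg _; exact: open_nbhs_nbhs.
have N x : U x -> \forall y \near x, f y = g y.
  by move=> Ux; apply: filterS fg _; exact: open_nbhs_nbhs.
split=> [x Ux|i]; first exact: near_eq_continuous (N _ Ux) (cf x Ux).
split=> [x Ux|]; first exact: near_eq_derivable (N _ Ux) ((H i).1 _ Ux).
by apply: IH (H i).2 => x Ux; exact: near_eq_derive (N _ Ux).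
Qed.

Lemma Ck_local {n} L (U : set 'rV[R]_n) f :
  (forall x, U x -> exists2 V, V x & Ck L V f) -> Ck L U f.
Proof.
elim: L f => [|L IH] f H.
  by split=> // x /H[V Vx /Ck_continuous]; apply.
split=> [x /H[V Vx /Ck_continuous]|i]; first by apply.
split=> [x /H[V Vx] /Ck_derivable|]; first by apply.
by apply: IH => x /H[V Vx [_ /(_ i)[_ ?]]]; exists V.
Qed.

Lemma Cinf_local {n} (U : set 'rV[R]_n) (f : 'rV[R]_n -> R) :
  (forall x, U x -> exists2 V, V x & Cinf R V f) -> Cinf R U f.
Proof.
move=> H; apply/CinfP => L; apply: Ck_local => x /H[V Vx /CinfP Vf].
by exists V.
Qed.

Lemma Cinf_ext {n} (U : set 'rV[R]_n) (f g : 'rV[R]_n -> R) :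
  open U -> (forall x, U x -> f x = g x) -> Cinf R U f -> Cinf R U g.
Proof. by move=> oU fg /CinfP Uf; apply/CinfP => L; apply: Ck_ext fg (Uf L). Qed.

Lemma Ck_cst {n} L (U : set 'rV[R]_n) (a : R) : Ck L U (fun=> a).
Proof.
elim: L a => [|L IH] a.
  by split=> // x _; exact: cst_continuous.
split=> [x _|i]; first exact: cst_continuous.
split=> [x _|]; first exact: derivable_cst.
have -> : 'd_i (fun=> a) = (fun=> 0) :> ('rV[R]_n -> R).
  by apply/funext => x; exact: derive_cst.
exact: IH.
Qed.

Lemma Ck_add {n} L (U : set 'rV[R]_n) f g : open U ->
  Ck L U f -> Ck L U g -> Ck L U (fun x => f x + g x).
Proof.
move=> oU; elim: L f g => [|L IH] f g [cf Hf] [cg Hg].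
  by split=> // x Ux; apply: continuousD; [exact: cf|exact: cg].
split=> [x Ux|i]; first by apply: continuousD; [exact: cf|exact: cg].
split=> [x Ux|]; first by apply: derivableD; [exact: (Hf i).1|exact: (Hg i).1].
apply: Ck_ext (IH _ _ (Hf i).2 (Hg i).2) => // x Ux /=.
by rewrite deriveD //; [exact: (Hf i).1|exact: (Hg i).1].
Qed.

Lemma Ck_mul {n} L (U : set 'rV[R]_n) f g : open U ->
  Ck L U f -> Ck L U g -> Ck L U (fun x => f x * g x).
Proof.
move=> oU; elim: L f g => [|L IH] f g Hf Hg.
  split=> // x Ux.
  by apply: continuousM; [exact: Ck_continuous Hf Ux|exact: Ck_continuous Hg Ux].
split=> [x Ux|i].
  by apply: continuousM; [exact: Ck_continuous Hf Ux|exact: Ck_continuous Hg Ux].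
have [[cf Hf'] [cg Hg']] := (Hf, Hg).
split=> [x Ux|].
  by apply: derivableM; [exact: (Hf' i).1|exact: (Hg' i).1].
have H1 := IH _ _ (Ck_le _ _ _ _ (leqnSn L) Hf) (Hg' i).2.
have H2 := IH _ _ (Ck_le _ _ _ _ (leqnSn L) Hg) (Hf' i).2.
apply: Ck_ext (Ck_add _ _ _ _ oU H1 H2) => // x Ux /=.
by rewrite deriveM //; [exact: (Hf' i).1|exact: (Hg' i).1].
Qed.

Lemma Ck_sum {n} L (U : set 'rV[R]_n) {I : Type} (r : seq I) (P : pred I) f : open U ->
  (forall i, Ck L U (f i)) -> Ck L U (fun x => \sum_(i <- r | P i) f i x).
Proof.
move=> oU Hf; elim: r => [|i r IH].
  by under eq_fun do rewrite big_nil; exact: Ck_cst.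
under eq_fun do rewrite big_cons; case: (P i) => //.
exact: Ck_add.
Qed.

Lemma Ck_comp {m n} L (U : set 'rV[R]_m) (V : set 'rV[R]_n) f (F : 'rV[R]_m -> 'rV[R]_n) :
  open U -> open V -> Ck L V f -> (forall j, Ck L U (fun x => F x 0 j)) ->
  (forall x, U x -> V (F x)) -> Ck L U (f \o F).
Proof.
move=> oU oV + + UV.
have cF L' : (forall j, Ck L' U (fun x => F x 0 j)) ->
    forall x, U x -> {for x, continuous F}.
  move=> HF x Ux; apply/rV_continuousP => j; exact: Ck_continuous (HF j) Ux.
have cfF L' f' : Ck L' V f' -> (forall j, Ck L' U (fun x => F x 0 j)) ->
    forall x, U x -> {for x, continuous (f' \o F)}.
  move=> Hf HF x Ux; apply: continuous_comp; first exact: cF HF _ Ux.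
  exact: Ck_continuous Hf (UV _ Ux).
elim: L f => [|L IH] f Hf HF; first by split => //; exact: cfF Hf HF.
have HFL j : Ck L U (fun x => F x 0 j) by apply: Ck_le (HF j); exact: leqnSn.
have dF i x : U x -> derivable F x (basis_vec R i).
  move=> Ux; apply/derivable_mxP => a j; rewrite ord1.
  exact: (Ck_derivable _ _ _ _ _ (HF j) Ux).
have [_ Hf'] := Hf.
have C1 x : U x -> differentiable f (F x) /\
   'd f (F x) = (fun h => \sum_j h 0 j * 'd_j f (F x)) :> ('rV[R]_n -> R).
  move=> Ux; apply: C1_differentiable => j.
    apply: filterS (open_nbhs_nbhs (conj oV (UV _ Ux))) => y Vy.
    exact: (Hf' j).1.
  exact: Ck_continuous (Hf' j).2 (UV _ Ux).
have D i x : U x -> is_derive x (basis_vec R i) (f \o F)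
    (\sum_j 'd_i (fun x => F x 0 j) x * 'd_j f (F x)).
  move=> Ux; have [df dfE] := C1 x Ux.
  have := @is_derive_comp_diff _ _ _ _ f F x (basis_vec R i) df (dF i x Ux).
  rewrite dfE derive_mx; last exact: dF.
  by under eq_bigr do rewrite mxE.
split=> [|i]; first exact: cfF Hf HF.
split=> [x Ux|]; first by have [] := D i x Ux.
apply: (@Ck_ext _ _ _ (fun x => \sum_j 'd_i (fun x => F x 0 j) x * 'd_j f (F x))) => //.
  by move=> x Ux; have [_ ->] := D i x Ux.
apply: Ck_sum => // j; apply: Ck_mul => //.
  by have [_ /(_ i)[]] := HF j.
by apply: (IH ('d_j f)) => //; exact: (Hf' j).2.
Qed.

Lemma Ck_coord {n} L (U : set 'rV[R]_n) j : Ck L U (fun x => x 0 j).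
Proof.
have D i x : is_derive x (basis_vec R i) (fun x : 'rV[R]_n => x 0 j) ((i == j)%:R).
  have := @is_derive_id _ 'rV[R]_n x (basis_vec R i); case=> dx.
  rewrite derive_mx // => /matrixP/(_ 0 j); rewrite !mxE eqxx /= eq_sym => E.
  split=> //; move/derivable_mxP: dx; exact.
case: L => [|L]; first by split => // x _; exact: coord_continuous.
split=> [x _|i]; first exact: coord_continuous.
split=> [x _|]; first by have [] := D i x.
have -> : 'd_i (fun x : 'rV[R]_n => x 0 j) = (fun=> (i == j)%:R) :> ('rV[R]_n -> R).
  by apply/funext => x; have [] := D i x.
exact: Ck_cst.
Qed.

Lemma Cinf_vecP {m n} (U : set 'rV[R]_m) (F : 'rV[R]_m -> 'rV[R]_n) : open U ->
  Cinf R U F <-> forall j, Cinf R U (fun x => F x 0 j).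
Proof.
move=> oU.
have der (G : 'rV[R]_m -> 'rV[R]_n) x v : derivable G x v <->
   forall j, derivable (fun x => G x 0 j) x v.
  split=> [/derivable_mxP H j|H]; first exact: H.
  by apply/derivable_mxP => a j; rewrite ord1.
(* A derivative is computed coordinatewise only where it exists, so equality at [l] presupposes
   derivability along shorter lists. From the components this is immediate; from [F] it needs a
   strong induction on the length. *)
have key l : (forall l', (size l' < size l)%N -> forall i x, U x ->
      forall j, derivable (pd R (fun x => F x 0 j) l') x (basis_vec R i)) ->
    forall x, U x -> forall j, pd R F l x 0 j = pd R (fun x => F x 0 j) l x.
  elim: l => //= i l IH Hd x Ux j.
  have IH' : forall x, U x -> forall j, pd R F l x 0 j = pd R (fun x => F x 0 j) l x.
    by apply: IH => l' ll'; apply: Hd; exact: leqW.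
  have N k : \forall y \near x, pd R (fun x => F x 0 k) l y = pd R F l y 0 k.
    apply: filterS (open_nbhs_nbhs (conj oU Ux)) => y Uy.
    by rewrite IH'.
  rewrite derive_mx ?mxE.
    by apply: near_eq_derive; apply: filterS (N j) => y ->.
  apply/der => k; apply: near_eq_derivable (N k) _; exact: Hd.
split.
  move=> H; have E l : forall x, U x -> forall j, pd R F l x 0 j = pd R (fun x => F x 0 j) l x.
    have [k] := ubnP (size l); elim: k l => // k IH l lk; apply: key => l' ll' i x Ux j.
    apply: near_eq_derivable ((der _ _ _).1 ((H l').2 i x Ux) j).
    apply: filterS (open_nbhs_nbhs (conj oU Ux)) => y Uy.
    by apply: IH => //; exact: leq_trans ll' _.
  move=> j l; split=> [x Ux|i x Ux].
    apply: near_eq_continuous ((rV_continuousP _ _).1 ((H l).1 x Ux) j).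
    by apply: filterS (open_nbhs_nbhs (conj oU Ux)) => y Uy; exact: E.
  apply: near_eq_derivable ((der _ _ _).1 ((H l).2 i x Ux) j).
  by apply: filterS (open_nbhs_nbhs (conj oU Ux)) => y Uy; exact: E.
move=> H.
have E l : forall x, U x -> forall j, pd R F l x 0 j = pd R (fun x => F x 0 j) l x.
  by apply: key => l' _ i x Ux j; exact: (H j l').2.
move=> l; split=> [x Ux|i x Ux].
  apply/rV_continuousP => j; apply: near_eq_continuous ((H j l).1 x Ux).
  by apply: filterS (open_nbhs_nbhs (conj oU Ux)) => y Uy; rewrite E.
apply/der => j; apply: near_eq_derivable ((H j l).2 i x Ux).
by apply: filterS (open_nbhs_nbhs (conj oU Ux)) => y Uy; rewrite E.
Qed.

Lemma Cinf_comp {m n} (U : set 'rV[R]_m) (V : set 'rV[R]_n) (f : 'rV[R]_n -> R)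
    (F : 'rV[R]_m -> 'rV[R]_n) :
  open U -> open V -> Cinf R V f -> Cinf R U F ->
  (forall x, U x -> V (F x)) -> Cinf R U (f \o F).
Proof.
move=> oU oV /CinfP Hf /(Cinf_vecP _ _ oU) HF UV; apply/CinfP => L.
apply: Ck_comp (Hf L) _ UV => // j; move/CinfP: (HF j); exact.
Qed.

Lemma Cinf_cst {n} (U : set 'rV[R]_n) (a : R) : Cinf R U (fun=> a).
Proof. by apply/CinfP => L; exact: Ck_cst. Qed.

Lemma Cinf_coord {n} (U : set 'rV[R]_n) j : Cinf R U (fun x => x 0 j).
Proof. by apply/CinfP => L; exact: Ck_coord. Qed.

Lemma Cinf_add {n} (U : set 'rV[R]_n) (f g : 'rV[R]_n -> R) : open U ->
  Cinf R U f -> Cinf R U g -> Cinf R U (fun x => f x + g x).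
Proof. by move=> oU /CinfP Hf /CinfP Hg; apply/CinfP => L; exact: Ck_add. Qed.

Lemma Cinf_mul {n} (U : set 'rV[R]_n) (f g : 'rV[R]_n -> R) : open U ->
  Cinf R U f -> Cinf R U g -> Cinf R U (fun x => f x * g x).
Proof. by move=> oU /CinfP Hf /CinfP Hg; apply/CinfP => L; exact: Ck_mul. Qed.

Lemma Cinf_opp {n} (U : set 'rV[R]_n) (f : 'rV[R]_n -> R) : open U ->
  Cinf R U f -> Cinf R U (fun x => - f x).
Proof.
move=> oU Hf; under eq_fun do rewrite -mulN1r.
exact: (Cinf_mul _ _ _ oU (Cinf_cst _ _) Hf).
Qed.

Lemma Cinf_sub {n} (U : set 'rV[R]_n) (f g : 'rV[R]_n -> R) : open U ->
  Cinf R U f -> Cinf R U g -> Cinf R U (fun x => f x - g x).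
Proof. by move=> oU Hf Hg; exact: (Cinf_add _ _ _ oU Hf (Cinf_opp _ _ oU Hg)). Qed.

Lemma Cinf_sum {n} (U : set 'rV[R]_n) {I : Type} (r : seq I) (P : pred I)
    (f : I -> 'rV[R]_n -> R) : open U ->
  (forall i, Cinf R U (f i)) -> Cinf R U (fun x => \sum_(i <- r | P i) f i x).
Proof.
move=> oU Hf; apply/CinfP => L; apply: Ck_sum => // i; move/CinfP: (Hf i); exact.
Qed.

Lemma Cinf_prod {n} (U : set 'rV[R]_n) {I : Type} (r : seq I) (P : pred I)
    (f : I -> 'rV[R]_n -> R) : open U ->
  (forall i, Cinf R U (f i)) -> Cinf R U (fun x => \prod_(i <- r | P i) f i x).
Proof.
move=> oU Hf; elim: r => [|i r IH].
  by under eq_fun do rewrite big_nil; exact: Cinf_cst.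
by under eq_fun do rewrite big_cons; case: (P i); [exact: (Cinf_mul _ _ _ oU (Hf i) IH)|exact: IH].
Qed.

Lemma Cinf_exp {n} (U : set 'rV[R]_n) (f : 'rV[R]_n -> R) k : open U ->
  Cinf R U f -> Cinf R U (fun x => f x ^+ k).
Proof.
move=> oU Hf; elim: k => [|k IH].
  by under eq_fun do rewrite expr0; exact: Cinf_cst.
by under eq_fun do rewrite exprS; exact: Cinf_mul.
Qed.

(** Regularity of the outer function in a composition. Level 0 already asks for derivability, so
    continuity comes for free at every order; the set [A] is there for inverse and square root. *)
Fixpoint Ck1 (L : nat) (A : set R) (p : R -> R) : Prop :=
  (forall t, A t -> derivable p t 1) /\ if L is L'.+1 then Ck1 L' A (derive1 p) else True.

Lemma derive_comp1 {V : normedModType R} (p : R -> R) (f : V -> R) x v :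
  derivable p (f x) 1 -> derivable f x v ->
  is_derive x v (p \o f) ((derive1 p) (f x) * 'D_v f x).
Proof.
move=> dp df; have /derivable1_diffP dp' := dp.
have E : 'd p (f x) ('D_v f x) = derive1 p (f x) * 'D_v f x :> R.
  by rewrite deriv1E; [exact: mulrC|exact: dp].
by rewrite -E; exact: (@is_derive_comp_diff _ _ _ _ p f x v dp' df).
Qed.

Lemma Ck_comp1 {n} L (U : set 'rV[R]_n) (A : set R) f (p : R -> R) :
  open U -> Ck1 L A p -> Ck L U f -> (forall x, U x -> A (f x)) -> Ck L U (p \o f).
Proof.
move=> oU + + UA; have cpf L' p' : Ck1 L' A p' -> Ck L' U f ->
    forall x, U x -> {for x, continuous (p' \o f)}.
  move=> Hp Hf x Ux; apply: continuous_comp; first exact: Ck_continuous Hf Ux.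
  have dp : derivable p' (f x) 1 by case: L' {Hf} Hp => [|L'] [+ _]; apply; exact: UA.
  by apply: differentiable_continuous; apply/derivable1_diffP.
elim: L p => [|L IH] p Hp Hf; first by split => //; exact: cpf Hp Hf.
split=> [|i]; first exact: cpf Hp Hf.
have [dp Hp'] := Hp.
have D x : U x -> is_derive x (basis_vec R i) (p \o f) ((derive1 p) (f x) * 'd_i f x).
  move=> Ux; apply: derive_comp1; first exact/dp/UA.
  exact: Ck_derivable Hf Ux.
split=> [x Ux|]; first by have [] := D x Ux.
apply: (@Ck_ext _ _ _ (fun x => (derive1 p) (f x) * 'd_i f x)) => //.
  by move=> x Ux; have [_ ->] := D x Ux.
apply: Ck_mul => //; last by have [_ /(_ i)[]] := Hf.
by apply: (IH (derive1 p)) => //; apply: Ck_le Hf; exact: leqnSn.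
Qed.

Lemma Cinf_comp1 {n} (U : set 'rV[R]_n) (A : set R) (f : 'rV[R]_n -> R) (p : R -> R) :
  open U -> (forall L, Ck1 L A p) -> Cinf R U f -> (forall x, U x -> A (f x)) ->
  Cinf R U (p \o f).
Proof.
move=> oU Hp /CinfP Hf UA; apply/CinfP => L; exact: Ck_comp1 (Hp L) (Hf L) UA.
Qed.

Lemma near_eq_derive1 (p q : R -> R) t : (\forall s \near t, p s = q s) ->
  (derive1 p) t = (derive1 q) t.
Proof. by move=> pq; rewrite !derive1E; apply: near_eq_derive. Qed.

Lemma Ck1_ext L (A : set R) (p q : R -> R) : open A -> (forall t, A t -> p t = q t) ->
  Ck1 L A p -> Ck1 L A q.
Proof.
move=> oA; have N (p' q' : R -> R) : (forall t, A t -> p' t = q' t) ->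
    forall t, A t -> \forall s \near t, p' s = q' s.
  by move=> pq t At; apply: filterS pq _; exact: open_nbhs_nbhs.
elim: L p q => [|L IH] p q pq [dp H].
  by split=> // t At; apply: (@near_eq_derivable _ R R p q t 1 (N _ _ pq _ At) (dp _ At)).
split=> [t At|]; first exact: (@near_eq_derivable _ R R p q t 1 (N _ _ pq _ At) (dp _ At)).
by apply: IH H => t At; apply: near_eq_derive1; exact: N.
Qed.

(** Inverse, square root and [ell] are shown smooth by exhibiting explicit classes of functions
    stable under differentiation. *)
Lemma Ck1_closed (A : set R) (K : set (R -> R)) : open A ->
  (forall p, K p -> exists2 q, K q & forall t, A t -> is_derive t 1 p (q t)) ->
  forall p, K p -> forall L, Ck1 L A p.
Proof.
move=> oA HK p Kp L; elim: L p Kp => [|L IH] p Kp; have [q Kq pq] := HK p Kp.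
  by split=> // t /pq [].
split=> [t /pq []//|]; apply: (@Ck1_ext _ _ q) => //; last exact: IH.
by move=> t At; have [_] := pq t At; rewrite derive1E.
Qed.

End FiniteSmoothness.

(** * Smooth functions of one variable *)

Section OneVariable.
Context {R : realType}.

(** The difference quotient is at most [C * |h|]. This supplies the derivative at flat points, where
    no formula is available on both sides. *)
Lemma is_derive_quadratic {V : normedModType R} (f : V -> R) (x v : V) (C : R) :
  (\forall h \near (0 : R), `|f (h *: v + x) - f x| <= C * h ^+ 2) ->
  is_derive x v f 0.
Proof.
move=> H; suff cv : (fun h : R => h^-1 *: (f (h *: v + x) - f x)) @ 0^' --> (0 : R).
  by split; [apply/cvg_ex; exists 0|exact: cvg_lim cv].
apply/cvgrPdist_le => eps e0; near=> h.
have h0 : h != 0 by near: h; exact: nbhs_dnbhs_neq.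
rewrite sub0r normrN normrM normrV ?unitfE // mulrC ler_pdivrMr ?normr_gt0 //.
have Hh : `|f (h *: v + x) - f x| <= C * h ^+ 2.
  by near: h; apply: nbhs_dnbhs.
apply: (le_trans Hh); rewrite -real_normK ?num_real // expr2 mulrA.
apply: ler_wpM2r => //; apply: (@le_trans _ _ (`|C| * `|h|)).
  by rewrite ler_wpM2r // ler_norm.
have hs : `|h| <= eps / (`|C| + 1).
  near: h; apply: nbhs_dnbhs; by apply: (@nbhs0_le R R); apply: divr_gt0.
apply: (@le_trans _ _ ((`|C| + 1) * `|h|)).
  by rewrite ler_wpM2r // lerDl.
by rewrite mulrC -ler_pdivlMr // ltr_wpDl.
Unshelve. all: by end_near. Qed.

Lemma Ck1_prim L (A : set R) (p q : R -> R) : open A ->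
  (forall t, A t -> is_derive t 1 p (q t)) -> Ck1 L A q -> Ck1 L.+1 A p.
Proof.
move=> oA pq Hq; split=> [t /pq[]//|].
by apply: (@Ck1_ext _ _ _ q) => // t /pq[_ <-]; rewrite derive1E.
Qed.

Lemma Ck1_le L L' (A : set R) (p : R -> R) : (L' <= L)%N -> Ck1 L A p -> Ck1 L' A p.
Proof.
elim: L' L p => [|L' IH] [|L] // p LL [dp H]; split => //.
exact: IH H.
Qed.

Lemma Ck1_cst L (A : set R) (a : R) : Ck1 L A (fun=> a).
Proof.
elim: L a => [|L IH] a; first by split=> // t _; exact: derivable_cst.
split=> [t _|]; first exact: derivable_cst.
have -> : derive1 (fun=> a) = (fun=> 0) :> (R -> R).
  by apply/funext => t; rewrite derive1_cst.
exact: IH.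
Qed.

Lemma Ck1_add L (A : set R) (p q : R -> R) : open A ->
  Ck1 L A p -> Ck1 L A q -> Ck1 L A (fun t => p t + q t).
Proof.
move=> oA; elim: L p q => [|L IH] p q Hp Hq.
  by split=> // t At; apply: derivableD; [apply: Hp.1|apply: Hq.1].
apply: (Ck1_prim _ _ _ (fun t => derive1 p t + derive1 q t)) => //.
  move=> t At; rewrite !derive1E.
  by apply: is_deriveD; apply/derivableP; [apply: Hp.1|apply: Hq.1].
by apply: IH; [apply: Hp.2|apply: Hq.2].
Qed.

Lemma Ck1_mul L (A : set R) (p q : R -> R) : open A ->
  Ck1 L A p -> Ck1 L A q -> Ck1 L A (fun t => p t * q t).
Proof.
move=> oA; elim: L p q => [|L IH] p q Hp Hq.
  by split=> // t At; apply: derivableM; [apply: Hp.1|apply: Hq.1].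
apply: (Ck1_prim _ _ _ (fun t => p t * derive1 q t + q t * derive1 p t)) => //.
  move=> t At; rewrite !derive1E.
  have dp := derivableP (Hp.1 t At); have dq := derivableP (Hq.1 t At).
  exact: is_deriveM.
apply: Ck1_add => //; apply: IH.
- by apply: Ck1_le Hp.
- exact: Hq.2.
- by apply: Ck1_le Hq.
- exact: Hp.2.
Qed.

Lemma Ck1_affine L (p : R -> R) (a b : R) :
  (forall L, Ck1 L setT p) -> Ck1 L setT (fun t => p (a * t + b)).
Proof.
have d (t : R) : is_derive t 1 (fun t => a * t + b) a.
  by apply: is_derive_eq; rewrite /GRing.scale /= ?mulr1 ?mulr0 ?scaler0 ?addr0 ?add0r ?addr0.
have D (q : R -> R) t : derivable q (a * t + b) 1 ->
    is_derive t 1 (fun t => q (a * t + b)) (derive1 q (a * t + b) * a).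
  move=> dq; have [dt Dt] := d t; have := @derive_comp1 _ R q (fun t => a * t + b) t 1 dq dt.
  by rewrite Dt.
elim: L p => [|L IH] p Hp; first by split=> // t _; have [] := D p t ((Hp 0%N).1 _ I).
apply: (@Ck1_prim L setT (fun t => p (a * t + b)) (fun t => derive1 p (a * t + b) * a)).
- exact: openT.
- by move=> t _; apply: D; exact: (Hp 0%N).1.
- apply: Ck1_mul; [exact: openT| |exact: Ck1_cst].
  by apply: IH => L'; exact: (Hp L'.+1).2.
Qed.

Lemma is_derive_expn {V : normedModType R} (f : V -> R) (x v : V) (n : nat) (df : R) :
  is_derive x v f df -> is_derive x v (fun t => f t ^+ n) (n%:R * f x ^+ n.-1 * df).
Proof.
move=> d; have := @is_deriveX _ _ f n x v df d.
by have -> : f ^+ n = (fun t => f t ^+ n) by apply/funext => t; rewrite exprfctE.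
Qed.

Lemma is_derive_cmul {V : normedModType R} (f : V -> R) (x v : V) (c df : R) :
  is_derive x v f df -> is_derive x v (fun t => c * f t) (c * df).
Proof. by move=> d; exact: is_deriveZ. Qed.

Lemma Ck1_inv L : Ck1 L [set t : R | t != 0] GRing.inv.
Proof.
pose K := [set p : R -> R | exists c n, p = fun t => c * t^-1 ^+ n].
have K1 : K GRing.inv by exists 1, 1%N; apply/funext => t; rewrite mul1r.
apply: (Ck1_closed _ K) K1 L; first exact: open_neq.
move=> p [c [n ->]]; exists (fun t => (- c * n%:R) * t^-1 ^+ n.+1).
  by exists (- c * n%:R), n.+1.
move=> t /= t0.
have d : is_derive t 1 (fun t : R => t^-1) (- t ^- 2).
  by apply: is_derive_eq; first exact: is_deriveV; rewrite /GRing.scale /= mulr1.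
apply: (is_derive_eq (is_derive_cmul _ _ _ c _ (is_derive_expn _ _ _ n _ d))).
rewrite -exprVn.
case: n => [|n]; first by rewrite mulr0 !mul0r mulr0.
by rewrite succnK !exprS; ring.
Qed.

Lemma Ck1_sqrt L : Ck1 L [set t : R | 0 < t] Num.sqrt.
Proof.
(* These are the half-integer powers [c * t ^ ((1 - n) / 2)]. *)
pose K := [set p : R -> R | exists c n, p = fun t => c * ((Num.sqrt t)^-1 ^+ n * Num.sqrt t)].
have K1 : K Num.sqrt by exists 1, 0%N; apply/funext => t; rewrite mul1r mul1r.
apply: (Ck1_closed _ K) K1 L; first exact: open_gt.
move=> p [c [n ->]]; exists (fun t => (c * (1 - n%:R) / 2) * ((Num.sqrt t)^-1 ^+ n.+2 * Num.sqrt t)).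
  by exists (c * (1 - n%:R) / 2), n.+2.
move=> t /= t0.
have s0 : Num.sqrt t != 0 by rewrite gt_eqF // sqrtr_gt0.
have d1 := is_derive1_sqrt t0.
have d : is_derive t 1 (fun t : R => (Num.sqrt t)^-1) (- (Num.sqrt t) ^- 2 * (2 * Num.sqrt t)^-1).
  exact: is_deriveV.
have d2 := is_derive_expn _ _ _ n _ d.
have d3 := @is_deriveM _ _ _ _ _ _ _ _ d2 d1.
apply: (is_derive_eq (is_derive_cmul _ _ _ c _ d3)); rewrite /GRing.scale /=.
case: n {d2 d3} => [|n]; first by rewrite subr0 !expr2 !expr0 /=; field.
rewrite succnK !exprS -natr1; set s := Num.sqrt t in s0 *.
by set u := s^-1 ^+ n; field.
Qed.

End OneVariable.

(** * The functions of the cutoff construction *)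

Section Ell.
Context {R : realType}.
Local Notation ell := (ell R).

Lemma ell_le0 t : t <= 0 -> ell t = 0.
Proof. by rewrite /Defs.ell => ->. Qed.

Lemma ell_gt0 t : (0 < ell t) = (0 < t).
Proof. by rewrite /Defs.ell; have [t0|t0] := leP t 0; [exact: ltxx|exact: expR_gt0]. Qed.

Lemma ell_ge0 t : 0 <= ell t.
Proof. by rewrite /Defs.ell; case: ifP => // _; exact: expR_ge0. Qed.

Lemma horner_bound (p : {poly R}) : exists C m, 0 <= C /\
  forall x, 1 <= x -> `|p.[x]| <= C * x ^+ m.
Proof.
elim/poly_ind: p => [|p c [C [m [C0 H]]]].
  by exists 0, 0%N; split=> // x _; rewrite horner0 normr0 mul0r.
exists (C + `|c|), m.+1; split; first by rewrite addr_ge0.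
move=> x x1; have x0 : 0 <= x by lra.
rewrite hornerMXaddC; apply: (le_trans (ler_normD _ _)); rewrite mulrDl lerD //.
  by rewrite normrM (ger0_norm x0) exprSr mulrA ler_wpM2r // H.
by rewrite ler_peMr // exprn_ege1.
Qed.

Lemma Ck1_ell L : Ck1 L setT ell.
Proof.
(* On [t > 0] the derivatives of [ell] have this form: differentiation sends the polynomial [p] to
   ['X ^+ 2 * (p - deriv p)]. *)
pose T p := fun t : R => if t <= 0 then 0 else (p : {poly R}).[t^-1] * expR (- t^-1).
pose K := [set f : R -> R | exists p, f = T p].
have K1 : K ell.
  exists 1; apply/funext => t; rewrite /Defs.ell /T hornerE.
  by case: ifP => // _; rewrite mul1r.
apply: (Ck1_closed _ K) K1 L; first exact: openT.
move=> _ [p ->]; exists (T ('X ^+ 2 * (p - deriv p))); first by exists ('X ^+ 2 * (p - deriv p)).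
move=> t _; have [t0|t0|->] := ltgtP t 0.
- have -> : T ('X ^+ 2 * (p - deriv p)) t = 0 by rewrite /T ltW.
  apply: (@near_eq_is_derive _ R R (fun=> 0)) => //.
    by near=> s; rewrite /T ifT // ltW //; near: s; exact: lt_nbhsl.
- have -> : T ('X ^+ 2 * (p - deriv p)) t = ('X ^+ 2 * (p - deriv p)).[t^-1] * expR (- t^-1).
    by rewrite /T leNgt t0.
  apply: (@near_eq_is_derive _ R R (fun t => p.[t^-1] * expR (- t^-1))) => //.
    near=> s; rewrite /T ifF //; apply/negbTE; rewrite -ltNge; near: s; exact: lt_nbhsr.
  have tn0 : t != 0 by rewrite gt_eqF.
  have d : is_derive t 1 (fun t : R => t^-1) (- t ^- 2).
    by apply: is_derive_eq; first exact: is_deriveV; rewrite /GRing.scale /= mulr1.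
  have d1 : is_derive t 1 (horner p \o GRing.inv) ((deriv p).[t^-1] * (- t ^- 2)).
    by apply: is_derive1_comp.
  have d2 : is_derive t 1 (expR \o (fun t => - t^-1)) (expR (- t^-1) * (- - t ^- 2)).
    by apply: is_derive1_comp.
  apply: (@is_derive_eq _ _ _ _ _ _ _ _ (is_deriveM d1 d2)).
  rewrite /GRing.scale /= hornerM hornerXn hornerD hornerN -exprVn.
  ring.
- have -> : T ('X ^+ 2 * (p - deriv p)) 0 = 0 by rewrite /T lexx.
  have [C [m [C0 HC]]] := horner_bound p.
  apply: (@is_derive_quadratic _ R _ _ _ (C * (m.+2)`!%:R)).
  near=> h; rewrite scaler1 addr0 {2}/T lexx subr0.
  rewrite /T; have [h0|h0] := leP h 0; first by rewrite normr0; apply: mulr_ge0; [exact: mulr_ge0|exact: sqr_ge0].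
  have h1 : 1 <= h^-1.
    by rewrite invf_ge1 // ltW //; near: h; apply: lt_nbhsl; exact: ltr01.
  rewrite normrM (ger0_norm (expR_ge0 _)).
  (* [expR h^-1] dominates [h^-1 ^+ m.+2] up to the factorial: two powers more than the polynomial
     uses up, which leaves the quadratic bound. *)
  apply: (@le_trans _ _ (C * h^-1 ^+ m * ((m.+2)`!%:R * h ^+ m.+2))).
    apply: ler_pM => //; first exact: HC.
    have hm : 0 < (m.+2)`!%:R * h ^+ m.+2.
      by apply: mulr_gt0; [rewrite ltr0n fact_gt0|exact: exprn_gt0].
    rewrite expRN -lef_pV2 ?posrE ?invr_gt0 ?expR_gt0 //.
    rewrite invrK; apply: le_trans (expR_ge1Dxn m.+1 _); last by rewrite invr_ge0 ltW.
    by rewrite invfM -exprVn mulrC lerDr.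
  have hn0 : h != 0 by rewrite gt_eqF.
  suff -> : C * h^-1 ^+ m * ((m.+2)`!%:R * h ^+ m.+2) = C * (m.+2)`!%:R * h ^+ 2 by [].
  by rewrite (exprD h 2 m) exprVn; field; rewrite expf_neq0.
Unshelve. all: by end_near. Qed.

End Ell.

(** * The derivative of an oriented integral *)

Section Primitives.
Context {R : realType}.
Local Notation mu := (@lebesgue_measure R).
Local Notation oint := (oint R).

Lemma is_derive_oint (f : R -> R) (t : R) : continuous f -> is_derive t 1 (oint f 0) (f t).
Proof.
(* A base point below both [t] and 0: near [t] the oriented integral is [F y - F 0], whatever the
   sign of [y]. *)
move=> cf; pose a := Num.min t 0 - 1.
have at_ : a < t by rewrite /a; case: (leP t 0); lra.
have a0 : a < 0 by rewrite /a; case: (leP t 0); lra.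
have If (x y : R) : mu.-integrable `[x, y] (EFin \o f).
  apply: continuous_compact_integrable; first exact: segment_compact.
  by apply: continuous_subspaceT.
pose F y := \int[mu]_(x in `[a, y]) f x.
have t1 : t < t + 1 by rewrite ltrDl.
have H := @continuous_FTC1 R f (BLeft a) t (t + 1) t1 (If _ _).
have [|dF FE] := H _ (cf t).
  by rewrite /Order.lt.
have FB (x y : R) : a <= x -> x <= y -> F y - F x = \int[mu]_(x in `[x, y]) f x.
  move=> ax xy; have := @Rintegral_itvB R f (BLeft a) (BRight y) x (If a y).
  rewrite !bnd_simp => /(_ ax xy) ->.
  by apply: Rintegral_itv_obnd_cbnd; apply: integrableS (If x y) => //; exact: subset_itv_oc_cc.
have dF1 : is_derive t 1 F (f t) by split; [exact: dF|rewrite -derive1E].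
have dF2 : is_derive t 1 (fun y => F y - F 0) (f t).
  by apply: (is_derive_eq (is_deriveB dF1 (is_derive_cst (F 0) t 1))); rewrite subr0.
apply: near_eq_is_derive dF2.
near=> y; have ay : a < y by near: y; exact: lt_nbhsr.
rewrite /Defs.oint; have [y0|y0] := leP 0 y; first by rewrite FB // ltW.
by rewrite -FB ?opprB // ltW.
Unshelve. all: by end_near. Qed.

End Primitives.

(** * Monotonicity, Lipschitz bound and affine range of [phi] *)

Section Phi.
Context {R : realType}.
Local Notation phi := (phi R).
Local Notation lam := (lam R).
Local Notation bump := (Defs.bump R).
Local Notation ell := (ell R).

Lemma le_of_derive (f g : R -> R) (a b : R) : (forall t : R, is_derive t 1 f (g t)) ->
  (forall t, a < t < b -> 0 <= g t) -> a <= b -> f a <= f b.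
Proof.
move=> fg g0 ab; apply: (@ger0_derive1_ndecr _ f a b) => //.
- move=> x xab; rewrite derive1E; have [_ ->] := fg x.
  by apply: g0; rewrite in_itv in xab.
- by apply: continuous_subspaceT => x; apply: differentiable_continuous; apply/derivable1_diffP; have [] := fg x.
Qed.

Lemma lt_of_derive (f g : R -> R) (a b : R) : (forall t : R, is_derive t 1 f (g t)) ->
  (forall t, a < t < b -> 0 < g t) -> a < b -> f a < f b.
Proof.
move=> fg g0 ab; apply: (@gtr0_derive1_lt_cc _ f a b) => //.
- move=> x xab; rewrite derive1E; have [_ ->] := fg x.
  by apply: g0; rewrite in_itv in xab.
- by apply: continuous_subspaceT => x; apply: differentiable_continuous; apply/derivable1_diffP; have [] := fg x.
- by rewrite in_itv /= lexx ltW.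
- by rewrite in_itv /= lexx ltW.
Qed.

Lemma Ck1_continuous (p : R -> R) : Ck1 0 setT p -> continuous p.
Proof.
by case=> dp _ x; apply: differentiable_continuous; apply/derivable1_diffP/dp.
Qed.

Lemma Ck1_bump L : Ck1 L setT bump.
Proof.
apply: Ck1_mul; first exact: openT.
  apply: (Ck1_ext _ _ (fun t => ell (3 * t + 0))); [exact: openT| |].
    by move=> t _; rewrite addr0.
  by apply: Ck1_affine => L'; exact: Ck1_ell.
apply: (Ck1_ext _ _ (fun t => ell (- 3 * t + 3))); [exact: openT| |].
  by move=> t _; rewrite mulNr addrC.
by apply: Ck1_affine => L'; exact: Ck1_ell.
Qed.

Lemma bump_ge0 t : 0 <= bump t.
Proof. by rewrite /Defs.bump mulr_ge0 // ell_ge0. Qed.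

Lemma bump_gt0 t : 0 < t < 1 -> 0 < bump t.
Proof. by move=> t01; rewrite /Defs.bump mulr_gt0 // ell_gt0; lra. Qed.

Lemma bump_le0 t : t <= 0 -> bump t = 0.
Proof. by move=> t0; rewrite /Defs.bump ell_le0 ?mul0r //; lra. Qed.

Lemma bump_ge1 t : 1 <= t -> bump t = 0.
Proof. by move=> t1; rewrite /Defs.bump [X in _ * X]ell_le0 ?mulr0 //; lra. Qed.

Let B := oint R bump 0.

Let B' (t : R) : is_derive t 1 B (bump t).
Proof. by apply: is_derive_oint; apply: Ck1_continuous; exact: Ck1_bump. Qed.

Lemma oint00 (f : R -> R) : oint R f 0 0 = 0.
Proof. by rewrite /oint lexx set_itv1 Rintegral_set1. Qed.

Let B_le a b : a <= b -> B a <= B b.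
Proof. by apply: le_of_derive B' _ => t _; exact: bump_ge0. Qed.

Let B_lt a b : 0 <= a -> a < b -> b <= 1 -> B a < B b.
Proof. by move=> a0 ab b1; apply: lt_of_derive B' _ ab => t tab; apply: bump_gt0; lra. Qed.

Let B0 : B 0 = 0. Proof. exact: oint00. Qed.

Let B_le0 t : t <= 0 -> B t = 0.
Proof.
move=> t0; have h1 := B_le _ _ t0.
have h2 : - B t <= - B 0.
  apply: (@le_of_derive (fun t => - B t) (fun t => - bump t)) t0.
    by move=> s; apply: is_deriveN.
  by move=> s /andP[_ s0]; rewrite bump_le0 ?oppr0 // ltW.
by rewrite B0 in h1 h2; lra.
Qed.

Let B_ge1 t : 1 <= t -> B t = B 1.
Proof.
move=> t1; have h1 := B_le _ _ t1.
have h2 : - B 1 <= - B t.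
  apply: (@le_of_derive (fun t => - B t) (fun t => - bump t)) t1.
    by move=> s; apply: is_deriveN.
  by move=> s /andP[s1 _]; rewrite bump_ge1 ?oppr0 // ltW.
by lra.
Qed.

Let alpha0E : alpha0 R = B 1. Proof. by []. Qed.

Let B1_gt0 : 0 < B 1.
Proof. by have := B_lt 0 1; rewrite B0; apply. Qed.

Lemma is_derive_lam (t : R) : is_derive t 1 lam ((alpha0 R)^-1 * bump t).
Proof.
exact: (is_derive_cmul _ _ _ _ _ (B' t)).
Qed.

Lemma lam_le0 t : t <= 0 -> lam t = 0.
Proof. by move=> t0; rewrite /Defs.lam -/(B t) B_le0 ?mulr0. Qed.

Lemma lam_ge1 t : 1 <= t -> lam t = 1.
Proof. by move=> t0; rewrite /Defs.lam alpha0E -/(B t) B_ge1 // mulVf // gt_eqF. Qed.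

Lemma lam_ge0 t : 0 <= lam t.
Proof.
rewrite /Defs.lam alpha0E -/(B t); apply: mulr_ge0.
  by rewrite invr_ge0; exact: ltW B1_gt0.
have [t0|t0] := leP t 0; first by rewrite B_le0.
by have := B_le _ _ (ltW t0); rewrite B0.
Qed.

Lemma lam_le1 t : lam t <= 1.
Proof.
have [t1|/ltW/lam_ge1 -> //] := leP t 1.
by rewrite /Defs.lam alpha0E -/(B t) mulrC ler_pdivrMr // mul1r B_le.
Qed.

Lemma lam_gt0 t : 0 < t -> t <= 1 -> 0 < lam t.
Proof.
move=> t0 t1; rewrite /Defs.lam alpha0E -/(B t) mulr_gt0 ?invr_gt0 //.
by have := B_lt 0 t; rewrite B0; apply.
Qed.

Lemma lam_lt1 t : 0 <= t -> t < 1 -> lam t < 1.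
Proof.
move=> t0 t1; rewrite /Defs.lam alpha0E -/(B t) mulrC ltr_pdivrMr // mul1r B_lt //.
Qed.

Lemma Ck1_lam L : Ck1 L setT lam.
Proof.
apply: (@Ck1_le _ L.+1) => //; apply: Ck1_prim (fun t _ => is_derive_lam t) _; first exact: openT.
by apply: Ck1_mul; [exact: openT|exact: Ck1_cst|exact: Ck1_bump].
Qed.

Lemma is_derive_phi (c : R) : is_derive c 1 phi (lam (2^-1 + c)).
Proof.
have dl (t : R) : is_derive t 1 (oint R lam 0) (lam t).
  by apply: is_derive_oint; apply: Ck1_continuous; exact: Ck1_lam.
have -> : phi = oint R lam 0 \o shift 2^-1.
  by apply/funext => t; rewrite /Defs.phi /= addrC.
have := @is_derive1_comp R (oint R lam 0) (shift 2^-1) c _ _ (dl _) (is_derive_shift c 1 2^-1).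
by rewrite mulr1 /= addrC.
Qed.

Lemma Ck1_phi L : Ck1 L setT phi.
Proof.
apply: (@Ck1_le _ L.+1) => //; apply: Ck1_prim (fun t _ => is_derive_phi t) _; first exact: openT.
apply: (Ck1_ext _ _ (fun t => lam (1 * t + 2^-1))); [exact: openT| |].
  by move=> t _; rewrite mul1r addrC.
by apply: Ck1_affine; exact: Ck1_lam.
Qed.

Lemma phi_continuous : continuous phi.
Proof. exact: Ck1_continuous (Ck1_phi 0%N). Qed.

Lemma phi_le a b : a <= b -> phi a <= phi b.
Proof. by apply: le_of_derive is_derive_phi _ => t _; exact: lam_ge0. Qed.

Let is_derive_subphi (c : R) : is_derive c 1 (fun c => c - phi c) (1 - lam (2^-1 + c)).
Proof. by have d := is_derive_phi c; apply: is_deriveB. Qed.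

Lemma phi_lip a b : a <= b -> phi b - phi a <= b - a.
Proof.
move=> ab; have : a - phi a <= b - phi b; last by lra.
apply: (le_of_derive _ _ _ _ is_derive_subphi _ ab) => t _.
by rewrite subr_ge0 lam_le1.
Qed.

Lemma phi_mhalf : phi (- 2^-1) = 0.
Proof. by rewrite /Defs.phi subrr oint00. Qed.

Lemma phi_ge0 c : 0 <= phi c.
Proof.
have [c0|c0] := leP c (- 2^-1); last by rewrite -phi_mhalf phi_le // ltW.
have : - phi c <= - phi (- 2^-1).
  apply: (@le_of_derive (fun t => - phi t) (fun t => - lam (2^-1 + t))) c0.
    by move=> t; have d := is_derive_phi t; apply: is_deriveN.
  by move=> t tc; rewrite lam_le0 ?oppr0 //; lra.
by rewrite phi_mhalf; lra.
Qed.

Lemma phi_le0 c : c <= - 2^-1 -> phi c = 0.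
Proof. by move=> c0; apply/eqP; rewrite eq_le phi_ge0 -phi_mhalf phi_le. Qed.

(** The offset of [phi] from the identity on the range [c >= 1/2]. It is 0 by the symmetry of [bump]
    about 1/2, but the geometry of the disk only calls for the bounds [kap_gt] and [kap_lt]. *)
Definition kap : R := phi 2^-1 - 2^-1.

Lemma phi_ge_half c : 2^-1 <= c -> phi c = c + kap.
Proof.
move=> c2; suff : phi c - c = phi 2^-1 - 2^-1 by rewrite /kap => <-; lra.
have h1 := phi_lip _ _ c2; suff : phi 2^-1 - 2^-1 <= phi c - c by lra.
apply: (@le_of_derive (fun t => phi t - t) (fun t => lam (2^-1 + t) - 1)) c2.
  by move=> t; have d := is_derive_phi t; apply: is_deriveB.
by move=> t tc; rewrite lam_ge1 ?subrr //; lra.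
Qed.

(** Since [lam <= 1], [c - phi c] is nondecreasing, and from 1/2 on it is constantly [- kap]. *)
Lemma phi_ge_shift c : c + kap <= phi c.
Proof.
have [/phi_ge_half ->//|/ltW/phi_lip] := leP 2^-1 c.
by rewrite /kap; lra.
Qed.

Lemma kap_gt : - 2^-1 < kap.
Proof.
have : phi (- 2^-1) < phi 2^-1.
  by apply: lt_of_derive is_derive_phi _ _ => [t tc|]; [apply: lam_gt0|]; lra.
by rewrite phi_mhalf /kap; lra.
Qed.

Lemma kap_lt : kap < 2^-1.
Proof.
have : - 2^-1 - phi (- 2^-1) < 2^-1 - phi 2^-1.
  apply: (lt_of_derive _ _ _ _ is_derive_subphi) => [t tc|]; last lra.
  by rewrite subr_gt0; apply: lam_lt1; lra.
by rewrite phi_mhalf /kap; lra.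
Qed.

End Phi.

(** * Whitney's theorem on even functions *)

Section IteratedPartials.
Context {R : realType} {n : nat}.
Local Notation e := (@basis_vec R n).
Implicit Types (U : set 'rV[R]_n) (f g : 'rV[R]_n -> R).

Lemma pd_ext U f g l : open U -> (forall x, U x -> f x = g x) ->
  forall x, U x -> pd R f l x = pd R g l x.
Proof.
move=> oU fg; elim: l => //= i l IH x Ux; apply: near_eq_derive.
by apply: filterS (open_nbhs_nbhs (conj oU Ux)) => y; exact: IH.
Qed.

Lemma pd_add U f g l : open U -> Cinf R U f -> Cinf R U g ->
  forall x, U x -> pd R (fun x => f x + g x) l x = pd R f l x + pd R g l x.
Proof.
move=> oU Uf Ug; elim: l => //= i l IH x Ux.
rewrite -deriveD; [|exact: (Uf l).2|exact: (Ug l).2].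
apply: near_eq_derive.
by apply: filterS (open_nbhs_nbhs (conj oU Ux)) => y Uy; rewrite IH.
Qed.

Lemma pd_cmul U f c l : open U -> Cinf R U f ->
  forall x, U x -> pd R (fun x => c * f x) l x = c * pd R f l x.
Proof.
move=> oU Uf; elim: l => //= i l IH x Ux.
have [_ <-] := is_derive_cmul _ _ _ c _ (derivableP ((Uf l).2 i x Ux)).
apply: near_eq_derive.
by apply: filterS (open_nbhs_nbhs (conj oU Ux)) => y Uy; rewrite IH.
Qed.

Lemma pd_sum U {I : Type} (r : seq I) (f : I -> 'rV[R]_n -> R) l : open U ->
  (forall i, Cinf R U (f i)) ->
  forall x, U x -> pd R (fun x => \sum_(i <- r) f i x) l x = \sum_(i <- r) pd R (f i) l x.
Proof.
move=> oU Uf x Ux; elim: r => [|i r IH].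
  rewrite big_nil; under eq_fun do rewrite big_nil.
  apply: etrans (etrans (@pd_cmul U (fun=> 0) 0 l oU (Cinf_cst _ _) x Ux) (mul0r _)).
  by apply: (@pd_ext U) => // y _; rewrite mul0r.
rewrite big_cons -IH; under eq_fun do rewrite big_cons.
by apply: (pd_add U) => //; exact: Cinf_sum.
Qed.

Lemma dist_le_two (eps P Q z : R) : `|P - z| < eps -> `|Q - z| < eps -> `|P - Q| <= eps + eps.
Proof.
move=> Pz Qz; rewrite -(subrK z P) -addrA; apply: (le_trans (ler_normD _ _)).
by apply: lerD; [exact: ltW|rewrite distrC; exact: ltW].
Qed.

(** The second difference over a small square is symmetric in the two directions. Two mean value
    steps, taken in either order, turn it into [a ^+ 2] times one or the other mixed partial at
    points near [x]. *)
Lemma derive_commute U f i j x : open U -> Cinf R U f -> U x ->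
  'D_(e i) ('D_(e j) f) x = 'D_(e j) ('D_(e i) f) x.
Proof.
move=> oU Uf Ux.
have Cf a b : {for x, continuous ('D_(e a) ('D_(e b) f))}.
  exact: (Uf [:: a; b]).1.
suff H eps : 0 < eps -> `|'D_(e i) ('D_(e j) f) x - 'D_(e j) ('D_(e i) f) x| <= eps + eps.
  apply/eqP; rewrite -subr_eq0 -normr_le0; apply/ler_addgt0Pr => eps e0.
  by rewrite add0r (splitr eps); apply: H; rewrite divr_gt0.
move=> e0.
have [d d0 Hd] : exists2 d : R, 0 < d & forall y, `|x - y| < d -> U y /\
    `|'D_(e i) ('D_(e j) f) x - 'D_(e i) ('D_(e j) f) y| < eps /\
    `|'D_(e j) ('D_(e i) f) x - 'D_(e j) ('D_(e i) f) y| < eps.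
  have : \forall y \near x, U y /\
    `|'D_(e i) ('D_(e j) f) x - 'D_(e i) ('D_(e j) f) y| < eps /\
    `|'D_(e j) ('D_(e i) f) x - 'D_(e j) ('D_(e i) f) y| < eps.
    apply: filterI; first exact: open_nbhs_nbhs.
    by apply: filterI; [move/cvgrPdist_lt: (Cf i j)|move/cvgrPdist_lt: (Cf j i)]; apply.
  by move/rV_nearP.
(* Two moves of length at most [a] stay within distance [d] of [x]. *)
pose a := d / 3; have a0 : 0 < a by rewrite divr_gt0.
have e1 k : `|e k| <= 1.
  by apply: rV_norm_le => // k'; rewrite !mxE eqxx /=; case: eqP; rewrite ?normr1 ?normr0.
have small (h k : R) (p q : 'I_n) : `|h| <= a -> `|k| <= a ->
    `|x - (h *: e p + (k *: e q + x))| < d.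
  move=> ha ka; rewrite addrA distrC addrK; apply: (le_lt_trans (ler_normD _ _)).
  rewrite !normrZ; apply: (@le_lt_trans _ _ (a + a)).
    by apply: lerD; rewrite -[leRHS]mulr1; apply: ler_pM.
  by rewrite /a; lra.
have aa : `|a| <= a by rewrite ger0_norm // ltW.
have na0 : `|0 : R| <= a by rewrite normr0 ltW.
have dd p q y : `|x - y| < d -> derivable ('D_(e p) f) y (e q).
  by case/Hd => Uy _; apply: (Uf [:: p]).2.
have d1 p y : `|x - y| < d -> derivable f y (e p).
  by case/Hd => Uy _; apply: (Uf [::]).2.
have key p q : exists y, `|x - y| < d /\
    f (a *: e p + (a *: e q + x)) - f (a *: e p + x) - f (a *: e q + x) + f x
    = a * (a * 'D_(e q) ('D_(e p) f) y).
  pose ph y := f (a *: e q + y) - f y.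
  have dph (h : R) : `|h| <= `|a| ->
      is_derive (h *: e p + x) (e p) ph ('D_(e p) f (a *: e q + (h *: e p + x)) - 'D_(e p) f (h *: e p + x)).
    rewrite (ger0_norm (ltW a0)) => ha.
    have D2 : is_derive (h *: e p + x) (e p) f ('D_(e p) f (h *: e p + x)).
      by apply/derivableP/d1; have := small h 0 p q ha na0; rewrite scale0r add0r.
    have D1 : is_derive (h *: e p + x) (e p) (fun y => f (a *: e q + y)) ('D_(e p) f (a *: e q + (h *: e p + x))).
      have := derivableP (d1 p _ (small a h q p aa ha)); case=> D1 _.
      have E : (fun k : R => k^-1 *: (f (a *: e q + (k *: e p + (h *: e p + x))) - f (a *: e q + (h *: e p + x))))
        = (fun k : R => k^-1 *: (f (k *: e p + (a *: e q + (h *: e p + x))) - f (a *: e q + (h *: e p + x)))).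
        by apply/funext => k; rewrite addrCA.
      by split; [rewrite /derivable E|rewrite /derive E].
    exact: is_deriveB.
  have [h ha] := @derive_line_mvt _ _ ph x (e p) a (fun h ha => @ex_derive _ _ _ _ _ _ _ (dph h ha)).
  have [_ ->] := dph h ha; rewrite (ger0_norm (ltW a0)) in ha => Eh.
  have [|k ka Ek] := @derive_line_mvt _ _ ('D_(e p) f) (h *: e p + x) (e q) a.
    by move=> k ka; apply: dd; apply: small => //; rewrite (le_trans ka).
  exists (k *: e q + (h *: e p + x)); split.
    by apply: small => //; rewrite (le_trans ka).
  rewrite -Ek -Eh /ph (addrCA (a *: e q)); ring.
have [y1 [y1d E1]] := key i j; have [y2 [y2d E2]] := key j i.
have EE : 'D_(e j) ('D_(e i) f) y1 = 'D_(e i) ('D_(e j) f) y2.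
  have an0 : a != 0 by rewrite gt_eqF.
  apply: (@mulfI R a an0); apply: (@mulfI R a an0).
  apply: (etrans (esym E1)); apply: (etrans _ E2).
  by rewrite (addrCA (a *: e i)) (addrAC (f _)).
have [_ [_ H1]] := Hd _ y1d; have [_ [H2 _]] := Hd _ y2d.
by apply: dist_le_two H2 _; rewrite -EE.
Qed.

Lemma pd_commute U f i j k x : open U -> Cinf R U f -> U x ->
  pd R f (rcons (nseq k j) i) x = pd R f (i :: nseq k j) x.
Proof.
move=> oU Uf; elim: k x => //= k IH x Ux.
apply: (etrans _ (@derive_commute U _ _ _ _ oU (Cinf_pd _ _ _ Uf) Ux)).
apply: near_eq_derive.
by apply: filterS (open_nbhs_nbhs (conj oU Ux)) => y; exact: IH.
Qed.

End IteratedPartials.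

(** * Gluing along the hyperplane [x 0 i0 = 0], with [i0] as normal direction *)

Section FlatGluing.
Context {R : realType} {n : nat} (i0 : 'I_n).
Local Notation e := (@basis_vec R n).
Implicit Types (W : set 'rV[R]_n) (k r : 'rV[R]_n -> R) (x z : 'rV[R]_n).

Definition upd (x : 'rV[R]_n) (a : R) : 'rV[R]_n :=
  \row_j (if j == i0 then a else x 0 j).

Lemma upd_i0 x a : upd x a 0 i0 = a.
Proof. by rewrite mxE eqxx. Qed.

Lemma upd_upd x a b : upd (upd x a) b = upd x b.
Proof. by apply/rowP => j; rewrite !mxE; case: eqP. Qed.

Lemma upd_id x : upd x (x 0 i0) = x.
Proof. by apply/rowP => j; rewrite !mxE; case: eqP => [->|]. Qed.

Lemma upd_on x : x 0 i0 = 0 -> upd x 0 = x.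
Proof. by move=> x0; have := upd_id x; rewrite x0. Qed.

Lemma upd_addl x a h : h *: e i0 + upd x a = upd x (h + a).
Proof. by apply/rowP => j; rewrite !mxE eqxx /=; case: eqP; rewrite ?mulr1 ?mulr0 ?add0r. Qed.

Lemma add_upd x h : h *: e i0 + x = upd x (h + x 0 i0).
Proof. by rewrite -upd_addl upd_id. Qed.

Lemma e_coord i j : e i 0 j = (i == j)%:R.
Proof. by rewrite mxE eqxx /= eq_sym. Qed.

Lemma norm_e_le i : `|e i| <= 1.
Proof. by apply: rV_norm_le => // j; rewrite e_coord; case: eqP; rewrite ?normr1 ?normr0. Qed.

Lemma upd_dist (x z : 'rV[R]_n) (a d : R) : 0 < d -> `|z - x| < d -> `|z 0 i0 - a| < d ->
  `|z - upd x a| < d.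
Proof.
move=> d0 zx za; apply: (@le_lt_trans _ _ (Num.max `|z - x| `|z 0 i0 - a|)); last first.
  by rewrite gt_max zx.
apply: rV_norm_le => [|j]; first by rewrite le_max normr_ge0.
rewrite !mxE le_max; case: eqP => [->|_]; first by rewrite lexx orbT.
by have := rV_coord_le (z - x) j; rewrite !mxE => ->.
Qed.

Definition cylinder W := forall x a, W x -> W (upd x a).

Lemma open_coord W (A : set R) : open W -> open A -> open (W `&` [set x : 'rV[R]_n | A (x 0 i0)]).
Proof.
move=> oW oA; apply: openI => //.
by apply: (@open_comp _ _ (fun x : 'rV[R]_n => x 0 i0)) => // x _; exact: coord_continuous.
Qed.

Lemma glue_flat0 W r : open W ->
  (forall x, W x -> x 0 i0 = 0 -> r x = 0) ->
  Ck 0 (W `&` [set x : 'rV[R]_n | x 0 i0 != 0]) r ->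
  (forall z, W z -> z 0 i0 = 0 ->
     exists C, \forall x \near z, (x : 'rV[R]_n) 0 i0 != 0 -> `|r x| <= C * x 0 i0 ^+ 2) ->
  Ck 0 W r.
Proof.
move=> oW r0 Hr Hb.
split=> // x Wx; have [x0|x0] := eqVneq (x 0 i0) 0; last by apply: (Ck_continuous _ _ _ _ Hr).
rewrite /prop_for /continuous_at r0 //; have [C HC] := Hb x Wx x0.
have cC : {for x, continuous (fun y : 'rV[R]_n => C * y 0 i0 ^+ 2)}.
  apply: continuousM; first exact: cst_continuous.
  by apply: continuousM; exact: coord_continuous.
apply/(@cvgrPdist_lt _ R _ (nbhs x)) => eps e0; move/cvgrPdist_lt: cC => /(_ eps e0).
rewrite x0 expr2 mul0r mulr0.
apply: filterS3 HC (open_nbhs_nbhs (conj oW Wx)) => y HC Wy; rewrite !sub0r !normrN => Hy.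
have [y0|/HC yC] := eqVneq (y 0 i0) 0; first by rewrite r0 // normr0.
by apply: (le_lt_trans yC); exact: le_lt_trans (ler_norm _) Hy.
Qed.

(** The quadratic bound makes every first derivative of [r] exist and vanish on the hyperplane; the
    derivatives then satisfy the same hypotheses with one order less. *)
Lemma glue_flat L W r : open W ->
  (forall x, W x -> x 0 i0 = 0 -> r x = 0) ->
  Ck L (W `&` [set x : 'rV[R]_n | x 0 i0 != 0]) r ->
  (forall l, (size l <= L)%N -> forall z, W z -> z 0 i0 = 0 ->
     exists C, \forall x \near z, (x : 'rV[R]_n) 0 i0 != 0 -> `|pd R r l x| <= C * x 0 i0 ^+ 2) ->
  Ck L W r.
Proof.
move=> oW; elim: L r => [|L IH] r r0 Hr Hb.
  by apply: glue_flat0 => //; exact: (Hb [::]).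
have cr : Ck 0 W r.
  by apply: glue_flat0 => //; [apply: Ck_le Hr|exact: (Hb [::])].
have D i z : W z -> z 0 i0 = 0 -> is_derive z (e i) r 0.
  move=> Wz z0; have [C HC] := Hb [::] isT z Wz z0.
  have /rV_nearP[d d0 Hd] : \forall x \near z, W x /\ ((x : 'rV[R]_n) 0 i0 != 0 -> `|r x| <= C * x 0 i0 ^+ 2).
    by apply: filterI HC; exact: open_nbhs_nbhs.
  apply: (@is_derive_quadratic _ _ _ _ _ `|C|); rewrite r0 //.
  near=> h; rewrite subr0.
  have hd : `|h| < d by near: h; exact: (@nbhs0_lt R R).
  have [|Wx xC] := Hd (h *: e i + z).
    rewrite distrC addrK normrZ; apply: le_lt_trans hd.
    by rewrite -[leRHS]mulr1 ler_wpM2l // norm_e_le.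
  have E : (h *: e i + z) 0 i0 = h * (i == i0)%:R by rewrite !mxE eqxx /= z0 addr0 eq_sym.
  have C0 : 0 <= `|C| * h ^+ 2 by rewrite mulr_ge0 // sqr_ge0.
  have [x0|x0] := eqVneq ((h *: e i + z) 0 i0) 0; first by rewrite r0 // normr0.
  apply: (le_trans (xC x0)); move: x0; rewrite E.
  case: (eqVneq i i0) => _; rewrite ?mulr0 ?eqxx // mulr1 => _.
  by rewrite ler_wpM2r ?sqr_ge0 // ler_norm.
have [_ Hr'] := Hr.
split=> [x Wx|i]; first exact: cr.1.
split=> [x Wx|].
  have [x0|x0] := eqVneq (x 0 i0) 0; first by have [] := D i x Wx x0.
  exact: (Hr' i).1.
apply: IH => [x Wx x0||l lL z Wz z0].
- by have [] := D i x Wx x0.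
- exact: (Hr' i).2.
- by have [|C HC] := Hb (rcons l i) _ z Wz z0; [rewrite size_rcons|exists C; rewrite -pd_rcons].
Unshelve. all: by end_near. Qed.

Definition vanish (q : nat) W k := forall j, (j < q)%N -> forall z, W z -> z 0 i0 = 0 ->
  pd R k (nseq j i0) z = 0.

Lemma rcons_nseq {T} j (x : T) : rcons (nseq j x) x = nseq j.+1 x.
Proof. by elim: j => //= j ->. Qed.

Lemma vanish_normal q W k : vanish q.+1 W k -> vanish q W ('D_(e i0) k).
Proof. by move=> H j jq z Wz z0; rewrite -pd_rcons rcons_nseq; exact: H. Qed.

(** A tangential derivative commutes with the normal ones, and the tangential derivative of a
    function that is 0 on the hyperplane is 0 there. *)
Lemma vanish_tangent q W k i : open W -> Cinf R W k -> i != i0 ->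
  vanish q W k -> vanish q W ('D_(e i) k).
Proof.
move=> oW Wk ii0 H j jq z Wz z0; rewrite -pd_rcons (@pd_commute _ _ W) //=.
have [|//] := @is_derive_quadratic R _ (pd R k (nseq j i0)) z (e i) 0.
have /rV_nearP[d d0 Hd] := open_nbhs_nbhs (conj oW Wz).
near=> h; rewrite mul0r (H j jq z) // subr0.
have hd : `|h| < d by near: h; exact: (@nbhs0_lt R R).
rewrite (H j jq) ?normr0 //.
  apply: Hd; rewrite distrC addrK normrZ; apply: le_lt_trans hd.
  by rewrite -[leRHS]mulr1 ler_wpM2l // norm_e_le.
by rewrite !mxE eqxx /= eq_sym (negbTE ii0) mulr0 add0r.
Unshelve. all: by end_near. Qed.

(** Each mean value step on the normal segment from [upd y 0] to [y] gains one factor [|y 0 i0|]. *)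
Lemma taylor_bound q W k z : open W -> Cinf R W k -> vanish q W k ->
  W z -> z 0 i0 = 0 ->
  exists C, 0 <= C /\ \forall y \near z, `|k y| <= C * `|y 0 i0| ^+ q.
Proof.
move=> oW; elim: q k => [|q IH] k Wk Hk Wz z0.
  exists (`|k z| + 1); split; first by rewrite addr_ge0.
  have /cvgrPdist_lt/(_ _ ltr01) := Cinf_continuous _ _ _ Wk Wz.
  apply: filterS => y /ltW yz; rewrite expr0 mulr1 -(subrK (k z) (k y)) addrC.
  by apply: (le_trans (ler_normD _ _)); rewrite lerD2l distrC.
have [C [C0 HC]] := IH ('D_(e i0) k) (Cinf_pd _ _ [:: i0] Wk) (vanish_normal _ _ _ Hk) Wz z0.
exists C; split=> //.
have /rV_nearP[d d0 Hd] : \forall y \near z, W y /\ `|'D_(e i0) k y| <= C * `|y 0 i0| ^+ q.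
  by apply: filterI HC; exact: open_nbhs_nbhs.
apply/rV_nearP; exists d => // y yd.
have yid : `|y 0 i0| < d.
  apply: le_lt_trans yd; have := rV_coord_le (z - y) i0.
  by rewrite !mxE z0 sub0r normrN.
have in_ball (h : R) : `|h| <= `|y 0 i0| -> `|z - (h *: e i0 + upd y 0)| < d.
  move=> hy; rewrite upd_addl addr0; apply: upd_dist => //.
  by rewrite z0 sub0r normrN; exact: le_lt_trans hy yid.
have [|h hy E] := @derive_line_mvt _ _ k (upd y 0) (e i0) (y 0 i0).
  by move=> h hy; apply: (Wk [::]).2; exact: (Hd _ (in_ball _ hy)).1.
move: E; rewrite upd_addl addr0 upd_id.
have ku : k (upd y 0) = 0.
  have := Hk 0%N (ltn0Sn _); apply; last exact: upd_i0.
  by have := Hd _ (in_ball 0 _); rewrite normr0 scale0r add0r => /(_ (normr_ge0 _)) [].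
rewrite ku subr0 => ->; rewrite normrM exprS mulrCA ler_wpM2l //.
apply: (le_trans (Hd _ (in_ball _ hy)).2); rewrite upd_addl addr0 upd_i0.
by rewrite ler_wpM2l // lerXn2r // nnegrE.
Qed.

End FlatGluing.

(** * The side [x 0 i0 > 0]: functions of the square root of the normal coordinate *)

Section RightBound.
Context {R : realType} {n : nat} (i0 : 'I_n).
Local Notation e := (@basis_vec R n).
Local Notation upd := (upd i0).
Implicit Types (W : set 'rV[R]_n) (k r : 'rV[R]_n -> R) (x z : 'rV[R]_n).

Lemma Cinf_upd W (U : set 'rV[R]_n) k (f : 'rV[R]_n -> R) :
  open U -> open W -> Cinf R W k -> Cinf R U f -> (forall x, U x -> W (upd x (f x))) ->
  Cinf R U (fun x => k (upd x (f x))).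
Proof.
move=> oU oW Wk Uf UW; apply: (Cinf_comp U W k (fun x => upd x (f x))) => //.
apply/(Cinf_vecP _ _ oU) => j; have [->|ji] := eqVneq j i0.
  by apply: (Cinf_ext _ _ _ oU _ Uf) => x _; rewrite upd_i0.
apply: (Cinf_ext _ _ _ oU _ (Cinf_coord _ j)).
by move=> x _; rewrite mxE (negbTE ji).
Qed.

Lemma is_derive_coord i j x : is_derive x (e i) (fun y => y 0 j) (i == j)%:R.
Proof.
have [d E] := @is_derive_id _ 'rV[R]_n x (e i).
split; first exact: ((derivable_mxP _ _ _).1 d 0 j).
by move: E; rewrite derive_mx // => /rowP/(_ j); rewrite !mxE eqxx /= eq_sym.
Qed.

Lemma is_derive_upd W k (a : 'rV[R]_n -> R) x i (a' : R) : open W -> Cinf R W k ->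
  W (upd x (a x)) -> is_derive x (e i) a a' ->
  is_derive x (e i) (fun y => k (upd y (a y)))
    (a' * 'D_(e i0) k (upd x (a x)) + (i != i0)%:R * 'D_(e i) k (upd x (a x))).
Proof.
move=> oW Wk Wx [da aE].
have dupd : derivable (fun y => upd y (a y)) x (e i) /\
    'D_(e i) (fun y => upd y (a y)) x = upd (e i) a'.
  have H j : is_derive x (e i) (fun y => upd y (a y) 0 j) (upd (e i) a' 0 j).
    rewrite !mxE; case: (eqVneq j i0) => ji.
      have -> : (fun y => upd y (a y) 0 j) = a by apply/funext => y; rewrite ji upd_i0.
      by split.
    have -> : (fun y => upd y (a y) 0 j) = (fun y => y 0 j).
      by apply/funext => y; rewrite mxE (negbTE ji).
    by rewrite eqxx /= eq_sym; exact: is_derive_coord.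
  have d : derivable (fun y => upd y (a y)) x (e i).
    by apply/derivable_mxP => b j; rewrite ord1; case: (H j).
  split=> //; rewrite derive_mx //; apply/rowP => j; rewrite mxE.
  by case: (H j).
have [dk dkE] : differentiable k (upd x (a x)) /\
   'd k (upd x (a x)) = (fun h => \sum_j h 0 j * 'D_(e j) k (upd x (a x))) :> ('rV[R]_n -> R).
  apply: C1_differentiable => j; last exact: (Wk [:: j]).1.
  by apply: filterS (open_nbhs_nbhs (conj oW Wx)) => y Wy; exact: (Wk [::]).2.
have := @is_derive_comp_diff _ _ _ _ k (fun y => upd y (a y)) x (e i) dk dupd.1.
rewrite dkE dupd.2 (bigD1 i0) //= upd_i0.
suff -> : \sum_(j < n | j != i0) upd (e i) a' 0 j * 'D_(e j) k (upd x (a x))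
  = (i != i0)%:R * 'D_(e i) k (upd x (a x)) by [].
have [->|ii0] := eqVneq i i0.
  rewrite mul0r big1 // => j ji; rewrite mxE (negbTE ji) e_coord eq_sym (negbTE ji).
  by rewrite mul0r.
rewrite (bigD1 i) //= mxE (negbTE ii0) e_coord eqxx big1 ?addr0 // => j /andP[ji0 ji].
by rewrite mxE (negbTE ji0) e_coord eq_sym (negbTE ji) mul0r.
Qed.

(** Differentiating [k] at the square root brings out negative powers of that root. With an
    arbitrary power [p] built in, the class is stable under differentiation up to linear
    combinations, see [derive_root_quot]. *)
Definition root_quot (p : nat) k x : R :=
  (Num.sqrt (x 0 i0))^-1 ^+ p * k (upd x (Num.sqrt (x 0 i0))).

Lemma Cinf_root_quot W k p : open W -> cylinder i0 W -> Cinf R W k ->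
  Cinf R (W `&` [set x : 'rV[R]_n | 0 < x 0 i0]) (root_quot p k).
Proof.
move=> oW cW Wk; set U := _ `&` _.
have oU : open U by apply: (open_coord i0 W [set t | 0 < t]) => //; exact: open_gt.
have Us : Cinf R U (fun x => Num.sqrt (x 0 i0)).
  apply: (Cinf_comp1 U [set t | 0 < t] (fun x => x 0 i0) Num.sqrt) => //.
  - exact: Ck1_sqrt.
  - exact: Cinf_coord.
  - by move=> x [].
have Ws x : U x -> W (upd x (Num.sqrt (x 0 i0))) by case=> Wx _; exact: cW.
apply: (Cinf_mul _ _ _ oU _ (Cinf_upd _ _ _ _ oU oW Wk Us Ws)).
apply: (Cinf_exp _ _ _ oU).
apply: (Cinf_comp1 U [set t | t != 0] _ GRing.inv _ _ Us) => //; first exact: Ck1_inv.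
by move=> x [_ x0]; rewrite /= gt_eqF // sqrtr_gt0.
Qed.

Lemma is_derive_inv_comp {V : normedModType R} (f : V -> R) (x v : V) df :
  f x != 0 -> is_derive x v f df -> is_derive x v (fun y => (f y)^-1) (- (f x) ^- 2 * df).
Proof.
move=> f0 [d E]; split; first exact: (@derivableV R V f x v f0 d).
by rewrite (@deriveV R V f x v f0 d) E.
Qed.

Lemma derive_root_quot W k p i x : open W -> cylinder i0 W -> Cinf R W k ->
  W x -> 0 < x 0 i0 ->
  'D_(e i) (root_quot p k) x =
  (i == i0)%:R * (- p%:R / 2) * root_quot p.+2 k x
  + ((i == i0)%:R / 2) * root_quot p.+1 ('D_(e i0) k) x
  + (i != i0)%:R * root_quot p ('D_(e i) k) x.
Proof.
move=> oW cW Wk Wx x0.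
have s0 : Num.sqrt (x 0 i0) != 0 by rewrite gt_eqF // sqrtr_gt0.
have d1 : is_derive x (e i) (fun y => Num.sqrt (y 0 i0))
   ((2 * Num.sqrt (x 0 i0))^-1 * (i == i0)%:R).
  have [dc cE] := is_derive_coord i i0 x; have [ds sE] := is_derive1_sqrt x0.
  have := @derive_comp1 _ _ Num.sqrt (fun y : 'rV[R]_n => y 0 i0) x (e i) ds dc.
  by rewrite cE derive1E sE.
have d2 := is_derive_upd _ _ _ _ _ _ oW Wk (cW _ _ Wx) d1.
have d3 : is_derive x (e i) (fun y => (Num.sqrt (y 0 i0))^-1)
   (- (Num.sqrt (x 0 i0)) ^- 2 * ((2 * Num.sqrt (x 0 i0))^-1 * (i == i0)%:R)).
  exact: (@is_derive_inv_comp _ (fun y : 'rV[R]_n => Num.sqrt (y 0 i0)) x (e i) _ s0 d1).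
have d4 := is_derive_expn _ _ _ p _ d3.
have [_ ->] := @is_deriveM _ _ _ _ _ _ _ _ d4 d2.
rewrite /root_quot /GRing.scale /=.
move: ('D_(e i0) k _) ('D_(e i) k _) (k _) => D0 Di K.
case: p {d4} => [|p].
  by rewrite /= oppr0 mul0r; field.
rewrite succnK -natr1 !exprS; set s := Num.sqrt _ in s0 *; set u := s^-1 ^+ p; field.
exact: s0.
Qed.

(** With [s] the square root, the function is of size [s ^ (q - p)]. A normal derivative either
    raises [p] by 2, or raises [p] by 1 and lowers [q] by 1, so it costs two powers of [s]; the
    remaining [s ^+ 4] is the square of the normal coordinate. *)
Lemma root_quot_bound l p q W k z : open W -> cylinder i0 W -> Cinf R W k ->
  vanish i0 q W k -> (p + (size l).*2 + 4 <= q)%N -> W z -> z 0 i0 = 0 ->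
  exists C, 0 <= C /\ \forall x \near z, 0 < (x : 'rV[R]_n) 0 i0 ->
    `|pd R (root_quot p k) l x| <= C * x 0 i0 ^+ 2.
Proof.
move=> oW cW; elim/last_ind: l p q k => [|l i IH] p q k Wk vk.
  rewrite addn0 => pq Wz z0.
  have [C [C0 HC]] := taylor_bound i0 _ _ _ _ oW Wk vk Wz z0.
  exists C; split=> //; have [d d0 Hd] := (rV_nearP _ _).1 HC.
  (* The bound [d ^+ 2] keeps the square root of the normal coordinate below [d]; the bound 1 makes
     higher powers of it smaller. *)
  apply/rV_nearP; exists (Num.min d (Num.min (d ^+ 2) 1)).
    by rewrite !lt_min d0 ltr01 exprn_gt0.
  move=> x; rewrite !lt_min => /and3P[xd xd2 x1] x0 /=.
  have xi : `|x 0 i0| <= `|z - x|.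
    by have := rV_coord_le (z - x) i0; rewrite !mxE z0 sub0r normrN.
  rewrite gtr0_norm // in xi.
  set s := Num.sqrt (x 0 i0); have s0 : 0 < s by rewrite sqrtr_gt0.
  have ss : s ^+ 2 = x 0 i0 by rewrite sqr_sqrtr // ltW.
  have s1 : s <= 1.
    by rewrite -(@ler_pXn2r _ 2) ?nnegrE ?ltW // expr1n ss (le_lt_trans xi).
  have sd : s < d.
    by rewrite -(@ltr_pXn2r _ 2) ?nnegrE ?ltW // ss (le_lt_trans xi).
  have := Hd (upd x s) _; rewrite upd_i0 => ks.
  rewrite /root_quot -/s normrM.
  have sp : 0 <= s^-1 ^+ p by rewrite exprn_ge0 // invr_ge0 ltW.
  rewrite (ger0_norm sp) mulrC -ler_pdivlMr; last by rewrite exprn_gt0 // invr_gt0.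
  apply: (le_trans (ks _)).
    by apply: upd_dist => //; rewrite z0 sub0r normrN gtr0_norm.
  rewrite exprVn invrK (gtr0_norm s0) -mulrA ler_wpM2l // -ss -exprM -exprD.
  by apply: (ler_wiXn2l (ltW s0) s1); rewrite [(2 * 2)%N](_ : _ = 4%N) // addnC.
rewrite size_rcons doubleS => pq Wz z0.
set U := W `&` [set x : 'rV[R]_n | 0 < x 0 i0].
have oU : open U by apply: (open_coord i0 W [set t | 0 < t]) => //; exact: open_gt.
have WDk j : Cinf R W ('D_(e j) k) := Cinf_pd _ _ [:: j] Wk.
have [ii0|ii0] := eqVneq i i0; last first.
  have [|C [C0 HC]] := IH p q ('D_(e i) k) (WDk i) (vanish_tangent _ _ _ _ _ oW Wk ii0 vk) _ Wz z0.
    by apply: leq_trans pq; rewrite leq_add2r leq_add2l; apply: leq_trans (leqnSn _) (leqnSn _).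
  exists C; split=> //.
  apply: filterS2 HC (open_nbhs_nbhs (conj oW Wz)) => x HC Wx x0; rewrite pd_rcons.
  rewrite (pd_ext U _ (root_quot p ('D_(e i) k))) //; first exact: HC.
  move=> y [Wy y0]; rewrite (derive_root_quot _ _ p i _ oW cW Wk Wy y0) (negbTE ii0) !mul0r !add0r.
  by rewrite mul1r.
case: q vk pq => [|q] vk pq; first by rewrite addnC in pq.
have [|C1 [C10 HC1]] := IH p.+2 q.+1 k Wk vk _ Wz z0.
  by move: pq; rewrite !addSn !addnS.
have [|C2 [C20 HC2]] := IH p.+1 q ('D_(e i0) k) (WDk i0) (vanish_normal _ _ _ _ vk) _ Wz z0.
  by move: pq; rewrite !addSn !addnS ltnS.
exists (`|- p%:R / 2| * C1 + `|1 / 2| * C2); split.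
  by rewrite addr_ge0 // mulr_ge0.
have c1 := Cinf_mul _ _ _ oU (Cinf_cst _ (- p%:R / 2)) (Cinf_root_quot _ _ p.+2 oW cW Wk).
have c2 := Cinf_mul _ _ _ oU (Cinf_cst _ (1 / 2)) (Cinf_root_quot _ _ p.+1 oW cW (WDk i0)).
apply: filterS3 HC1 HC2 (open_nbhs_nbhs (conj oW Wz)) => x HC1 HC2 Wx x0.
have Ux : U x by [].
have E y : U y -> 'D_(e i) (root_quot p k) y = (- p%:R / 2) * root_quot p.+2 k y
   + (1 / 2) * root_quot p.+1 ('D_(e i0) k) y.
  case=> Wy y0; rewrite (derive_root_quot _ _ p i _ oW cW Wk Wy y0) ii0 eqxx.
  by rewrite !mul1r mul0r addr0.
rewrite pd_rcons (pd_ext _ _ _ _ oU E _ Ux) (pd_add _ _ _ _ oU c1 c2 _ Ux).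
rewrite (pd_cmul _ _ _ _ oU (Cinf_root_quot _ _ p.+2 oW cW Wk) _ Ux).
rewrite (pd_cmul _ _ _ _ oU (Cinf_root_quot _ _ p.+1 oW cW (WDk i0)) _ Ux).
apply: (le_trans (ler_normD _ _)); rewrite [X in X + _ <= _]normrM [X in _ + X <= _]normrM mulrDl.
apply: lerD; rewrite -[leRHS]mulrA; apply: ler_wpM2l; rewrite ?normr_ge0 //.
  exact: HC1.
exact: HC2.
Qed.

End RightBound.

Section CompactBound.
Context {R : realType}.

Lemma compact_bounded_on {T : topologicalType} (K : set T) (f : T -> R) : compact K ->
  (forall x, K x -> {for x, continuous f}) -> exists M, 0 <= M /\ forall x, K x -> `|f x| <= M.
Proof.
move=> cK cf.
have : compact (f @` K).
  apply: continuous_compact => //; apply: continuous_in_subspaceT => x /[!inE]; exact: cf.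
move=> /compact_bounded [M [Mr HM]]; exists (`|M| + 1); split; first by rewrite addr_ge0.
move=> x Kx; apply: (HM (`|M| + 1)); last by exists x.
by rewrite (le_lt_trans (ler_norm _)) // ltrDl.
Qed.

End CompactBound.

(** * The side [x 0 i0 < 0]: terms of a Borel sum *)

Section LeftBound.
Context {R : realType} {n : nat} (i0 : 'I_n).
Local Notation e := (@basis_vec R n).
Local Notation upd := (upd i0).
Implicit Types (W V K : set 'rV[R]_n) (c k r : 'rV[R]_n -> R) (x z : 'rV[R]_n) (psi : R -> R).

Definition slice_cst W c := forall x a, W x -> c (upd x a) = c x.

Definition left_term (p : nat) psi (eps : R) c x : R :=
  x 0 i0 ^+ p * (psi (x 0 i0 / eps) * c x).

Lemma derive_slice_normal W c x : slice_cst W c -> W x -> is_derive x (e i0) c 0.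
Proof.
move=> sc Wx; apply: (@is_derive_quadratic _ _ _ _ _ 0); near=> h.
by rewrite add_upd sc // subrr normr0 mul0r.
Unshelve. all: by end_near. Qed.

Lemma slice_derive W c i : open W -> cylinder i0 W -> Cinf R W c -> slice_cst W c ->
  i != i0 -> slice_cst W ('D_(e i) c).
Proof.
move=> oW cW Wc sc ii0 x a Wx.
have [_ E] := is_derive_upd i0 W c (fun=> a) x i 0 oW Wc (cW _ a Wx) (is_derive_cst a x (e i)).
rewrite mul0r add0r ii0 mul1r in E; rewrite -E; apply: near_eq_derive.
by apply: filterS (open_nbhs_nbhs (conj oW Wx)) => y Wy; exact: sc.
Qed.

Definition cut_smooth psi := (forall L, Ck1 L setT psi) /\ forall t, t < -1 -> psi t = 0.

(** The derivative of [t ^+ p * psi (t / eps)] is [t ^+ p.-1 * psi_next p psi (t / eps)] for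
    [p > 0]. All dependence on [eps] stays in the argument, so estimates remain uniform in [eps]. *)
Definition psi_next (p : nat) psi (t : R) : R := p%:R * psi t + t * derive1 psi t.

Lemma Ck1_id L : Ck1 L setT (fun t : R => t).
Proof.
have H := @Ck1_prim R L setT (fun t => t) (fun=> 1) openT.
apply: (@Ck1_le _ L.+1) => //; apply: H; last exact: Ck1_cst.
Qed.

Lemma cut_smooth_next p psi : cut_smooth psi -> cut_smooth (psi_next p psi).
Proof.
move=> [Hs H0]; split=> [L|t t1].
  apply: Ck1_add; first exact: openT.
    by apply: Ck1_mul; [exact: openT|exact: Ck1_cst|exact: Hs].
  by apply: Ck1_mul; [exact: openT|exact: Ck1_id|exact: (Hs L.+1).2].
rewrite /psi_next H0 // mulr0 add0r (near_eq_derive1 _ (fun=> 0)) ?derive1_cst ?mulr0 //.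
by near=> s; apply: H0; near: s; exact: lt_nbhsl.
Unshelve. all: by end_near. Qed.

Lemma Cinf_left_term W p psi eps c : open W -> cut_smooth psi -> Cinf R W c ->
  Cinf R W (left_term p psi eps c).
Proof.
move=> oW [Hs _] Wc; apply: (Cinf_mul _ _ _ oW).
  by apply: (Cinf_exp _ _ _ oW); exact: Cinf_coord.
have H : Cinf R W (fun x => x 0 i0 * eps^-1).
  by apply: (Cinf_mul _ _ _ oW); [exact: Cinf_coord|exact: Cinf_cst].
exact: (Cinf_mul _ _ _ oW (Cinf_comp1 W setT _ psi oW Hs H (fun _ _ => I)) Wc).
Qed.

Lemma derive_left_term W p psi eps c i x : cut_smooth psi -> Cinf R W c -> slice_cst W c ->
  W x -> eps != 0 ->
  'D_(e i) (left_term p.+1 psi eps c) x =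
  if i == i0 then left_term p (psi_next p.+1 psi) eps c x
  else left_term p.+1 psi eps ('D_(e i) c) x.
Proof.
move=> [Hs _] Wc sc Wx e0.
have dc := derivableP ((Wc [::]).2 i x Wx).
have dt := is_derive_coord i i0 x.
have dte : is_derive x (e i) (fun y => y 0 i0 / eps) ((i == i0)%:R / eps).
  have := is_derive_cmul _ _ _ eps^-1 _ dt; rewrite mulrC.
  by have -> : (fun y => eps^-1 * y 0 i0) = (fun y => y 0 i0 / eps) :> ('rV[R]_n -> R)
    by apply/funext => y; rewrite mulrC.
have dpsi : is_derive x (e i) (fun y => psi (y 0 i0 / eps))
    (derive1 psi (x 0 i0 / eps) * ((i == i0)%:R / eps)).
  have [d dE] := dte.
  have := @derive_comp1 R _ psi (fun y : 'rV[R]_n => y 0 i0 / eps) x (e i) ((Hs 0%N).1 _ I) d.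
  by rewrite dE.
have [_ ->] := is_deriveM (is_derive_expn _ _ _ p.+1 _ dt) (is_deriveM dpsi dc).
rewrite /left_term /psi_next mulrfctE /GRing.scale /=.
have [ii0|ii0] := eqVneq i i0.
  have [_ Dc] := derive_slice_normal _ _ _ sc Wx; rewrite ii0 Dc.
  move: (psi _) (derive1 psi _) (c x) => A B C; rewrite /= ?eqxx exprS; field.
  exact: e0.
have -> : false%:R = 0 :> R by [].
by rewrite mul0r !mulr0 !addr0.
Qed.

(** The cutoff vanishes where the normal coordinate [t] is below [- eps]; elsewhere
    [|t| <= eps <= 1], so [|t| ^+ p <= eps * t ^+ 2] as soon as [p >= 3]. A normal derivative lowers
    [p] by one. The factor [eps] is what later makes the terms summable. *)
Lemma left_term_bound l p psi c W V K : open W -> cylinder i0 W -> V `<=` W ->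
  compact K -> K `<=` W -> (forall x, V x -> K (upd x 0)) ->
  cut_smooth psi -> Cinf R W c -> slice_cst W c -> (size l + 3 <= p)%N ->
  exists C, 0 <= C /\ forall eps, 0 < eps -> eps <= 1 -> forall x, V x -> x 0 i0 < 0 ->
    `|pd R (left_term p psi eps c) l x| <= C * eps * x 0 i0 ^+ 2.
Proof.
move=> oW cW VW cK KW VK; elim/last_ind: l p psi c => [|l i IH] p psi c Hpsi Wc sc lp.
  (* As [c] does not vary along [i0], its values on [V] are attained on the compact set [K]. *)
  have [M [M0 HM]] := compact_bounded_on _ _ cK (fun x Kx => Cinf_continuous _ _ _ Wc (KW _ Kx)).
  have [P [P0 HP]] : exists P, 0 <= P /\ forall t, `[-1, 0]%classic t -> `|psi t| <= P.
    apply: compact_bounded_on; first exact: segment_compact.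
    by move=> t _; apply: Ck1_continuous; exact: Hpsi.1.
  exists (P * M); split; first exact: mulr_ge0.
  move=> eps e0 e1 x Vx x0 /=; rewrite /left_term; set t := x 0 i0 in x0 *.
  have Ce : 0 <= P * M * eps * t ^+ 2.
    by apply: mulr_ge0; [apply: mulr_ge0 (ltW e0); exact: mulr_ge0|exact: sqr_ge0].
  have [te|te] := ltP t (- eps).
    by rewrite Hpsi.2 ?mul0r ?mulr0 ?normr0 // ltr_pdivrMr // mulN1r.
  have nt : `|t| <= eps by rewrite ltr0_norm // lerNl.
  have psit : `|psi (t / eps)| <= P.
    by apply: HP; rewrite /= in_itv /= ler_pdivlMr // mulN1r te /= pmulr_lle0 ?invr_gt0 // ltW.
  have cx : `|c x| <= M by rewrite -(sc x 0 (VW _ Vx)); apply/HM/VK.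
  rewrite normrM normrM -mulrA mulrC; apply: ler_pM; rewrite ?mulr_ge0 //.
    exact: ler_pM.
  rewrite normrX; case: p lp => [|[|[|p]]] // _.
  rewrite -[t ^+ 2]real_normK ?num_real //.
  rewrite (exprD _ 2 p.+1) mulrC; apply: ler_wpM2r; first exact: exprn_ge0.
  rewrite exprS; apply: (@le_trans _ _ (`|t| * 1)); last by rewrite mulr1.
  by apply: ler_wpM2l => //; apply: exprn_ile1 => //; exact: le_trans nt e1.
rewrite size_rcons in lp; case: p lp => // p lp.
have lp' : (size l + 3 <= p)%N by rewrite -ltnS.
have [ii0|ii0] := eqVneq i i0.
  have [C [C0 HC]] := IH p _ c (cut_smooth_next p.+1 _ Hpsi) Wc sc lp'.
  exists C; split=> // eps e0 e1 x Vx x0; rewrite pd_rcons.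
  rewrite (pd_ext W _ (left_term p (psi_next p.+1 psi) eps c) l oW _ x (VW _ Vx)); first exact: HC.
  by move=> y Wy; rewrite (derive_left_term W _ _ _ _ i _ Hpsi Wc sc Wy (negbT (gt_eqF e0))) ii0 eqxx.
have WDc : Cinf R W ('D_(e i) c) := Cinf_pd _ _ [:: i] Wc.
have [C [C0 HC]] := IH p.+1 _ _ Hpsi WDc (slice_derive _ _ _ oW cW Wc sc ii0) (leqW lp').
exists C; split=> // eps e0 e1 x Vx x0; rewrite pd_rcons.
rewrite (pd_ext W _ (left_term p.+1 psi eps ('D_(e i) c)) l oW _ x (VW _ Vx)); first exact: HC.
by move=> y Wy; rewrite (derive_left_term W _ _ _ _ i _ Hpsi Wc sc Wy (negbT (gt_eqF e0))) (negbTE ii0).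
Qed.

(** There are finitely many lists of bounded length over a finite alphabet; the constants are added
    up over the first letter. *)
Lemma seq_bounded_uniform {T : finType} (P : seq T -> R -> Prop) (k : nat) :
  (forall l, (size l <= k)%N -> exists C, 0 <= C /\ P l C) ->
  (forall l C C', C <= C' -> P l C -> P l C') ->
  exists C, 0 <= C /\ forall l, (size l <= k)%N -> P l C.
Proof.
move=> + mono; elim: k P mono => [|k IH] P mono H.
  have [|C [C0 HC]] := H [::] => //; exists C; split=> // l.
  by rewrite leqn0 size_eq0 => /eqP ->.
have [|C [C0 HC]] := H [::] => //.
have /choice[D HD] (i : T) : exists D, 0 <= D /\ forall l, (size l <= k)%N -> P (i :: l) D.
  by apply: (IH (fun l => P (i :: l))) => [l|l lk]; [exact: mono|exact: H].
have D0 i : 0 <= D i by case: (HD i).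
have SD : 0 <= \sum_i D i by exact: sumr_ge0.
exists (C + \sum_i D i); split; first exact: addr_ge0.
case=> [_|i l lk]; first by apply: mono HC; rewrite lerDl.
apply: mono ((HD i).2 l lk); rewrite (bigD1 i) //= addrCA lerDl.
by apply: addr_ge0 => //; exact: sumr_ge0.
Qed.

End LeftBound.

(** * Even functions as smooth functions of the square *)

Section WhitneyEven.
Context {R : realType} {n : nat} (i0 : 'I_n).
Local Notation e := (@basis_vec R n).
Local Notation upd := (upd i0).
Implicit Types (W V K : set 'rV[R]_n) (c g r : 'rV[R]_n -> R) (x y z : 'rV[R]_n).

Lemma even_pd W g j x : open W -> cylinder i0 W -> Cinf R W g ->
  (forall x, W x -> g (upd x (- x 0 i0)) = g x) -> W x ->
  pd R g (nseq j i0) (upd x (- x 0 i0)) = (-1) ^+ j * pd R g (nseq j i0) x.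
Proof.
move=> oW cW Wg ev; elim: j x => [|j IH] x Wx; first by rewrite /= ev // mul1r.
set h := pd R g (nseq j i0) in IH *.
have Wh : Cinf R W h by exact: Cinf_pd.
have Wsx : W (upd x (- x 0 i0)) by exact: cW.
have [d dE] := is_derive_coord i0 i0 x.
have da : is_derive x (e i0) (fun y : 'rV[R]_n => - y 0 i0) (-1).
  have := is_deriveN (is_derive_coord i0 i0 x).
  by rewrite eqxx.
have [_ E1] := is_derive_upd i0 W h (fun y => - y 0 i0) x i0 (-1) oW Wh Wsx da.
have [_ E2] := is_derive_cmul _ _ _ ((-1) ^+ j) _ (derivableP ((Wh [::]).2 i0 x Wx)).
have E3 : 'D_(e i0) (fun y => h (upd y (- y 0 i0))) x = 'D_(e i0) (fun y => (-1) ^+ j * h y) x.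
  apply: near_eq_derive.
  by apply: filterS (open_nbhs_nbhs (conj oW Wx)) => y; exact: IH.
rewrite E1 E2 eqxx /= mul0r addr0 in E3.
rewrite [LHS](_ : _ = - (-1 * 'D_(e i0) h (upd x (- x 0 i0)))); last by rewrite mulN1r opprK.
by rewrite E3 exprS mulN1r mulNr.
Qed.

Lemma pd_monomial W c m j x : open W -> Cinf R W c -> slice_cst i0 W c -> W x ->
  pd R (fun y => y 0 i0 ^+ m * c y) (nseq j i0) x = (m ^_ j)%:R * (x 0 i0 ^+ (m - j) * c x).
Proof.
move=> oW Wc sc; elim: j x => [|j IH] x Wx; first by rewrite /= subn0 ffactn0 mul1r.
have dt := is_derive_expn _ _ _ (m - j) _ (is_derive_coord i0 i0 x).
have dc := derive_slice_normal i0 _ _ _ sc Wx.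
have [_ E] := is_derive_cmul _ _ _ (m ^_ j)%:R _ (is_deriveM dt dc).
have -> : pd R (fun y => y 0 i0 ^+ m * c y) (nseq j.+1 i0) x =
  'D_(e i0) (fun y => (m ^_ j)%:R * (y 0 i0 ^+ (m - j) * c y)) x.
  apply: near_eq_derive.
  by apply: filterS (open_nbhs_nbhs (conj oW Wx)) => y; exact: IH.
rewrite -[LHS]/('D_(e i0) (fun y => (m ^_ j)%:R * ((fun y => y 0 i0 ^+ (m - j)) * c) y) x) E.
rewrite /GRing.scale /= eqxx mulr0 add0r mulr1 -subnS ffactnSr natrM.
by rewrite -mulrA; congr (_ * _); rewrite mulrC mulrA.
Qed.

Section Extension.
Variables (W V K : set 'rV[R]_n) (g : 'rV[R]_n -> R).
Hypotheses (oW : open W) (cW : cylinder i0 W) (oV : open V) (VW : V `<=` W).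
Hypotheses (cK : compact K) (KW : K `<=` W) (VK : forall x, V x -> K (upd x 0)).
Hypotheses (Wg : Cinf R W g) (ev : forall x, W x -> g (upd x (- x 0 i0)) = g x).

(* Coefficients of the even Taylor expansion of [g] along the slice [x_{i0} = 0]; where
   [x_{i0} < 0] the extension is a Borel sum with these coefficients. *)
Let c (k : nat) (x : 'rV[R]_n) : R := ((2 * k)`!%:R)^-1 * pd R g (nseq (2 * k) i0) (upd x 0).

Let sc k : slice_cst i0 W (c k).
Proof. by move=> x a Wx; rewrite /c upd_upd. Qed.

Let Wc k : Cinf R W (c k).
Proof.
apply: (Cinf_mul _ _ _ oW (Cinf_cst _ _)).
apply: (Cinf_upd i0 W W _ (fun=> 0) oW oW (Cinf_pd _ _ _ Wg) (Cinf_cst _ _)) => x Wx.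
exact: cW.
Qed.

Let rem (M : nat) x : R := g x - \sum_(k < M) x 0 i0 ^+ (2 * k) * c k x.

Let Wmono m k : Cinf R W (fun x => x 0 i0 ^+ m * c k x).
Proof. by apply: (Cinf_mul _ _ _ oW (Cinf_exp _ _ _ oW (Cinf_coord _ _)) (Wc k)). Qed.

Let Wrem M : Cinf R W (rem M).
Proof.
apply: (Cinf_sub _ _ _ oW Wg).
by apply: (Cinf_sum _ _ _ (fun (k : 'I_M) x => x 0 i0 ^+ (2 * k) * c k x) oW) => k; exact: Wmono.
Qed.

(** Odd normal derivatives of [g] vanish on the hyperplane by evenness, and the even ones below
    order [2 * M] are cancelled by the Taylor coefficients [c k]. *)
Let rem_vanish M : vanish i0 (2 * M) W (rem M).
Proof.
move=> j jM z Wz z0.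
have Ws : Cinf R W (fun x => \sum_(k < M) x 0 i0 ^+ (2 * k) * c k x).
  by apply: (Cinf_sum _ _ _ (fun (k : 'I_M) x => x 0 i0 ^+ (2 * k) * c k x) oW) => k; exact: Wmono.
have -> : pd R (rem M) (nseq j i0) z = pd R g (nseq j i0) z
    - pd R (fun x => \sum_(k < M) x 0 i0 ^+ (2 * k) * c k x) (nseq j i0) z.
  rewrite -mulN1r -(pd_cmul _ _ (-1) _ oW Ws _ Wz).
  rewrite -(pd_add _ _ _ _ oW Wg (Cinf_mul _ _ _ oW (Cinf_cst _ _) Ws) _ Wz).
  by apply: (pd_ext W _ _ _ oW _ _ Wz) => y _; rewrite /rem mulN1r.
rewrite (pd_sum W _ (fun (k : 'I_M) x => x 0 i0 ^+ (2 * k) * c k x) _ oW); last 2 first.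
- by move=> k; exact: Wmono.
- exact: Wz.
under eq_bigr => k _ do rewrite (pd_monomial W (c k) (2 * k) j z oW (Wc k) (@sc k) Wz) z0.
have [oj|ej] := boolP (odd j).
  have g0 : pd R g (nseq j i0) z = 0.
    have := even_pd W g j z oW cW Wg ev Wz.
    rewrite z0 oppr0 (upd_on i0 z z0) -signr_odd oj expr1 mulN1r => H.
    by apply/eqP; rewrite -[_ == 0](mulrn_eq0 _ 2) mulr2n {1}H addNr.
  rewrite g0 sub0r big1 ?oppr0 // => k _; have [jk|kj] := ltnP j (2 * k).
    by rewrite expr0n subn_eq0 leqNgt jk /= mul0r mulr0.
  have : (2 * k < j)%N.
    rewrite ltn_neqAle kj andbT; apply: contraTneq oj => <-.
    by rewrite mul2n odd_double.
  by move=> jk; rewrite ffact_small // mul0r.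
have jE : j = (2 * j./2)%N by rewrite mul2n -[LHS]odd_double_half (negbTE ej).
have jM2 : (j./2 < M)%N by rewrite -(ltn_pmul2l (ltn0Sn 1)) -jE.
rewrite (bigD1 (Ordinal jM2)) //= -jE subnn expr0 mul1r ffactnn /c -jE (upd_on i0 z z0).
rewrite mulrA mulfV ?mul1r ?pnatr_eq0 -?lt0n ?fact_gt0 // opprD addrA subrr sub0r.
rewrite big1 ?oppr0 // => k; rewrite -val_eqE /= => kj.
have [jk|kj'] := ltnP j (2 * k).
  by rewrite expr0n subn_eq0 leqNgt jk /= mul0r mulr0.
have : (2 * k < j)%N.
  rewrite ltn_neqAle kj' andbT; apply: contraNneq kj => <-.
  by rewrite mul2n doubleK.
by move=> jk; rewrite ffact_small // mul0r.
Qed.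

(** This is 0 for [t <= -1] and 1 for [t >= -1/2]; being 1 near 0, it leaves the Taylor coefficients
    of the sum unchanged. *)
Let chi (t : R) : R := lam R (2 * t + 2).

Let chi_cut : cut_smooth chi.
Proof.
split; first by move=> L; apply: Ck1_affine; exact: Ck1_lam.
by move=> t t1; rewrite /chi lam_le0 //; lra.
Qed.

Let chi1 t : - 2^-1 <= t -> chi t = 1.
Proof. by move=> t2; rewrite /chi lam_ge1 //; lra. Qed.

(** The bound [2^-1 ^+ k] makes derivatives up to order [k - 3] summable in [k]. The bound
    [k.+1%:R^-1] leaves only finitely many nonzero terms at each point of the open half-space. *)
Let eps_ex k : exists eps : R, [/\ 0 < eps, eps <= k.+1%:R^-1 &
  forall l, (size l + 3 <= k)%N -> forall x, V x -> x 0 i0 < 0 ->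
    `|pd R (left_term i0 k chi eps (c k)) l x| <= 2^-1 ^+ k * x 0 i0 ^+ 2].
Proof.
have [k3|k3] := ltnP k 3.
  exists k.+1%:R^-1; split=> //.
  by move=> l lk; have := leq_trans (leq_addl _ _) lk; rewrite leqNgt k3.
pose P (l : seq 'I_n) (C : R) := forall eps, 0 < eps -> eps <= 1 -> forall x, V x -> x 0 i0 < 0 ->
  `|pd R (left_term i0 k chi eps (c k)) l x| <= C * eps * x 0 i0 ^+ 2.
have [l lk|l C C' CC' HC eps e0 e1 x Vx x0|C [C0 HC]] := @seq_bounded_uniform R _ P (k - 3).
- apply: (left_term_bound i0 l k chi (c k) W V K oW cW VW cK KW VK chi_cut (Wc k) (@sc k)).
  by rewrite addnC -leq_subRL.
- apply: (le_trans (HC eps e0 e1 x Vx x0)); apply: ler_wpM2r; first exact: sqr_ge0.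
  by apply: ler_wpM2r; first exact: ltW.
have C1 : 0 < C + 1 by lra.
(* [C + 1] in place of [C] avoids a zero denominator. *)
pose eps := Num.min k.+1%:R^-1 (2^-1 ^+ k / (C + 1)).
have e0 : 0 < eps by rewrite lt_min invr_gt0 ltr0n /= divr_gt0 // exprn_gt0 // invr_gt0.
have ek : eps <= k.+1%:R^-1 by rewrite ge_min lexx.
exists eps; split=> // l lk x Vx x0.
have e1 : eps <= 1 by apply: le_trans ek _; rewrite invf_le1 ?ler1n.
have lk' : (size l <= k - 3)%N by rewrite leq_subRL // addnC.
apply: (le_trans (HC l lk' eps e0 e1 x Vx x0)); apply: ler_wpM2r; first exact: sqr_ge0.
apply: (@le_trans _ _ ((C + 1) * eps)); first by apply: ler_wpM2r; [exact: ltW|rewrite lerDl].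
by rewrite mulrC -ler_pdivlMr // ge_min lexx orbT.
Qed.

Let eps k := projT1 (cid (eps_ex k)).
Let eps_gt0 k : 0 < eps k. Proof. by case: (projT2 (cid (eps_ex k))). Qed.
Let eps_le k : eps k <= k.+1%:R^-1. Proof. by case: (projT2 (cid (eps_ex k))). Qed.
Let eps_bound k l : (size l + 3 <= k)%N -> forall x, V x -> x 0 i0 < 0 ->
    `|pd R (left_term i0 k chi (eps k) (c k)) l x| <= 2^-1 ^+ k * x 0 i0 ^+ 2.
Proof. by case: (projT2 (cid (eps_ex k))) => _ _; exact. Qed.

Let term k := left_term i0 k chi (eps k) (c k).
(** A nonzero term [k] has [- x 0 i0 <= eps k <= 1 / (k + 1)], so truncating at the integer part of
    [1 / (- x 0 i0)] loses nothing; [borelE] replaces this variable bound by any larger fixed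
    one. *)
Let borel x : R := \sum_(k < (Num.truncn (- x 0 i0)^-1).+1) term k x.

Let term0 k x : (- x 0 i0)^-1 < k%:R -> x 0 i0 < 0 -> term k x = 0.
Proof.
move=> xk x0; rewrite /term /left_term chi_cut.2 ?mul0r ?mulr0 //.
rewrite ltr_pdivrMr // mulN1r ltrNr; apply: le_lt_trans (eps_le k) _.
rewrite -[ltRHS]invrK ltf_pV2 ?posrE ?invr_gt0 ?oppr_gt0 ?ltr0n //.
by apply: lt_trans xk _; rewrite ltr_nat.
Qed.

Let borelE N x : x 0 i0 < 0 -> (- x 0 i0)^-1 < N%:R -> borel x = \sum_(k < N) term k x.
Proof.
move=> x0 xN; have x1 : 0 <= (- x 0 i0)^-1 by rewrite invr_ge0 oppr_ge0 ltW.
set T := Num.truncn (- x 0 i0)^-1.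
have xT : (- x 0 i0)^-1 < T.+1%:R by rewrite truncnS_gt.
have key a b : (- x 0 i0)^-1 < a%:R -> (a <= b)%N ->
   \sum_(k < b) term k x = \sum_(k < a) term k x.
  move=> xa ab; rewrite -!(big_mkord predT (term^~ x)) (big_cat_nat _ ab) //=.
  rewrite [X in _ + X]big_nat_cond [X in _ + X]big1 ?addr0 // => k /andP[/andP[ak _] _].
  by apply: term0 => //; apply: lt_le_trans xa _; rewrite ler_nat.
rewrite /borel -/T; have [NT|TN] := leqP N T.+1; first exact: key.
by apply/esym/key => //; exact: ltnW.
Qed.

Let H x : R := if 0 <= x 0 i0 then g (upd x (Num.sqrt (x 0 i0))) else borel x.

Let H_pos x : 0 <= x 0 i0 -> H x = g (upd x (Num.sqrt (x 0 i0))).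
Proof. by rewrite /H => ->. Qed.

Let H_neg x : x 0 i0 < 0 -> H x = borel x.
Proof. by rewrite /H leNgt => ->. Qed.

Let WT M : Cinf R W (fun x => \sum_(k < M) x 0 i0 ^+ k * c k x).
Proof. by apply: (Cinf_sum _ _ _ (fun (k : 'I_M) x => x 0 i0 ^+ k * c k x) oW) => k; exact: Wmono. Qed.

(** The common Taylor polynomial in the normal coordinate is removed from both halves of [H]; what
    is left is flat enough on the hyperplane for [glue_flat]. *)
Let r M x : R := H x - \sum_(k < M) x 0 i0 ^+ k * c k x.

Let Vpos := V `&` [set x : 'rV[R]_n | 0 < x 0 i0].

Let oVpos : open Vpos.
Proof. by apply: (open_coord i0 V [set t | 0 < t]) => //; exact: open_gt. Qed.

Let r_pos M x : Vpos x -> r M x = root_quot i0 0 (rem M) x.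
Proof.
move=> [Vx x0]; rewrite /r H_pos ?ltW // /root_quot expr0 mul1r /rem upd_i0.
congr (_ - _); apply: eq_bigr => k _.
by rewrite (@sc k _ _ (VW _ Vx)) exprM sqr_sqrtr // ltW.
Qed.

(** Close to the hyperplane the first [M] cutoffs equal 1, so the polynomial cancels the head of the
    Borel sum and only the tail remains. *)
Let r_neg M N a x : V x -> a < x 0 i0 -> x 0 i0 < 0 -> (forall k, (k < M)%N -> - (2^-1 * eps k) <= a) ->
  (M <= N)%N -> (- x 0 i0)^-1 < N%:R -> r M x = \sum_(M <= k < N) term k x.
Proof.
move=> Vx ax x0 aeps MN xN; rewrite /r H_neg // (borelE N) //.
rewrite -!(big_mkord predT (term^~ x)) (big_cat_nat _ MN) //= addrAC.
rewrite [X in X - _](_ : _ = \sum_(k < M) x 0 i0 ^+ k * c k x) ?subrr ?add0r //.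
rewrite big_mkord; apply: eq_bigr => k _; rewrite /term /left_term chi1 ?mul1r //.
by rewrite ler_pdivlMr // mulNr; apply: (le_trans (aeps k (ltn_ord k))); exact: ltW.
Qed.

Let geometric_le m N : \sum_(m <= k < N) (2^-1 : R) ^+ k <= 2.
Proof.
have G : forall N, \sum_(0 <= k < N) (2^-1 : R) ^+ k = 2 - 2 * 2^-1 ^+ N.
  elim=> [|k IH]; first by rewrite big_geq // expr0; lra.
  by rewrite big_nat_recr //= IH exprS; lra.
apply: (@le_trans _ _ (\sum_(0 <= k < N) 2^-1 ^+ k)); last first.
  by rewrite G gerBl mulr_ge0 // exprn_ge0 // invr_ge0.
have [mN|Nm] := leqP m N.
  rewrite [leRHS](big_cat_nat _ mN) //= lerDr.
  by apply: sumr_ge0 => k _; rewrite exprn_ge0 // invr_ge0.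
rewrite big_geq ?(ltnW Nm) //.
by apply: sumr_ge0 => k _; rewrite exprn_ge0 // invr_ge0.
Qed.

Let WTerm k : Cinf R W (term k).
Proof. exact: (Cinf_left_term i0 W k chi (eps k) (c k) oW chi_cut (Wc k)). Qed.

Let H_Cinf_neg x : V x -> x 0 i0 < 0 -> exists U, [/\ open U, U x, U `<=` V & Cinf R U H].
Proof.
move=> Vx x0; pose U := V `&` [set y : 'rV[R]_n | y 0 i0 < x 0 i0 / 2].
have oU : open U by apply: (open_coord i0 V [set t | t < x 0 i0 / 2]) => //; exact: open_lt.
exists U; split=> //; [by split=> //=; lra|by move=> y []|].
pose N := (Num.truncn (- (x 0 i0 / 2))^-1).+1.
have UN y : U y -> y 0 i0 < 0 /\ (- y 0 i0)^-1 < N%:R.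
  case=> Vy /= yx; split; first lra.
  apply: (@lt_trans _ _ (- (x 0 i0 / 2))^-1); last by rewrite truncnS_gt.
  by rewrite ltf_pV2 ?posrE; lra.
apply: (Cinf_ext _ (fun y => \sum_(k < N) term k y) _ oU).
  by move=> y /UN[y0 yN]; rewrite H_neg // (borelE N).
apply: (Cinf_subset W); first by move=> y [/VW].
exact: (Cinf_sum _ _ _ (fun (k : 'I_N) y => term k y) oW (fun k => WTerm k)).
Qed.

Let H_Cinf_pos : Cinf R Vpos H.
Proof.
have oWp : open (W `&` [set x : 'rV[R]_n | 0 < x 0 i0]).
  by apply: (open_coord i0 W [set t | 0 < t]) => //; exact: open_gt.
have WH := Cinf_root_quot i0 _ _ 0 oW cW Wg.
apply: (Cinf_ext _ (root_quot i0 0 g) _ oVpos).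
  by move=> x [Vx x0]; rewrite H_pos ?ltW // /root_quot expr0 mul1r.
by apply: Cinf_subset WH => x [/VW Wx x0].
Qed.

Let r_bound_pos M l z : ((size l).*2 + 4 <= 2 * M)%N -> V z -> z 0 i0 = 0 ->
  exists C, 0 <= C /\ \forall x \near z, 0 < (x : 'rV[R]_n) 0 i0 -> `|pd R (r M) l x| <= C * x 0 i0 ^+ 2.
Proof.
move=> lM Vz z0.
have [C [C0 HC]] := root_quot_bound i0 l 0 (2 * M) W _ z oW cW (Wrem M) (@rem_vanish M) lM (VW _ Vz) z0.
exists C; split=> //.
apply: filterS2 HC (open_nbhs_nbhs (conj oV Vz)) => x HC Vx x0.
by rewrite (pd_ext _ _ _ l oVpos (r_pos M) x (conj Vx x0)); exact: HC.
Qed.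

Let r_bound_neg M l z : (size l + 3 <= M)%N -> V z -> z 0 i0 = 0 ->
  \forall x \near z, (x : 'rV[R]_n) 0 i0 < 0 -> `|pd R (r M) l x| <= 2 * x 0 i0 ^+ 2.
Proof.
move=> lM Vz z0.
(* To the right of [a] the cutoffs with index below [M] are all 1. *)
have [a a0 Ha] : exists2 a, a < 0 & forall k, (k < M)%N -> - (2^-1 * eps k) <= a.
  elim: (M) => [|M' [a a0 Ha]]; first by exists (-1) => //; rewrite oppr_lt0.
  exists (Num.max a (- (2^-1 * eps M'))).
    by rewrite gt_max a0 oppr_lt0 mulr_gt0 ?eps_gt0 // invr_gt0.
  by move=> k; rewrite ltnS leq_eqVlt le_max => /predU1P[->|/Ha ->//]; rewrite lexx orbT.
have az : \forall x \near z, a < (x : 'rV[R]_n) 0 i0.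
  have oA : open (V `&` [set x : 'rV[R]_n | a < x 0 i0]).
    by apply: (open_coord i0 V [set t | a < t]) => //; exact: open_gt.
  by apply: filterS (open_nbhs_nbhs (conj oA _)) => [x []//|]; split=> //=; rewrite z0.
apply: filterS2 az (open_nbhs_nbhs (conj oV Vz)) => x ax Vx x0.
(* On this neighbourhood of [x] the normal coordinate stays below half its value at [x], so one
   number [N] of terms serves for all points and the sum can be differentiated term by term. *)
pose U := V `&` [set y : 'rV[R]_n | `]a, (x 0 i0 / 2)[%classic (y 0 i0)].
have oU : open U by apply: (open_coord i0 V `]a, (x 0 i0 / 2)[%classic) => //; exact: interval_open.
have Ux : U x by split=> //=; rewrite in_itv /= ax /=; lra.
pose T := (Num.truncn (- (x 0 i0 / 2))^-1).+1; pose N := (M + T)%N.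
have UE y : U y -> r M y = \sum_(M <= k < N) term k y.
  case=> Vy; rewrite /= in_itv /= => /andP[ay yx].
  apply: (r_neg M N a) => //; [lra|exact: leq_addr|].
  apply: (@lt_trans _ _ (- (x 0 i0 / 2))^-1); first by rewrite ltf_pV2 ?posrE; lra.
  apply: (@lt_le_trans _ _ T%:R); first by rewrite truncnS_gt.
  by rewrite ler_nat leq_addl.
rewrite (pd_ext _ _ _ l oU UE x Ux).
have UT k : Cinf R U (term k) by apply: Cinf_subset (WTerm k) => y [/VW].
rewrite (pd_sum U (index_iota M N) term l oU UT x Ux).
apply: (le_trans (ler_norm_sum _ _ _)).
apply: (@le_trans _ _ (\sum_(M <= k < N) 2^-1 ^+ k * x 0 i0 ^+ 2)).
  apply: ler_sum_nat => k /andP[Mk _]; apply: eps_bound => //.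
  exact: leq_trans lM Mk.
by rewrite -mulr_suml ler_wpM2r ?sqr_ge0 ?geometric_le.
Qed.

(** The last clause records the locality of the Borel sum: if all normal derivatives of [g] vanish
    at the foot of [x] on the slice, then every coefficient there is 0. It is what preserves local
    finiteness of families. *)
Lemma whitney_even : exists F : 'rV[R]_n -> R, [/\ Cinf R V F,
  (forall x, V x -> 0 <= x 0 i0 -> F x = g (upd x (Num.sqrt (x 0 i0)))) &
  (forall x, V x -> x 0 i0 < 0 -> (forall j, pd R g (nseq j i0) (upd x 0) = 0) -> F x = 0)].
Proof.
exists H; split; last 2 first.
- by move=> x _; exact: H_pos.
- move=> x _ x0 g0; rewrite H_neg // /borel big1 // => k _.
  by rewrite /term /left_term /c g0 !mulr0.
(* [H] does not depend on [L]; only the polynomial compared with it does. Lists of length at most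
   [L] then meet both requirements, [size l + 3 <= M] on the left and [2 * size l + 4 <= 2 * M] on
   the right. *)
apply/CinfP => L; pose M := (L + 3)%N.
have VT := Cinf_subset _ _ _ VW (WT M).
have rL : Ck L V (r M); last first.
  have := Ck_add _ _ _ _ oV rL ((CinfP _ _).1 VT L).
  by apply: Ck_ext oV _ => x _; rewrite /r subrK.
apply: (glue_flat i0 L V (r M) oV).
- move=> x Vx x0; rewrite /r H_pos ?x0 // sqrtr0 (upd_on i0 x x0) /M addnC big_ord_recl /=.
  rewrite big1 ?addr0 => [|k _]; last by rewrite exprS mul0r mul0r.
  by rewrite expr0 mul1r /c muln0 fact0 invr1 mul1r /= (upd_on i0 x x0) subrr.
- apply: Ck_local => x [Vx xn0].
  have VTL U : open U -> U `<=` V -> Ck L U (fun x => - \sum_(k < M) x 0 i0 ^+ k * c k x).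
    move=> oU UV; apply: ((CinfP _ _).1 _ L).
    by apply: (Cinf_opp _ _ oU); exact: Cinf_subset VT.
  have [x0|x0|x0] := ltgtP (x 0 i0) 0; last by rewrite /= x0 eqxx in xn0.
  + have [U [oU Ux UV UH]] := H_Cinf_neg x Vx x0; exists U => //.
    exact: (Ck_add _ _ _ _ oU ((CinfP _ _).1 UH L) (VTL U oU UV)).
  + exists Vpos; first by [].
    by apply: (Ck_add _ _ _ _ oVpos ((CinfP _ _).1 H_Cinf_pos L) (VTL Vpos oVpos _)) => y [].
- move=> l lL z Vz z0.
  have lM : ((size l).*2 + 4 <= 2 * M)%N.
    rewrite mul2n /M doubleD; apply: leq_add => //.
    by rewrite leq_double.
  have [C [C0 HC]] := r_bound_pos M l z lM Vz z0.
  have lM3 : (size l + 3 <= M)%N by rewrite leq_add2r.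
  exists (C + 2); apply: filterS2 HC (r_bound_neg M l z lM3 Vz z0) => x HC HNx xn0.
  have t2 := sqr_ge0 (x 0 i0); rewrite mulrDl.
  have [x0|x0|x0] := ltgtP (x 0 i0) 0; last by rewrite x0 eqxx in xn0.
  + by apply: (le_trans (HNx x0)); rewrite lerDr mulr_ge0.
  + by apply: (le_trans (HC x0)); rewrite lerDl mulr_ge0.
Qed.

End Extension.
End WhitneyEven.

(** * The D-topology of a fat disk *)

Section EuclideanNorm.
Context {R : realType}.
Local Notation enorm := (@enorm R _).

Definition nsq {n} (u : 'rV[R]_n) : R := \sum_(i < n) u 0 i ^+ 2.

Lemma nsq_ge0 {n} (u : 'rV[R]_n) : 0 <= nsq u.
Proof. by apply: sumr_ge0 => i _; exact: sqr_ge0. Qed.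

Lemma enorm_ge0 {n} (u : 'rV[R]_n) : 0 <= enorm u.
Proof. exact: sqrtr_ge0. Qed.

Lemma enorm_sq {n} (u : 'rV[R]_n) : enorm u ^+ 2 = nsq u.
Proof. by rewrite sqr_sqrtr // nsq_ge0. Qed.

Lemma enorm_eq0 {n} (u : 'rV[R]_n) : (enorm u == 0) = (u == 0).
Proof.
apply/eqP/eqP => [u0|->]; last first.
  by rewrite /Defs.enorm big1 ?sqrtr0 // => i _; rewrite mxE expr0n.
have : nsq u = 0 by rewrite -enorm_sq u0 expr0n.
move/eqP; rewrite psumr_eq0 => [/allP H|i _]; last exact: sqr_ge0.
by apply/rowP => i; rewrite mxE; have := H i (mem_index_enum i); rewrite sqrf_eq0 => /eqP.
Qed.

Lemma enorm_gt0 {n} (u : 'rV[R]_n) : (0 < enorm u) = (u != 0).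
Proof. by rewrite lt0r enorm_ge0 andbT enorm_eq0. Qed.

Lemma nsq_gt0 {n} (u : 'rV[R]_n) : (0 < nsq u) = (u != 0).
Proof. by rewrite lt0r nsq_ge0 andbT -enorm_sq sqrf_eq0 enorm_eq0. Qed.

Lemma enormZ {n} (a : R) (u : 'rV[R]_n) : enorm (a *: u) = `|a| * enorm u.
Proof.
rewrite /Defs.enorm -sqrtr_sqr -sqrtrM ?sqr_ge0 // mulr_sumr; congr Num.sqrt.
by apply: eq_bigr => i _; rewrite mxE exprMn.
Qed.

Lemma coord_le_enorm {n} (u : 'rV[R]_n) i : `|u 0 i| <= enorm u.
Proof.
rewrite -sqrtr_sqr; apply: ler_wsqrtr; rewrite (bigD1 i) //= lerDl.
by apply: sumr_ge0 => j _; exact: sqr_ge0.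
Qed.

Lemma norm_le_enorm {n} (u : 'rV[R]_n) : `|u| <= enorm u.
Proof. by apply: rV_norm_le => [|j]; [exact: enorm_ge0|exact: coord_le_enorm]. Qed.

Lemma nsq_continuous {n} : continuous (@nsq n).
Proof.
move=> u; apply: (@cvg_sumr _ _ _ _ (nbhs u) _ (fun j (h : 'rV[R]_n) => h 0 j ^+ 2)) => j.
by apply: continuousM; exact: coord_continuous.
Qed.

Lemma enorm_continuous {n} : continuous (@Defs.enorm R n).
Proof.
move=> u; apply: (@continuous_comp _ _ _ (@nsq n) Num.sqrt); first exact: nsq_continuous.
exact: sqrt_continuous.
Qed.

Lemma Cinf_nsq {k n} (U : set 'rV[R]_k) (F : 'rV[R]_k -> 'rV[R]_n) : open U ->
  Cinf R U F -> Cinf R U (fun y => nsq (F y)).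
Proof.
move=> oU /(Cinf_vecP _ _ oU) HF.
apply: (Cinf_sum _ _ _ (fun j y => F y 0 j ^+ 2) oU) => j.
exact: (Cinf_exp _ _ _ oU).
Qed.

Lemma Cinf_enorm {k n} (U : set 'rV[R]_k) (F : 'rV[R]_k -> 'rV[R]_n) : open U ->
  Cinf R U F -> (forall y, U y -> F y != 0) -> Cinf R U (fun y => enorm (F y)).
Proof.
move=> oU HF F0.
apply: (Cinf_comp1 U [set t | 0 < t] (fun y => nsq (F y)) Num.sqrt oU Ck1_sqrt (Cinf_nsq _ _ oU HF)).
by move=> y Uy; rewrite /= nsq_gt0; exact: F0.
Qed.

Lemma Cinf_inv {k} (U : set 'rV[R]_k) (f : 'rV[R]_k -> R) : open U -> Cinf R U f ->
  (forall y, U y -> f y != 0) -> Cinf R U (fun y => (f y)^-1).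
Proof. by move=> oU Uf f0; exact: (Cinf_comp1 U [set t | t != 0] f GRing.inv oU Ck1_inv Uf f0). Qed.

Lemma Cinf_scale {k n} (U : set 'rV[R]_k) (a : 'rV[R]_k -> R) (F : 'rV[R]_k -> 'rV[R]_n) :
  open U -> Cinf R U a -> Cinf R U F -> Cinf R U (fun y => a y *: F y).
Proof.
move=> oU Ua /(Cinf_vecP _ _ oU) UF; apply/(Cinf_vecP _ _ oU) => j.
apply: (Cinf_ext _ (fun y => a y * F y 0 j) _ oU); first by move=> y _; rewrite mxE.
exact: (Cinf_mul _ _ _ oU Ua (UF j)).
Qed.

Lemma Cinf_row_mx {k n m} (U : set 'rV[R]_k) (F : 'rV[R]_k -> 'rV[R]_n) (G : 'rV[R]_k -> 'rV[R]_m) :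
  open U -> Cinf R U F -> Cinf R U G -> Cinf R U (fun y => row_mx (F y) (G y)).
Proof.
move=> oU /(Cinf_vecP _ _ oU) UF /(Cinf_vecP _ _ oU) UG; apply/(Cinf_vecP _ _ oU) => j.
case: (splitP j) => i ji.
  apply: (Cinf_ext _ _ _ oU _ (UF i)) => y _.
  by rewrite (_ : j = lshift m i) ?row_mxEl //; apply/val_inj.
apply: (Cinf_ext _ _ _ oU _ (UG i)) => y _.
by rewrite (_ : j = rshift n i) ?row_mxEr //; apply/val_inj.
Qed.

Lemma Cinf_lsubmx {n m} (U : set 'rV[R]_(n + m)) : open U -> Cinf R U (@lsubmx R 1 n m).
Proof.
move=> oU; apply/(Cinf_vecP _ _ oU) => j.
by apply: (Cinf_ext _ _ _ oU _ (Cinf_coord U (lshift m j))) => y _; rewrite mxE.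
Qed.

Lemma Cinf_rsubmx {n m} (U : set 'rV[R]_(n + m)) : open U -> Cinf R U (@rsubmx R 1 n m).
Proof.
move=> oU; apply/(Cinf_vecP _ _ oU) => j.
by apply: (Cinf_ext _ _ _ oU _ (Cinf_coord U (rshift n j))) => y _; rewrite mxE.
Qed.

Lemma Cinf_vec_comp {k l n} (U : set 'rV[R]_k) (V : set 'rV[R]_l) (F : 'rV[R]_l -> 'rV[R]_n)
  (G : 'rV[R]_k -> 'rV[R]_l) : open U -> open V -> Cinf R V F -> Cinf R U G ->
  (forall y, U y -> V (G y)) -> Cinf R U (F \o G).
Proof.
move=> oU oV /(Cinf_vecP _ _ oV) VF UG UV; apply/(Cinf_vecP _ _ oU) => j.
exact: (Cinf_comp U V (fun x => F x 0 j) G oU oV (VF j) UG UV).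
Qed.

Lemma continuous_row_mx {T : topologicalType} {n m} (F : T -> 'rV[R]_n) (G : T -> 'rV[R]_m) x :
  {for x, continuous F} -> {for x, continuous G} ->
  {for x, continuous (fun t => row_mx (F t) (G t))}.
Proof.
move=> /rV_continuousP cF /rV_continuousP cG; apply/rV_continuousP => j.
case: (splitP j) => i ji.
  have -> : (fun t => row_mx (F t) (G t) 0 j) = (fun t => F t 0 i); last exact: cF.
  by apply/funext => t; rewrite (_ : j = lshift m i) ?row_mxEl //; apply/val_inj.
have -> : (fun t => row_mx (F t) (G t) 0 j) = (fun t => G t 0 i); last exact: cG.
by apply/funext => t; rewrite (_ : j = rshift n i) ?row_mxEr //; apply/val_inj.
Qed.

Lemma continuous_sub_at {T : topologicalType} (f g : T -> R) x :
  {for x, continuous f} -> {for x, continuous g} -> {for x, continuous (fun t => f t - g t)}.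
Proof. by move=> cf cg; apply: cvgB; [exact: cf|exact: cg]. Qed.

Lemma continuous_add_at {T : topologicalType} (f g : T -> R) x :
  {for x, continuous f} -> {for x, continuous g} -> {for x, continuous (fun t => f t + g t)}.
Proof. by move=> cf cg; apply: cvgD; [exact: cf|exact: cg]. Qed.

Lemma continuous_cst_at {T : topologicalType} (a : R) (x : T) : {for x, continuous (fun=> a)}.
Proof. exact: cst_continuous. Qed.

Lemma continuous_scalar_row {T : topologicalType} (f : T -> R) x :
  {for x, continuous f} -> {for x, continuous (fun t => f t *: (1 : 'rV[R]_1))}.
Proof.
move=> cf; apply/rV_continuousP => j.
by have -> : (fun t => (f t *: (1 : 'rV[R]_1)) 0 j) = f
  by apply/funext => t; rewrite ord1 !mxE eqxx mulr1.
Qed.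

Lemma continuous_lsubmx {n m} : continuous (@lsubmx R 1 n m).
Proof.
move=> x; apply/rV_continuousP => j.
have -> : (fun t : 'rV[R]_(n + m) => lsubmx t 0 j) = (fun t => t 0 (lshift m j)).
  by apply/funext => t; rewrite mxE.
exact: coord_continuous.
Qed.

Lemma continuous_rsubmx {n m} : continuous (@rsubmx R 1 n m).
Proof.
move=> x; apply/rV_continuousP => j.
have -> : (fun t : 'rV[R]_(n + m) => rsubmx t 0 j) = (fun t => t 0 (rshift n j)).
  by apply/funext => t; rewrite mxE.
exact: coord_continuous.
Qed.

Lemma open_preimage {T U : topologicalType} (f : T -> U) (A : set U) :
  (forall x, {for x, continuous f}) -> open A -> open [set x | A (f x)].
Proof. by move=> cf oA; apply: open_comp => // x _; exact: cf. Qed.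

Lemma compact_enorm_le {n} (r : R) : compact [set u : 'rV[R]_n | enorm u <= r].
Proof.
apply: bounded_closed_compact.
  exists r; split; first exact: num_real.
  by move=> M rM u /= ur; apply: (le_trans (norm_le_enorm u)); rewrite (le_trans ur) // ltW.
apply: (@closed_comp _ _ (@Defs.enorm R n) [set t | t <= r]); last exact: closed_le.
by move=> u _; exact: enorm_continuous.
Qed.

Lemma Cinf_ext_vec {k n} (U : set 'rV[R]_k) (F G : 'rV[R]_k -> 'rV[R]_n) : open U ->
  (forall y, U y -> F y = G y) -> Cinf R U F -> Cinf R U G.
Proof.
move=> oU FG /(Cinf_vecP _ _ oU) UF; apply/(Cinf_vecP _ _ oU) => j.
by apply: (Cinf_ext _ _ _ oU _ (UF j)) => y Uy; rewrite FG.
Qed.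

End EuclideanNorm.

(** * Smooth parametrizations of the fat disk *)

Section DiskTopology.
Context {R : realType} {n m : nat}.
Local Notation en := (@enorm R _).
Local Notation phi := (phi R).
Local Notation Dset := (Dset R n m).
Local Notation Disk := (Disk R n m).
Local Notation Disk_plots := (Disk_plots R n m).
Local Notation E2 := ('rV[R]_n * 'rV[R]_m)%type.
Implicit Types (O : set Disk) (q w : E2).

Lemma Disk_plot_lift (k : nat) (U : set 'rV[R]_k) (P : 'rV[R]_k -> E2) (p0 : Disk) :
  open U -> Cinf R U (fun y => (P y).1) -> Cinf R U (fun y => (P y).2) ->
  (forall y, U y -> Dset (P y)) ->
  exists2 Q : 'rV[R]_k -> Disk, Disk_plots k U Q & forall y, U y -> sval (Q y) = P y.
Proof.
move=> oU P1 P2 UD.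
(* Values outside [U] are irrelevant for a plot; [p0] fills them in. *)
pose Q y : Disk := match pselect (Dset (P y)) with
  left H => exist _ (P y) H | right _ => p0 end.
have QP y : U y -> sval (Q y) = P y.
  by rewrite /Q => Uy; case: pselect => // /(_ (UD _ Uy)).
exists Q; last exact: QP.
split; [exact: oU| |].
  by apply: (Cinf_ext_vec _ _ _ oU _ P1) => y Uy; rewrite QP.
by apply: (Cinf_ext_vec _ _ _ oU _ P2) => y Uy; rewrite QP.
Qed.

Lemma Disk_eq (p q : Disk) : sval p = sval q -> p = q.
Proof. exact: eq_sig_hprop (fun _ => @Prop_irrelevance _) _ _. Qed.

(* A smooth parametrization with a continuous section shows that a D-open set
   is a Euclidean neighbourhood. *)
Lemma Dopen_section O (p : Disk) (k : nat) (U : set 'rV[R]_k) (P : 'rV[R]_k -> E2)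
    (sec : E2 -> 'rV[R]_k) :
  Dopen R Disk_plots O -> O p ->
  open U -> Cinf R U (fun y => (P y).1) -> Cinf R U (fun y => (P y).2) ->
  (forall y, U y -> Dset (P y)) ->
  U (sec (sval p)) -> {for sval p, continuous sec} ->
  (\forall w \near sval p, Dset w -> P (sec w) = w) ->
  \forall w \near sval p, forall q : Disk, sval q = w -> O q.
Proof.
move=> dO Op oU P1 P2 UD Up csec secK.
have [Q Qplot QP] := Disk_plot_lift _ _ _ p oU P1 P2 UD.
have oUQ := dO _ _ _ Qplot.
have Psp : P (sec (sval p)) = sval p by apply: nbhs_singleton secK _; exact: svalP.
have UQp : (U `&` Q @^-1` O) (sec (sval p)).
  split=> //=; suff -> : Q (sec (sval p)) = p by [].
  by apply: Disk_eq; rewrite QP.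
have N := csec _ (open_nbhs_nbhs (conj oUQ UQp)).
apply: filterS2 secK N => w wK [Uw Ow] q qw.
suff -> : q = Q (sec w) by [].
by apply: Disk_eq; rewrite QP // wK // -qw; exact: svalP.
Qed.

(** For [|u| < 1] the value of [phi] must be positive, so its argument exceeds -1/2. This bounds the
    part of the disk inside the rim, which gives the compactness used for tubes. *)
Lemma Dset_narrow w : Dset w -> en w.1 < 1 -> en w.2 < 5 / 2.
Proof.
rewrite /Defs.Dset => D u1; rewrite ltNge; apply/negP => v2.
by have := phi_le0 (2 - en w.1 - en w.2); have := enorm_ge0 w.1; lra.
Qed.

Lemma Dset_outer w : 1 <= en w.1 -> Dset w.
Proof. by rewrite /Defs.Dset => u1; have := phi_ge0 (2 - en w.1 - en w.2); lra. Qed.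

(** Over [v = 0] the defining inequality is strict, hence these points are interior in the Euclidean
    space and need no polar coordinates in [v]. *)
Lemma Dset_zero_interior (u : 'rV[R]_n) : 1 - phi (2 - en u - 0) < en u.
Proof. by have := phi_ge_shift (2 - en u - 0); have := @kap_gt R; lra. Qed.

Let cfst q : {for q, continuous (fun w => en w.1)}.
Proof. by apply: (@continuous_comp _ _ _ fst); [exact: cvg_fst|exact: enorm_continuous]. Qed.

Let csnd q : {for q, continuous (fun w => en w.2)}.
Proof. by apply: (@continuous_comp _ _ _ snd); [exact: cvg_snd|exact: enorm_continuous]. Qed.

Let near_gt {T : topologicalType} (f : T -> R) x a : {for x, continuous f} -> a < f x ->
  \forall y \near x, a < f y.
Proof.
move=> cf ax; have /= := cf [set t | a < t]; apply.
by apply: open_nbhs_nbhs; split=> //; exact: open_gt.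
Qed.

Lemma Dopen_near_interior O (p : Disk) : Dopen R Disk_plots O -> O p ->
  (sval p).2 = 0 -> \forall w \near sval p, forall q : Disk, sval q = w -> O q.
Proof.
move=> dO Op p2.
pose Un := [set y : 'rV[R]_(n + m) |
  0 < en (lsubmx y) - (1 - phi (2 - en (lsubmx y) - en (rsubmx y)))].
have oU : open Un.
  have cl : continuous (fun y : 'rV[R]_(n + m) => en (lsubmx y)).
    by move=> y; apply: continuous_comp; [exact: continuous_lsubmx|exact: enorm_continuous].
  have cr : continuous (fun y : 'rV[R]_(n + m) => en (rsubmx y)).
    by move=> y; apply: continuous_comp; [exact: continuous_rsubmx|exact: enorm_continuous].
  apply: (@open_preimage _ _ (fun y : 'rV[R]_(n + m) =>
    en (lsubmx y) - (1 - phi (2 - en (lsubmx y) - en (rsubmx y)))) [set t | 0 < t]).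
    move=> y; have c2 : {for y, continuous (fun y : 'rV[R]_(n + m) => 2 - en (lsubmx y) - en (rsubmx y))}.
      apply: continuous_sub_at; last exact: cr.
      by apply: continuous_sub_at; [exact: continuous_cst_at|exact: cl].
    have c3 : {for y, continuous (fun y : 'rV[R]_(n + m) => phi (2 - en (lsubmx y) - en (rsubmx y)))}.
      by apply: continuous_comp; [exact: c2|exact: phi_continuous].
    apply: continuous_sub_at; first exact: cl.
    by apply: continuous_sub_at; [exact: continuous_cst_at|exact: c3].
  exact: open_gt.
apply: (Dopen_section O p (n + m) Un (fun y => (lsubmx y, rsubmx y)) (fun w => row_mx w.1 w.2) dO Op oU).
- exact: (Cinf_lsubmx _ oU).
- exact: (Cinf_rsubmx _ oU).
- by move=> y; rewrite /Un /Defs.Dset /=; lra.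
- rewrite /Un /= row_mxKl row_mxKr p2.
  have -> : en (0 : 'rV[R]_m) = 0 by apply/eqP; rewrite enorm_eq0.
  by have := Dset_zero_interior (sval p).1; lra.
- by apply: continuous_row_mx; [exact: cvg_fst|exact: cvg_snd].
- by near=> w; rewrite row_mxKl row_mxKr -surjective_pairing.
Unshelve. all: by end_near. Qed.

Lemma enorm_unit {k} (a : R) (u : 'rV[R]_k) : u != 0 -> 0 <= a -> en (a *: ((en u)^-1 *: u)) = a.
Proof.
move=> u0 a0; rewrite !enormZ ger0_norm // ger0_norm ?invr_ge0 ?enorm_ge0 //.
by rewrite mulVf ?mulr1 // enorm_eq0.
Qed.

Lemma unit_scaleK {k} (u : 'rV[R]_k) : u != 0 -> en u *: ((en u)^-1 *: u) = u.
Proof. by move=> u0; rewrite scalerA mulfV ?scale1r // enorm_eq0. Qed.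

Let c1 {k} (y : 'rV[R]_(1 + k)) : R := y 0 (lshift k 0).

Let Cinf_c1 {k} (U : set 'rV[R]_(1 + k)) : Cinf R U (@c1 k).
Proof. exact: Cinf_coord. Qed.

Let scal (t : R) : 'rV[R]_1 := t *: 1.

Let c1_row {k} t (x : 'rV[R]_k) : c1 (row_mx (scal t) x) = t.
Proof. by rewrite /c1 row_mxEl !mxE eqxx mulr1. Qed.

Let open_neq0 {T : topologicalType} {k} (f : T -> 'rV[R]_k) : continuous f ->
  open [set y | f y != 0].
Proof.
move=> cf; have -> : [set y | f y != 0] = [set y | 0 < en (f y)].
  by apply/seteqP; split=> y /=; rewrite enorm_gt0.
apply: (@open_preimage _ _ (fun y => en (f y)) [set t | 0 < t]); last exact: open_gt.
by move=> y; apply: continuous_comp; [exact: cf|exact: enorm_continuous].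
Qed.

(** For small [|u|] the argument of [phi] is in its affine range, where [|u|] cancels and the disk
    is given by [|v| <= 1 + kap]. Setting [|v| = 1 + kap - s ^+ 2] and keeping [u] as a free
    coordinate avoids the singularity of the norm at [u = 0]. *)
Lemma Dopen_near_axis O (p : Disk) : Dopen R Disk_plots O -> O p ->
  (sval p).1 = 0 -> (sval p).2 != 0 -> \forall w \near sval p, forall q : Disk, sval q = w -> O q.
Proof.
move=> dO Op p1 p2.
pose K := @kap R.
pose uu (y : 'rV[R]_(1 + (n + m))) := lsubmx (rsubmx y).
pose vv (y : 'rV[R]_(1 + (n + m))) := rsubmx (rsubmx y).
have cu : continuous uu by move=> y; apply: continuous_comp; [exact: continuous_rsubmx|exact: continuous_lsubmx].
have cv : continuous vv by move=> y; apply: continuous_comp; [exact: continuous_rsubmx|exact: continuous_rsubmx].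
pose bb (y : 'rV[R]_(1 + (n + m))) := 1 + K - c1 y ^+ 2.
have cb : continuous bb.
  by move=> y; exact: (Cinf_continuous setT _ _ (Cinf_sub _ _ _ openT (Cinf_cst _ _) (Cinf_exp _ _ _ openT (Cinf_c1 _)))).
pose Un := [set y | vv y != 0] `&` [set y | 0 < bb y].
have oU : open Un.
  apply: openI; first exact: open_neq0.
  by apply: (@open_preimage _ _ bb [set t | 0 < t]) => //; exact: open_gt.
have Cu : Cinf R Un uu by apply: (Cinf_vec_comp Un setT (@lsubmx R 1 n m) rsubmx oU openT (Cinf_lsubmx _ openT) (Cinf_rsubmx _ oU)).
have Cv : Cinf R Un vv by apply: (Cinf_vec_comp Un setT (@rsubmx R 1 n m) rsubmx oU openT (Cinf_rsubmx _ openT) (Cinf_rsubmx _ oU)).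
have v0 y : Un y -> vv y != 0 by case.
have p1' : en (sval p).1 = 0 by apply/eqP; rewrite p1 enorm_eq0.
have K2 := @kap_gt R; have K1 := @kap_lt R.
have near_b w : Dset w -> en w.1 < 2^-1 - K -> en w.2 <= 1 + K.
  rewrite /Defs.Dset => D w1; have [c2|c2] := leP 2^-1 (2 - en w.1 - en w.2).
    by move: D; rewrite phi_ge_half // -/K; lra.
  by have := phi_le _ _ (ltW c2); rewrite (phi_ge_half 2^-1) // -/K; lra.
apply: (Dopen_section O p (1 + (n + m)) Un (fun y => (uu y, bb y *: ((en (vv y))^-1 *: vv y)))
  (fun w => row_mx (scal (Num.sqrt (1 + K - en w.2))) (row_mx w.1 w.2)) dO Op oU).
- exact: Cu.
- apply: (Cinf_scale _ _ _ oU).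
    exact: (Cinf_sub _ _ _ oU (Cinf_cst _ _) (Cinf_exp _ _ _ oU (Cinf_c1 _))).
  apply: (Cinf_scale _ _ _ oU _ Cv); apply: (Cinf_inv _ _ oU (Cinf_enorm _ _ oU Cv v0)).
  by move=> y /v0; rewrite enorm_eq0.
- move=> y [vy by0]; rewrite /Defs.Dset /= (enorm_unit _ _ vy (ltW by0)).
  have := phi_ge_shift (2 - en (uu y) - bb y); rewrite -/K /bb.
  by have := sqr_ge0 (c1 y); lra.
- rewrite /Un /uu /vv /bb /= c1_row !row_mxKr; split=> //=.
  have := near_b _ (svalP p); rewrite p1' => H.
  rewrite sqr_sqrtr; last by rewrite subr_ge0; apply: H; rewrite /K; lra.
  by rewrite opprB addrC subrK enorm_gt0.
- apply: continuous_row_mx; last by apply: continuous_row_mx; [exact: cvg_fst|exact: cvg_snd].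
  apply: continuous_scalar_row; apply: (@continuous_comp _ _ _ (fun w : E2 => 1 + K - en w.2) Num.sqrt).
    by apply: continuous_sub_at; [exact: continuous_cst_at|exact: csnd].
  exact: sqrt_continuous.
- have N1 : \forall w \near sval p, - (2^-1 - K) < - en w.1.
    apply: (near_gt (fun w : E2 => - en w.1)); last by rewrite p1' /K; lra.
    by apply: continuousN; exact: cfst.
  have N2 : \forall w \near sval p, 0 < en w.2.
    by apply: (near_gt (fun w : E2 => en w.2)); [exact: csnd|rewrite enorm_gt0].
  apply: filterS2 N1 N2 => w w1 w2 Dw.
  rewrite /uu /vv /bb /= c1_row !row_mxKr row_mxKl sqr_sqrtr; last first.
    by rewrite subr_ge0; apply: near_b => //; rewrite ltrN2 in w1.
  rewrite opprB addrC subrK unit_scaleK -?enorm_gt0 //.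
  by rewrite -surjective_pairing.
Qed.

(** In the coordinates [c = 2 - |u| - |v|] and the slack [s ^+ 2 = |u| - 1 + phi c] the inequality
    becomes automatic: [|u| = 1 - phi c + s ^+ 2] and [|v| = 1 - c + phi c - s ^+ 2]. Directions of
    [u] and [v] are kept as unnormalized vectors. *)
Lemma Dopen_near_generic O (p : Disk) : Dopen R Disk_plots O -> O p ->
  (sval p).1 != 0 -> (sval p).2 != 0 -> \forall w \near sval p, forall q : Disk, sval q = w -> O q.
Proof.
move=> dO Op p1 p2.
pose T := 'rV[R]_(1 + (1 + (n + m))).
pose cc (y : T) := c1 y.
pose ss (y : T) := c1 (rsubmx y).
pose uu (y : T) := lsubmx (rsubmx (rsubmx y)).
pose vv (y : T) := rsubmx (rsubmx (rsubmx y)).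
have r2 : continuous (fun y : T => rsubmx (rsubmx y)).
  by move=> y; apply: continuous_comp; [exact: continuous_rsubmx|exact: continuous_rsubmx].
have cu : continuous uu by move=> y; apply: continuous_comp; [exact: r2|exact: continuous_lsubmx].
have cv : continuous vv by move=> y; apply: continuous_comp; [exact: r2|exact: continuous_rsubmx].
pose aa (y : T) := 1 - phi (cc y) + ss y ^+ 2.
pose bb (y : T) := 1 - cc y + phi (cc y) - ss y ^+ 2.
have Cphi (U : set T) : open U -> Cinf R U (fun y => phi (cc y)).
  move=> oU; exact: (Cinf_comp1 U setT cc phi oU Ck1_phi (Cinf_c1 _) (fun _ _ => I)).
have Css (U : set T) : open U -> Cinf R U ss.
  move=> oU; exact: (Cinf_comp U setT c1 rsubmx oU openT (Cinf_c1 _) (Cinf_rsubmx _ oU)).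
have Ca (U : set T) : open U -> Cinf R U aa.
  move=> oU; apply: (Cinf_add _ _ _ oU _ (Cinf_exp _ _ _ oU (Css _ oU))).
  exact: (Cinf_sub _ _ _ oU (Cinf_cst _ _) (Cphi _ oU)).
have Cb (U : set T) : open U -> Cinf R U bb.
  move=> oU; apply: (Cinf_sub _ _ _ oU _ (Cinf_exp _ _ _ oU (Css _ oU))).
  apply: (Cinf_add _ _ _ oU _ (Cphi _ oU)).
  exact: (Cinf_sub _ _ _ oU (Cinf_cst _ _) (Cinf_c1 _)).
have ca : continuous aa by move=> y; exact: (Cinf_continuous setT _ _ (Ca _ openT)).
have cb : continuous bb by move=> y; exact: (Cinf_continuous setT _ _ (Cb _ openT)).
pose Un := ([set y | uu y != 0] `&` [set y | vv y != 0]) `&` ([set y | 0 < aa y] `&` [set y | 0 < bb y]).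
have oU : open Un.
  apply: openI; first by apply: openI; exact: open_neq0.
  by apply: openI; [apply: (@open_preimage _ _ aa [set t | 0 < t])|
    apply: (@open_preimage _ _ bb [set t | 0 < t])] => //; exact: open_gt.
have Cr : Cinf R Un (fun y : T => rsubmx (rsubmx y)).
  exact: (Cinf_vec_comp Un setT rsubmx rsubmx oU openT (Cinf_rsubmx _ openT) (Cinf_rsubmx _ oU)).
have Cu : Cinf R Un uu by apply: (Cinf_vec_comp Un setT (@lsubmx R 1 n m) _ oU openT (Cinf_lsubmx _ openT) Cr).
have Cv : Cinf R Un vv by apply: (Cinf_vec_comp Un setT (@rsubmx R 1 n m) _ oU openT (Cinf_rsubmx _ openT) Cr).
have u0 y : Un y -> uu y != 0 by case=> [[]].
have v0 y : Un y -> vv y != 0 by case=> [[]].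
pose cw (w : E2) := 2 - en w.1 - en w.2.
have ccw q : {for q, continuous cw}.
  apply: continuous_sub_at; last exact: csnd.
  by apply: continuous_sub_at; [exact: continuous_cst_at|exact: cfst].
pose sw (w : E2) := Num.sqrt (en w.1 - 1 + phi (cw w)).
have sw2 w : Dset w -> sw w ^+ 2 = en w.1 - 1 + phi (cw w).
  by rewrite /Defs.Dset -/(cw w) => D; rewrite sqr_sqrtr //; lra.
pose sec (w : E2) := row_mx (scal (cw w)) (row_mx (scal (sw w)) (row_mx w.1 w.2)).
have sec_a w : Dset w -> aa (sec w) = en w.1.
  by move=> Dw; rewrite /aa /cc /ss /sec c1_row row_mxKr c1_row sw2 //; lra.
have sec_b w : Dset w -> bb (sec w) = en w.2.
  by move=> Dw; rewrite /bb /cc /ss /sec c1_row row_mxKr c1_row sw2 // /cw; lra.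
apply: (Dopen_section O p (1 + (1 + (n + m))) Un (fun y => (aa y *: ((en (uu y))^-1 *: uu y), bb y *: ((en (vv y))^-1 *: vv y)))
  sec dO Op oU).
- apply: (Cinf_scale _ _ _ oU (Ca _ oU)).
  apply: (Cinf_scale _ _ _ oU _ Cu); apply: (Cinf_inv _ _ oU (Cinf_enorm _ _ oU Cu u0)).
  by move=> y /u0; rewrite enorm_eq0.
- apply: (Cinf_scale _ _ _ oU (Cb _ oU)).
  apply: (Cinf_scale _ _ _ oU _ Cv); apply: (Cinf_inv _ _ oU (Cinf_enorm _ _ oU Cv v0)).
  by move=> y /v0; rewrite enorm_eq0.
- move=> y [[uy vy] [ay by0]]; rewrite /Defs.Dset /= (enorm_unit _ _ uy (ltW ay)) (enorm_unit _ _ vy (ltW by0)).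
  have -> : 2 - aa y - bb y = cc y by rewrite /aa /bb; lra.
  by rewrite /aa; have := sqr_ge0 (ss y); lra.
- split; first by split=> /=; rewrite /uu /vv /sec !row_mxKr ?row_mxKl.
  by split=> /=; [rewrite (sec_a _ (svalP p))|rewrite (sec_b _ (svalP p))]; rewrite enorm_gt0.
- apply: continuous_row_mx; first by apply: continuous_scalar_row.
  apply: continuous_row_mx; last by apply: continuous_row_mx; [exact: cvg_fst|exact: cvg_snd].
  apply: continuous_scalar_row; apply: (@continuous_comp _ _ _ (fun w : E2 => en w.1 - 1 + phi (cw w)) Num.sqrt).
    apply: continuous_add_at; first by apply: continuous_sub_at; [exact: cfst|exact: continuous_cst_at].
    by apply: (@continuous_comp _ _ _ cw phi); [exact: ccw|exact: phi_continuous].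
  exact: sqrt_continuous.
- have N1 : \forall w \near sval p, 0 < en w.1.
    by apply: (near_gt (fun w : E2 => en w.1)); [exact: cfst|rewrite enorm_gt0].
  have N2 : \forall w \near sval p, 0 < en w.2.
    by apply: (near_gt (fun w : E2 => en w.2)); [exact: csnd|rewrite enorm_gt0].
  apply: filterS2 N1 N2 => w w1 w2 Dw.
  rewrite sec_a // sec_b // /uu /vv /sec !row_mxKr row_mxKl.
  by rewrite !unit_scaleK -?enorm_gt0 // -surjective_pairing.
Qed.

Lemma Dopen_near O (p : Disk) : Dopen R Disk_plots O -> O p ->
  \forall w \near sval p, forall q : Disk, sval q = w -> O q.
Proof.
move=> dO Op; have [p2|p2] := eqVneq (sval p).2 0; first exact: Dopen_near_interior.
by have [p1|p1] := eqVneq (sval p).1 0; [exact: Dopen_near_axis|exact: Dopen_near_generic].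
Qed.

(** The points inside the rim that miss [O] lie in a compact set on which [|u| < 1], so [|u|] has a
    maximum below 1 there; half of the gap serves as [d]. *)
Lemma Dopen_tube O : Dopen R Disk_plots O -> (forall p : Disk, Sset R n m p -> O p) ->
  exists d, [/\ 0 < d, d < 1 & forall p : Disk, 1 - d <= en (sval p).1 -> O p].
Proof.
(* Points outside the disk belong to [G] vacuously. Removing the interior of [G], and not [G]
   itself, makes [B] closed; [Dopen_near] puts the points with [|u| = 1] into that interior. *)
move=> dO SO; pose G : set E2 := [set w | forall q : Disk, sval q = w -> O q].
pose B : set E2 := ([set u | en u <= 1] `*` [set v | en v <= 5 / 2]) `&` ~` G°.
have cB : compact B.
  apply: compact_closedI; last by apply: open_closedC; exact: open_interior.
  by apply: compact_setX; exact: compact_enorm_le.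
have B1 w : B w -> en w.1 < 1.
  case=> -[/= w1 w2] nG; rewrite lt_neqAle w1 andbT; apply/eqP => w1E; apply: nG.
  have Dw : Dset w by apply: Dset_outer; rewrite w1E.
  have Sw : Sset R n m (exist _ w Dw) by rewrite /Sset /= w1E.
  exact: (Dopen_near O (exist _ w Dw) dO (SO _ Sw)).
have notB p : en (sval p).1 < 1 -> ~ O p -> B (sval p).
  move=> p1 nO; split; first by split=> /=; apply/ltW => //; exact: Dset_narrow (svalP p) p1.
  by move=> /interior_subset/(_ p erefl).
have [B0|Bn0] := pselect (exists w, B w); last first.
  exists 2^-1; split; [lra|lra|move=> p _].
  have [p1|p1] := leP 1 (en (sval p).1); first exact: SO.
  by apply: contrapT => nO; apply: Bn0; exists (sval p); exact: notB.
have [c] : exists2 c, c \in B & forall t, t \in B -> en t.1 <= en c.1.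
  apply: (@compact_EVT_max _ _ (fun w : E2 => en w.1) B) => //.
  by apply: continuous_subspaceT => w; exact: cfst.
rewrite inE => Bc cmax; have c1' := B1 _ Bc; have c0 := enorm_ge0 c.1.
exists ((1 - en c.1) / 2); split; [lra|lra|move=> p pd].
have [p1|p1] := leP 1 (en (sval p).1); first exact: SO.
apply: contrapT => nO; have := cmax (sval p); rewrite inE => /(_ (notB p p1 nO)).
lra.
Qed.

End DiskTopology.

(** * Extending locally finite families from the fat sphere to the fat disk *)

Section Families.
Context {R : realType}.
Local Notation Plots := (Plots R).
Local Notation smooth := (smooth R).
Local Notation real_plots := (real_plots R).

Definition fam_smooth {T I : Type} (p : Plots T) (f : I -> T -> R) : Prop :=
  (forall i, smooth p real_plots (f i)) /\
  forall k U P, p k U P -> forall y, U y ->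
    exists2 A : set I, finite_set A & \forall z \near y, forall i, ~ A i -> f i (P z) = 0.

Lemma fam_finite {T I : Type} (p : Plots T) (f : I -> T -> R) (x : T) :
  p 0%N setT (fun=> x) -> fam_smooth p f -> finite_set [set i | f i x != 0].
Proof.
move=> px [_ /(_ _ _ _ px 0 Logic.I)[A fA /nbhs_singleton HA]].
by apply: sub_finite_set fA => i /=; apply: contraNP => /HA ->.
Qed.

Lemma fam_smooth_local {T I : Type} (p : Plots T) (f : I -> T -> R) :
  (forall k U P, p k U P -> open U) ->
  (forall k U P, p k U P -> forall y, U y -> exists V, [/\ open V, V y,
     (forall i, Cinf R V (fun z => f i (P z))) &
     exists2 A : set I, finite_set A & forall z, V z -> forall i, ~ A i -> f i (P z) = 0]) ->
  fam_smooth p f.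
Proof.
move=> op H; split=> [i|] k U P pP.
  split; first exact: op pP.
  by apply: Cinf_local => y /(H _ _ _ pP)[V [_ Vy Vf _]]; exists V => //; exact: Vf.
move=> y /(H _ _ _ pP)[V [oV Vy _ [A fA HA]]]; exists A => //.
by apply: filterS (open_nbhs_nbhs (conj oV Vy)).
Qed.

Lemma fam_smooth_mul {T I : Type} (p : Plots T) (f g : I -> T -> R) :
  (forall i, smooth p real_plots (g i)) -> fam_smooth p f -> fam_smooth p (fun i x => g i x * f i x).
Proof.
move=> Hg [Hf Lf]; split=> [i k U P pP|k U P pP y Uy].
  have [oU Uf] := Hf i _ _ _ pP; have [_ Ug] := Hg i _ _ _ pP.
  by split; [exact: oU|exact: (Cinf_mul _ _ _ oU Ug Uf)].
have [A fA HA] := Lf _ _ _ pP y Uy; exists A => //.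
by apply: filterS HA => z HA i /HA ->; rewrite mulr0.
Qed.

Definition finsupp (I : Type) := {v : I -> R | finite_set [set i | v i != 0]}.

(** A common finite support near each parameter is part of the structure. Finite support at each
    point separately would not give local finiteness back. *)
Definition finsupp_plots (I : Type) : Plots (finsupp I) := fun k U P =>
  [/\ open U, (forall i, Cinf R U (fun y => sval (P y) i)) &
   forall y, U y -> exists2 A : set I, finite_set A &
     \forall z \near y, forall i, ~ A i -> sval (P z) i = 0].

Lemma finsupp_diffeology (I : Type) : is_diffeology R (finsupp_plots I).
Proof.
split.
- by move=> k U P [].
- move=> k U P Q [oU UP LP] PQ; split; [exact: oU|move=> i|move=> y Uy].
    by apply: (Cinf_ext _ _ _ oU _ (UP i)) => y Uy; rewrite PQ.
  have [A fA HA] := LP y Uy; exists A => //.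
  apply: filterS2 HA (open_nbhs_nbhs (conj oU Uy)) => z HA Uz i nA.
  by rewrite -PQ //; exact: HA.
- move=> k U x oU; split; [exact: oU|move=> i; exact: Cinf_cst|move=> y _].
    exists [set i | sval x i != 0]; first exact: (svalP x).
    by apply/rV_nearP; exists 1 => // _ _ i /negP; rewrite negbK => /eqP.
- move=> k U P oU H; split; [exact: oU|move=> i|move=> y Uy].
    by apply: Cinf_local => y /H[V [_ Vy _ [_ Vf _]]]; exists V.
  by have [V [_ Vy _ [_ _ /(_ y Vy)]]] := H y Uy.
- move=> k m U P V F [oU UP LP] oV VF VU; split; [exact: oV|move=> i|move=> y Vy].
    exact: (Cinf_comp V U (fun y => sval (P y) i) F oV oU (UP i) VF VU).
  have [A fA HA] := LP (F y) (VU y Vy); exists A => //.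
  exact: (((VF [::]).1 y Vy) _ HA).
Qed.

Lemma smooth_finsupp {T I : Type} (p : Plots T) (F : T -> finsupp I) :
  (forall k U P, p k U P -> open U) ->
  (smooth p (finsupp_plots I) F <-> fam_smooth p (fun i x => sval (F x) i)).
Proof.
move=> op; split=> [HF|[H1 H2] k U P pP].
  split=> [i|] k U P pP; first by have [oU UF _] := HF _ _ _ pP; split=> //; exact: UF.
  by have [_ _] := HF _ _ _ pP.
by split; [exact: op pP|move=> i; have [] := H1 i _ _ _ pP|exact: H2 _ _ _ pP].
Qed.

End Families.

Section OpenPreimage.
Context {R : realType}.

Lemma open_preimage_in {T U : topologicalType} (V : set T) (f : T -> U) (A : set U) :
  open V -> open A -> (forall y, V y -> {for y, continuous f}) -> open (V `&` [set y | A (f y)]).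
Proof.
move=> oV oA cf; rewrite openE => y [Vy Afy]; apply: filterI.
  exact: open_nbhs_nbhs (conj oV Vy).
exact: (cf y Vy _ (open_nbhs_nbhs (conj oA Afy))).
Qed.

End OpenPreimage.

(** * Plots of the fat sphere and a cutoff at its rim *)

Section SphereLift.
Context {R : realType} {n m : nat}.
Local Notation Disk := (Disk R n m).
Local Notation Sph := (Sph R n m).
Local Notation en := (@enorm R _).

Lemma Sph_plot_lift (k : nat) (U : set 'rV[R]_k) (P : 'rV[R]_k -> 'rV[R]_n * 'rV[R]_m) (s0 : Sph) :
  open U -> Cinf R U (fun y => (P y).1) -> Cinf R U (fun y => (P y).2) ->
  (forall y, U y -> 1 <= en (P y).1) ->
  exists2 Q : 'rV[R]_k -> Sph, Sph_plots R n m k U Q & forall y, U y -> sval (sval (Q y)) = P y.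
Proof.
move=> oU P1 P2 U1.
have [Q [_ Q1 Q2] QP] := Disk_plot_lift _ _ P (sval s0) oU P1 P2 (fun y Uy => Dset_outer _ (U1 y Uy)).
pose S y : Sph := match pselect (Sset R n m (Q y)) with
  left H => exist _ (Q y) H | right _ => s0 end.
have SQ y : U y -> sval (S y) = Q y.
  move=> Uy; rewrite /S; case: pselect => // -[]; rewrite /Sset QP //; exact: U1.
exists S; last by move=> y Uy; rewrite SQ // QP.
split; [exact: oU| |].
  by apply: (Cinf_ext_vec _ _ _ oU _ Q1) => y Uy; rewrite SQ.
by apply: (Cinf_ext_vec _ _ _ oU _ Q2) => y Uy; rewrite SQ.
Qed.

Lemma Sph_eq (s t : Sph) : sval (sval s) = sval (sval t) -> s = t.
Proof.
by move=> /Disk_eq st; apply: eq_sig_hprop st => x; exact: Prop_irrelevance.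
Qed.

Lemma Disk_plots_const (p : Disk) : Disk_plots R n m 0 setT (fun=> p).
Proof.
split; first exact: openT.
  by apply/(Cinf_vecP _ _ openT) => j; exact: Cinf_cst.
by apply/(Cinf_vecP _ _ openT) => j; exact: Cinf_cst.
Qed.

(** It rises from 0 at [|u| = 1 - d] to 1 at [|u| = 1]; using the squared norm keeps it smooth at
    [u = 0]. *)
Definition rim_cutoff (d : R) (p : Disk) : R :=
  lam R ((nsq (sval p).1 - (1 - d) ^+ 2) / (1 - (1 - d) ^+ 2)).

Lemma rim_cutoff_smooth d : smooth R (Disk_plots R n m) (real_plots R) (rim_cutoff d).
Proof.
move=> k U P [oU P1 P2]; split; first exact: oU.
have H : Cinf R U (fun y => (nsq (sval (P y)).1 - (1 - d) ^+ 2) / (1 - (1 - d) ^+ 2)).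
  apply: (Cinf_mul _ _ _ oU _ (Cinf_cst _ _)).
  exact: (Cinf_sub _ _ _ oU (Cinf_nsq _ _ oU P1) (Cinf_cst _ _)).
exact: (Cinf_comp1 U setT _ (lam R) oU Ck1_lam H (fun _ _ => I)).
Qed.

Lemma rim_cutoff_ge0 d p : 0 <= rim_cutoff d p.
Proof. exact: lam_ge0. Qed.

Lemma rim_cutoff_le1 d p : rim_cutoff d p <= 1.
Proof. exact: lam_le1. Qed.

Lemma rim_cutoff_outer d p : 0 < d -> d < 1 -> Sset R n m p -> rim_cutoff d p = 1.
Proof.
move=> d0 d1; rewrite /Sset => p1; rewrite /rim_cutoff lam_ge1 //.
have H : 0 < 1 - (1 - d) ^+ 2 by nra.
rewrite ler_pdivlMr // mul1r lerD2r -enorm_sq.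
by rewrite exprn_ege1.
Qed.

Lemma rim_cutoff_inner d p : 0 < d -> d < 1 -> en (sval p).1 <= 1 - d -> rim_cutoff d p = 0.
Proof.
move=> d0 d1 p1; rewrite /rim_cutoff lam_le0 //.
have H : 0 < 1 - (1 - d) ^+ 2 by nra.
rewrite pmulr_lle0 ?invr_gt0 // subr_le0 -enorm_sq.
by apply: lerXn2r p1; rewrite nnegrE ?enorm_ge0 //; lra.
Qed.

End SphereLift.

(** * Extension of a family across the rim of the disk *)

Section DiskExtension.
Context {R : realType} {n m : nat}.
Local Notation Disk := (Disk R n m).
Local Notation Sph := (Sph R n m).
Local Notation en := (@enorm R _).
Local Notation T := ('rV[R]_(1 + (n + m))).

Let i0 : 'I_(1 + (n + m)) := lshift (n + m) (0 : 'I_1).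
Let uu (y : T) : 'rV[R]_n := lsubmx (rsubmx y).
Let vv (y : T) : 'rV[R]_m := rsubmx (rsubmx y).
Let pt (t : R) (u : 'rV[R]_n) (v : 'rV[R]_m) : T := row_mx (t *: (1 : 'rV[R]_1)) (row_mx u v).

Let pt_uu t u v : uu (pt t u v) = u.
Proof. by rewrite /uu /pt row_mxKr row_mxKl. Qed.

Let pt_vv t u v : vv (pt t u v) = v.
Proof. by rewrite /vv /pt !row_mxKr. Qed.

Let pt_i0 t u v : pt t u v 0 i0 = t.
Proof. by rewrite /pt row_mxEl !mxE eqxx mulr1. Qed.

Let uu_upd y a : uu (upd i0 y a) = uu y.
Proof.
by apply/rowP => j; rewrite !mxE; case: eqP => // /(congr1 val).
Qed.

Let vv_upd y a : vv (upd i0 y a) = vv y.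
Proof.
by apply/rowP => j; rewrite !mxE; case: eqP => // /(congr1 val).
Qed.

Let upd_pt y a : upd i0 y a = pt a (uu y) (vv y).
Proof.
apply/rowP => j; rewrite /pt; case: (splitP j) => i ji.
  have -> : j = lshift (n + m) i by apply/val_inj.
  by rewrite row_mxEl (ord1 i) !mxE !eqxx mulr1.
have -> : j = rshift 1 i by apply/val_inj.
by rewrite row_mxEr /uu /vv hsubmxK [RHS]mxE [LHS]mxE; case: eqP => // /(congr1 val).
Qed.

Let cuu : continuous uu.
Proof. by move=> y; apply: continuous_comp; [exact: continuous_rsubmx|exact: continuous_lsubmx]. Qed.

Let cvv : continuous vv.
Proof. by move=> y; apply: continuous_comp; [exact: continuous_rsubmx|exact: continuous_rsubmx]. Qed.

Let Cuu (U : set T) : open U -> Cinf R U uu.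
Proof.
by move=> oU; exact: (Cinf_vec_comp U setT (@lsubmx R 1 n m) rsubmx oU openT (Cinf_lsubmx _ openT) (Cinf_rsubmx _ oU)).
Qed.

Let Cvv (U : set T) : open U -> Cinf R U vv.
Proof.
by move=> oU; exact: (Cinf_vec_comp U setT (@rsubmx R 1 n m) rsubmx oU openT (Cinf_rsubmx _ openT) (Cinf_rsubmx _ oU)).
Qed.

Let W : set T := [set y | 0 < en (uu y)].

Let ceu y : {for y, continuous (fun y : T => en (uu y))}.
Proof. by apply: continuous_comp; [exact: cuu|exact: enorm_continuous]. Qed.

Let cev y : {for y, continuous (fun y : T => en (vv y))}.
Proof. by apply: continuous_comp; [exact: cvv|exact: enorm_continuous]. Qed.

Let oW : open W.
Proof. exact: (@open_preimage T R (fun y : T => en (uu y)) [set t | 0 < t] ceu (@open_gt _ _)). Qed.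

Let cW : cylinder i0 W.
Proof. by move=> y a; rewrite /W /= uu_upd. Qed.

(** The reflected functions are evaluated near points with [3/4 <= |u| <= 1] and [|v| <= 5/2]. [V]
    is an open region with some room around these, bounded so that its projection to the slice lies
    in the compact set [K]. *)
Let V : set T := ([set y | 2^-1 < en (uu y)] `&` [set y | en (uu y) < 2]) `&` [set y | en (vv y) < 3].

Let oV : open V.
Proof.
apply: openI; last exact: (@open_preimage T R (fun y : T => en (vv y)) [set t | t < 3] cev (@open_lt _ _)).
apply: openI; first exact: (@open_preimage T R (fun y : T => en (uu y)) [set t | 2^-1 < t] ceu (@open_gt _ _)).
exact: (@open_preimage T R (fun y : T => en (uu y)) [set t | t < 2] ceu (@open_lt _ _)).
Qed.

Let VW : V `<=` W.
Proof. by move=> y [[/= y2 _] _]; rewrite /W /=; lra. Qed.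

Let K : set T := (fun w : 'rV[R]_n * 'rV[R]_m => pt 0 w.1 w.2) @`
  (([set u | en u <= 2] `&` [set u | 2^-1 <= en u]) `*` [set v | en v <= 3]).

Let cK : compact K.
Proof.
have c (w : 'rV[R]_n * 'rV[R]_m) :
    {for w, continuous (fun w : 'rV[R]_n * 'rV[R]_m => pt 0 w.1 w.2)}.
  apply: continuous_row_mx; first by apply: continuous_scalar_row; exact: continuous_cst_at.
  by apply: continuous_row_mx; [exact: cvg_fst|exact: cvg_snd].
apply: continuous_compact; first by apply: continuous_subspaceT => w; exact: c.
apply: compact_setX; last exact: compact_enorm_le.
apply: compact_closedI; first exact: compact_enorm_le.
apply: (@closed_comp _ _ (@Defs.enorm R n) [set t | 2^-1 <= t]); last exact: closed_ge.
by move=> u _; exact: enorm_continuous.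
Qed.

Let KW : K `<=` W.
Proof. by move=> _ [[u v] [[/= _ u2] _] <-]; rewrite /W /= pt_uu; lra. Qed.

Let VK y : V y -> K (upd i0 y 0).
Proof.
move=> [[/= y1 y2] y3]; exists (uu y, vv y); last by rewrite upd_pt.
by split=> /=; [split=> /=; exact: ltW|exact: ltW].
Qed.

Let Psi (y : T) : 'rV[R]_n * 'rV[R]_m :=
  ((Num.sqrt (1 + y 0 i0 ^+ 2) * (en (uu y))^-1) *: uu y, vv y).

Let Psi_upd y : Psi (upd i0 y (- y 0 i0)) = Psi y.
Proof. by rewrite /Psi uu_upd vv_upd upd_i0 sqrrN. Qed.

Let Psi_outer y : W y -> 1 <= en (Psi y).1.
Proof.
move=> Wy; rewrite /Psi /= enormZ ger0_norm; last first.
  by rewrite mulr_ge0 ?sqrtr_ge0 // invr_ge0 enorm_ge0.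
rewrite -mulrA mulVf ?mulr1 ?gt_eqF // -{1}(@sqrtr1 R); apply: ler_wsqrtr.
by rewrite lerDl sqr_ge0.
Qed.

Let Psi1 : Cinf R W (fun y => (Psi y).1).
Proof.
apply: (Cinf_scale _ _ _ oW _ (Cuu _ oW)).
apply: (Cinf_mul _ _ _ oW).
  have H : Cinf R W (fun y => 1 + y 0 i0 ^+ 2).
    exact: (Cinf_add _ _ _ oW (Cinf_cst _ _) (Cinf_exp _ _ _ oW (Cinf_coord _ _))).
  apply: (Cinf_comp1 W [set t | 0 < t] _ Num.sqrt oW Ck1_sqrt H) => y _ /=.
  by have := sqr_ge0 (y 0 i0); lra.
apply: (Cinf_inv _ _ oW (Cinf_enorm _ _ oW (Cuu _ oW) _)).
  by move=> y; rewrite /W /= enorm_gt0.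
by move=> y; rewrite /W /= => y0; rewrite gt_eqF.
Qed.

Let Psi2 : Cinf R W (fun y => (Psi y).2).
Proof. exact: Cvv. Qed.

Let Psi_pt u v : 1 <= en u -> Psi (pt (Num.sqrt (nsq u - 1)) u v) = (u, v).
Proof.
move=> u1; have u0 : en u != 0 by rewrite gt_eqF //; lra.
have nu : 0 <= nsq u - 1 by rewrite subr_ge0 -enorm_sq exprn_ege1.
rewrite /Psi pt_uu pt_vv pt_i0 sqr_sqrtr // addrC subrK -enorm_sq sqrtr_sqr.
by rewrite ger0_norm ?enorm_ge0 // mulfV // scale1r.
Qed.

Lemma disk_family_extend {I : Type} (f : I -> Sph -> R) : fam_smooth (Sph_plots R n m) f ->
  exists F : I -> Disk -> R, fam_smooth (Disk_plots R n m) F /\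
    forall i s, F i (sval s) = f i s.
Proof.
move=> [fs fl].
(* The sphere is empty when [n = 0], and then the zero family extends any family; otherwise [s0]
   serves as a default point. *)
have [s0|nos] := pselect (exists s0 : Sph, True); last first.
  exists (fun _ _ => 0); split; last by move=> i s; exfalso; apply: nos; exists s.
  apply: fam_smooth_local => [k U P []//|k U P [oU _ _] y Uy].
  exists U; split=> // [i|]; first exact: Cinf_cst.
  by exists set0.
have {s0} [s0 _] := s0.
have [Q Qplot QP] := Sph_plot_lift _ _ _ s0 oW Psi1 Psi2 Psi_outer.
pose g i y := f i (Q y).
have Wg i : Cinf R W (g i) by have [] := fs i _ _ _ Qplot.
have Qupd y : W y -> Q (upd i0 y (- y 0 i0)) = Q y.
  by move=> Wy; apply: Sph_eq; rewrite !QP ?Psi_upd //; exact: cW.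
have ev i y : W y -> g i (upd i0 y (- y 0 i0)) = g i y by move=> Wy; rewrite /g Qupd.
have /choice[H HH] i := whitney_even i0 W V K (g i) oW cW oV VW cK KW VK (Wg i) (ev i).
(* On the sphere the value of [f] is kept, also where [V] does not reach. On the overlap [HtE] shows
   that it agrees with the extension evaluated at [|u| ^+ 2 - 1]. *)
pose Ht i (p : Disk) := match pselect (Sset R n m p) with
  | left Hp => f i (exist _ p Hp)
  | right _ => H i (pt (nsq (sval p).1 - 1) (sval p).1 (sval p).2) end.
have HtS i (s : Sph) : Ht i (sval s) = f i s.
  rewrite /Ht; case: pselect => [Hp|[]]; last exact: (svalP s).
  by congr (f i _); exact: Sph_eq.
have q4 : 0 < (4^-1 : R) by rewrite invr_gt0.
have q41 : (4^-1 : R) < 1 by rewrite invf_lt1 // ltr1n.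
(* With width 1/4 the product vanishes for [|u| <= 3/4], away from [u = 0] where [Psi] is
   undefined. *)
exists (fun i p => rim_cutoff 4^-1 p * Ht i p); split; last first.
  by move=> i s; rewrite rim_cutoff_outer ?mul1r //; exact: (svalP s).
apply: fam_smooth_local => [k U P []//|k U P pP y0 Uy0].
have [oU P1 P2] := pP.
have [_ Cmu] := rim_cutoff_smooth 4^-1 _ _ _ pP.
pose eu y := en (sval (P y)).1; pose ev' y := en (sval (P y)).2.
have ceu' y : U y -> {for y, continuous eu}.
  move=> Uy; apply: continuous_comp; last exact: enorm_continuous.
  exact: ((P1 [::]).1 y Uy).
have cev' y : U y -> {for y, continuous ev'}.
  move=> Uy; apply: continuous_comp; last exact: enorm_continuous.
  exact: ((P2 [::]).1 y Uy).
(* Where all nearby values of the plot lie in the sphere it lifts to a plot of the sphere, and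
   smoothness and local finiteness are those of [f]. *)
have outer (U1 : set 'rV[R]_k) : open U1 -> U1 y0 -> U1 `<=` U -> (forall y, U1 y -> 1 <= eu y) ->
    exists V, [/\ open V, V y0,
      (forall i, Cinf R V (fun z => rim_cutoff 4^-1 (P z) * Ht i (P z))) &
      exists2 A : set I, finite_set A & forall z, V z -> forall i, ~ A i ->
        rim_cutoff 4^-1 (P z) * Ht i (P z) = 0].
  move=> oU1 U1y0 U1U U11.
  have Cv l (F : 'rV[R]_k -> 'rV[R]_l) : Cinf R U F -> Cinf R U1 F.
    move=> /(Cinf_vecP _ _ oU) UF; apply/(Cinf_vecP _ _ oU1) => j.
    exact: Cinf_subset U1U (UF j).
  have [S Splot SP] := Sph_plot_lift _ _ (fun y => sval (P y)) s0 oU1 (Cv _ _ P1) (Cv _ _ P2) U11.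
  have HtP i y : U1 y -> Ht i (P y) = f i (S y).
    by move=> Uy; rewrite -HtS; congr (Ht i _); apply: Disk_eq; rewrite SP.
  have [A fA HA] := fl _ _ _ Splot y0 U1y0.
  have [d d0 Hd] := (rV_nearP _ _).1 (filterI HA (open_nbhs_nbhs (conj oU1 U1y0))).
  exists (ball y0 d).
  have bU1 : ball y0 d `<=` U1 by move=> y; rewrite -ball_normE /= => /Hd[].
  have ob : open (ball y0 d) by exact: ball_open.
  split; [exact: ob|exact: ballxx| |].
    move=> i; apply: (Cinf_mul _ _ _ ob); first exact: (Cinf_subset _ _ _ (subset_trans bU1 U1U) Cmu).
    have [_ Cf] := fs i _ _ _ Splot.
    by apply: (Cinf_ext _ _ _ ob _ (Cinf_subset _ _ _ bU1 Cf)) => y /bU1 Uy; rewrite HtP.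
  exists A => // z bz i nA; rewrite HtP; last exact: bU1.
  have [|+ _] := Hd z; first by rewrite -ball_normE in bz.
  by move=> ->; rewrite ?mulr0.
have [y01|y01] := ltP 1 (eu y0).
  apply: (outer (U `&` [set y | 1 < eu y])).
  - exact: (open_preimage_in U eu [set t | 1 < t] oU (@open_gt _ 1) ceu').
  - by split.
  - by move=> y [].
  - by move=> y [_ /= /ltW].
(* By [Dset_narrow] a disk point with [|v| > 5/2] lies in the sphere. *)
have [y02|y02] := ltP (5 / 2) (ev' y0).
  apply: (outer (U `&` [set y | 5 / 2 < ev' y])).
  - exact: (open_preimage_in U ev' [set t | 5 / 2 < t] oU (@open_gt _ _) cev').
  - by split.
  - by move=> y [].
  - move=> y [_ /= y2]; rewrite leNgt; apply/negP => y1.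
    by have := Dset_narrow _ (svalP (P y)) y1; rewrite -/(ev' y); lra.
have [y03|y03] := ltP (eu y0) (3 / 4).
  exists (U `&` [set y | eu y < 3 / 4]).
  have o3 := open_preimage_in U eu [set t | t < 3 / 4] oU (@open_lt _ _) ceu'.
  have z3 i z : (U `&` [set y | eu y < 3 / 4]) z -> rim_cutoff 4^-1 (P z) * Ht i (P z) = 0.
    by case=> _ /= zz; rewrite rim_cutoff_inner ?mul0r // -/(eu z); lra.
  split; [exact: o3|by split| |].
    by move=> i; apply: (Cinf_ext _ (fun=> 0) _ o3 _ (Cinf_cst _ _)) => z /(z3 i) ->.
  by exists set0 => // z Vz i _; exact: z3.
pose V1 := ((U `&` [set y | 2^-1 < eu y]) `&` [set y | eu y < 2]) `&` [set y | ev' y < 3].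
have oV1 : open V1.
  apply: (open_preimage_in _ ev' [set t | t < 3] _ (@open_lt _ _)); last by move=> y [[Uy _] _]; exact: cev'.
  apply: (open_preimage_in _ eu [set t | t < 2] _ (@open_lt _ _)); last by move=> y [Uy _]; exact: ceu'.
  exact: (open_preimage_in _ eu [set t | 2^-1 < t] oU (@open_gt _ _)).
have V1y0 : V1 y0 by split; [split; [split=> //=; lra|rewrite /=; lra]|rewrite /=; lra].
have V1U : V1 `<=` U by move=> y [[[]]].
have Cv l (F : 'rV[R]_k -> 'rV[R]_l) : Cinf R U F -> Cinf R V1 F.
  move=> /(Cinf_vecP _ _ oU) UF; apply/(Cinf_vecP _ _ oV1) => j.
  exact: Cinf_subset V1U (UF j).
(* [th] is smooth and is the argument of [H i]. [th'] is only continuous: the square root is 0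
   inside the rim. It sends the plot into the domain of the [g i], where the finite set [A] is
   found. *)
pose th y := pt (nsq (sval (P y)).1 - 1) (sval (P y)).1 (sval (P y)).2.
pose th' y := pt (Num.sqrt (nsq (sval (P y)).1 - 1)) (sval (P y)).1 (sval (P y)).2.
have thV y : V1 y -> V (th y).
  by case=> [[[_ a] b] c]; rewrite /V /= pt_uu pt_vv; split; first split.
have HtE i y : V1 y -> Ht i (P y) = H i (th y).
  move=> Vy; rewrite /Ht; case: pselect => // Hp.
  have [_ H1 _] := HH i; have t0 : 0 <= nsq (sval (P y)).1 - 1 by rewrite subr_ge0 -enorm_sq exprn_ege1.
  rewrite H1 ?pt_i0 //; last exact: thV.
  rewrite upd_pt pt_uu pt_vv /g; congr (f i _); apply: Sph_eq.
  rewrite QP; last by rewrite /W /= pt_uu; move: Hp; rewrite /Sset; lra.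
  by rewrite Psi_pt // -surjective_pairing.
have Cth : Cinf R V1 th.
  apply: (Cinf_row_mx _ _ _ oV1); last exact: (Cinf_row_mx _ _ _ oV1 (Cv _ _ P1) (Cv _ _ P2)).
  apply/(Cinf_vecP _ _ oV1) => j.
  apply: (Cinf_ext _ (fun y => nsq (sval (P y)).1 - 1) _ oV1).
    by move=> y _; rewrite ord1 !mxE eqxx mulr1.
  exact: (Cinf_sub _ _ _ oV1 (Cinf_nsq _ _ oV1 (Cv _ _ P1)) (Cinf_cst _ _)).
have nsq0 : nsq (sval (P y0)).1 - 1 <= 0 by rewrite subr_le0 -enorm_sq exprn_ile1 // enorm_ge0.
have Wth0 : W (th' y0) by rewrite /W /= pt_uu -/(eu y0); lra.
have [A fA HA] := fl _ _ _ Qplot (th' y0) Wth0.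
have [d d0 Hd] := (rV_nearP _ _).1 HA.
have cth' : {for y0, continuous th'}.
  have c1 : {for y0, continuous (fun y => (sval (P y)).1)} := (P1 [::]).1 y0 Uy0.
  have c2 : {for y0, continuous (fun y => (sval (P y)).2)} := (P2 [::]).1 y0 Uy0.
  apply: continuous_row_mx; last exact: continuous_row_mx.
  apply: continuous_scalar_row; apply: (@continuous_comp _ _ _ (fun y => nsq (sval (P y)).1 - 1) Num.sqrt).
    apply: continuous_sub_at; last exact: continuous_cst_at.
    by apply: (@continuous_comp _ _ _ (fun y => (sval (P y)).1) (@nsq R n)) => //; exact: nsq_continuous.
  exact: sqrt_continuous.
have nth' : \forall y \near y0, `|th' y0 - th' y| < d.
  have ob : open_nbhs (th' y0) (ball (th' y0) d) by split; [exact: ball_open|exact: ballxx].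
  have nth0 : \forall y \near y0, ball (th' y0) d (th' y) by exact: (cth' _ (open_nbhs_nbhs ob)).
  by apply: filterS nth0 => y; rewrite -ball_normE.
have [d' d'0 Hd'] := (rV_nearP _ _).1 (filterI nth' (open_nbhs_nbhs (conj oV1 V1y0))).
have bV1 : ball y0 d' `<=` V1 by move=> y; rewrite -ball_normE /= => /Hd'[].
have ob : open (ball y0 d') by exact: ball_open.
exists (ball y0 d'); split; [exact: ob|exact: ballxx| |].
  move=> i; apply: (Cinf_mul _ _ _ ob); first exact: (Cinf_subset _ _ _ (subset_trans bV1 V1U) Cmu).
  have [HC _ _] := HH i.
  have Hth : Cinf R V1 (H i \o th) by exact: (Cinf_comp V1 V _ th oV1 oV HC Cth thV).
  by apply: (Cinf_ext _ _ _ ob _ (Cinf_subset _ _ _ bV1 Hth)) => y /bV1 Vy /=; rewrite HtE.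
exists A => // z bz i nA; have Vz := bV1 _ bz; rewrite HtE //.
have thz : `|th' y0 - th' z| < d by apply: (Hd' z _).1; rewrite -ball_normE in bz.
have g0 x : `|th' y0 - x| < d -> g i x = 0 by move=> /Hd; exact.
suff -> : H i (th z) = 0 by rewrite mulr0.
(* Outside the rim the value is [g i] at [th' z]. Inside it the slice point below [th z] is [th' z],
   and [g i] vanishes on a ball around it, so all its derivatives there are 0. *)
have [_ Hpos Hneg] := HH i; have [t0|t0] := leP 0 (th z 0 i0).
  by rewrite Hpos //; [rewrite upd_pt pt_uu pt_vv pt_i0; exact: g0|exact: thV].
apply: Hneg => // [|j]; first exact: thV.
have thE : upd i0 (th z) 0 = th' z.
  rewrite upd_pt pt_uu pt_vv /th' ler0_sqrtr //.
  by move: t0; rewrite pt_i0 => /ltW.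
have obd : open (ball (th' y0) d) by exact: ball_open.
have bd : ball (th' y0) d (upd i0 (th z) 0) by rewrite thE -ball_normE.
rewrite (pd_ext (ball (th' y0) d) (g i) (fun=> 0) _ obd _ _ bd); last first.
  by move=> x; rewrite -ball_normE; exact: g0.
elim: j => //= j IH.
have -> : pd R (fun=> 0 : R) (nseq j i0) = fun=> 0.
  elim: j {IH} => //= j ->; apply/funext => x; exact: derive_cst.
exact: derive_cst.
Qed.

End DiskExtension.

(** * Extending families over the skeleta *)

Section SmoothMaps.
Context {R : realType}.
Local Notation Plots := (Plots R).
Local Notation smooth := (smooth R).
Local Notation real_plots := (real_plots R).
Local Notation Dopen := (Dopen R).

Lemma fam_smooth_comp {S T I : Type} (p : Plots S) (q : Plots T) (h : S -> T) (f : I -> T -> R) :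
  smooth p q h -> fam_smooth q f -> fam_smooth p (fun i x => f i (h x)).
Proof.
move=> Hh [Hf Lf]; split=> [i k U P pP|k U P pP y Uy].
  by have := Hf i _ _ _ (Hh _ _ _ pP).
exact: Lf _ _ _ (Hh _ _ _ pP) y Uy.
Qed.

Lemma Dopen_preimage {S T : Type} (p : Plots S) (q : Plots T) (h : S -> T) (O : set T) :
  smooth p q h -> Dopen q O -> Dopen p (h @^-1` O).
Proof. by move=> Hh dO k U P pP; exact: (dO k U (h \o P) (Hh _ _ _ pP)). Qed.

Lemma Dopen_setU {T : Type} (p : Plots T) (A B : set T) :
  Dopen p A -> Dopen p B -> Dopen p (A `|` B).
Proof.
move=> dA dB k U P pP; rewrite preimage_setU setIUr; apply: openU; [exact: dA|exact: dB].
Qed.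

Lemma Dopen_real {T : Type} (p : Plots T) (f : T -> R) (A : set R) :
  smooth p real_plots f -> open A -> Dopen p (f @^-1` A).
Proof.
move=> Hf oA k U P pP; have [oU Cf] := Hf _ _ _ pP.
apply: (open_preimage_in U (f \o P) A oU oA) => y Uy; exact: Cinf_continuous Cf Uy.
Qed.

Lemma coprod_inj_smooth {J : Type} {T : J -> Type} (p : forall j, Plots (T j)) (j : J) :
  (forall k U P, p j k U P -> open U) ->
  smooth (p j) (coprod_plots R p) (fun x => existT _ j x).
Proof.
move=> op k U P pP; have oU := op _ _ _ pP; split=> // y Uy.
by exists U, j, P; split.
Qed.

Lemma fam_smooth_coprod {J I : Type} {T : J -> Type} (p : forall j, Plots (T j))
    (f : I -> {j : J & T j} -> R) :
  (forall j, fam_smooth (p j) (fun i x => f i (existT _ j x))) ->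
  fam_smooth (coprod_plots R p) f.
Proof.
move=> H; split=> [i k U P [oU loc]|k U P [oU loc] y Uy].
  split; first exact: oU.
  apply: Cinf_local => y Uy; have [V [j [Q [oV Vy VU pQ PQ]]]] := loc y Uy.
  exists V => //; have [_ Cf] := (H j).1 i _ _ _ pQ.
  by apply: (Cinf_ext _ _ _ oV _ Cf) => z Vz /=; rewrite PQ.
have [V [j [Q [oV Vy VU pQ PQ]]]] := loc y Uy.
have [A fA HA] := (H j).2 _ _ _ pQ y Vy; exists A => //.
apply: filterS2 HA (open_nbhs_nbhs (conj oV Vy)) => z HA Vz i nA.
by rewrite PQ //; exact: HA.
Qed.

(* The universal properties applied to this space give surjectivity statements: two maps to
   [bool] that agree on the pieces are equal. *)
Definition indiscrete_bool : Plots bool := fun k U _ => open U.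

Lemma indiscrete_diffeology : is_diffeology R indiscrete_bool.
Proof. by split. Qed.

Lemma sval_sub_eq {T : Type} {A : set T} (x y : {x : T | A x}) : sval x = sval y -> x = y.
Proof. exact: eq_sig_hprop (fun _ => @Prop_irrelevance _) _ _. Qed.

End SmoothMaps.

Section Skeleta.
Context {R : realType} (X : fatCW R).
Local Notation Plots := (Plots R).
Local Notation smooth := (smooth R).
Local Notation Dopen := (Dopen R).
Local Notation T := (cw_carrier R X).
Local Notation p := (cw_plots R X).
Local Notation skel := (skel R X).
Local Notation cells := (cells R X).
Local Notation mm := (cell_m R X).
Local Notation skp n := (sub_plots R p (skel n)).
Local Notation skmono n := (@skel_mono R X n).
Local Notation att n := (@attach R X n).
Local Notation chr n := (@charmap R X n).
Local Notation Dp n := (coprod_plots R (fun j : cells n => Disk_plots R n (mm n j))).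

Lemma cw_plot_open k U P : p k U P -> open U.
Proof. by have [H _ _ _ _] := cw_diffeology R X; exact: H. Qed.

Lemma chr_smooth n : smooth (Dp n) (skp n.+1) (chr n).
Proof. by have [_ _ H _ _] := skel_pushout R X n. Qed.

Lemma chr_cell_smooth n (j : cells n) :
  smooth (Disk_plots R n (mm n j)) p (fun q => sval (chr n (existT _ j q))).
Proof.
move=> k U P pP; apply: (@chr_smooth n k U (fun y => existT _ j (P y))).
by apply: (coprod_inj_smooth (fun j : cells n => Disk_plots R n (mm n j)) j _ k U P pP) => k' U' P' [].
Qed.

Lemma chr_att n (j : cells n) (s : Sph R n (mm n j)) :
  chr n (existT _ j (sval s)) = subincl (skmono n) (att n (existT _ j s)).
Proof.
have [_ _ _ E _] := skel_pushout R X n.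
by have := congr1 (@^~ (existT _ j s)) E.
Qed.

Lemma skel_cases n (x : {x | skel n.+1 x}) :
  (exists y, x = subincl (skmono n) y) \/ exists j q, x = chr n (existT _ j q).
Proof.
have [_ _ _ _ univ] := skel_pushout R X n.
pose ind (z : {x | skel n.+1 x}) : bool :=
  `[< (exists y, z = subincl (skmono n) y) \/ exists j q, z = chr n (existT _ j q) >].
have op N k U P : skp N k U P -> open U by exact: cw_plot_open.
have [|||u [_ _ _ uniq]] := univ bool indiscrete_bool indiscrete_diffeology (fun=> true) (fun=> true).
- by move=> k U P /op.
- by move=> k U P [].
- by [].
have E1 : (fun=> true) = u by apply: uniq => // k U P /op.
have E2 : ind = u.
  apply: uniq; first by move=> k U P /op.
    by apply/funext => y; apply/asboolP; left; exists y.
  by apply/funext => -[j q]; apply/asboolP; right; exists j, q.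
by apply/asboolP; rewrite -/(ind x) E2 -E1.
Qed.

Lemma cw_exhausted (x : T) : exists n, skel n x.
Proof.
have [||u [_ _ uniq]] := skel_colimit R X bool indiscrete_bool indiscrete_diffeology (fun _ _ => true).
- by move=> n k U P /cw_plot_open.
- by [].
have E1 : (fun=> true) = u by apply: uniq => // k U P /cw_plot_open.
have E2 : (fun x => `[< exists n, skel n x >]) = u.
  apply: uniq; first by move=> k U P /cw_plot_open.
  by move=> n y; apply/asboolP; exists n; exact: (svalP y).
by apply/asboolP; rewrite -[asbool _]/((fun x => `[< exists n, skel n x >]) x) E2 -E1.
Qed.

Lemma cw_const (x : T) : p 0%N setT (fun=> x).
Proof. by have [_ _ H _ _] := cw_diffeology R X; apply: H; exact: openT. Qed.

Lemma pushout_glue {I : Type} n (f : I -> {x | skel n x} -> R)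
    (b : I -> {j : cells n & Disk R n (mm n j)} -> R) :
  fam_smooth (skp n) f ->
  (forall j, fam_smooth (Disk_plots R n (mm n j)) (fun i q => b i (existT _ j q))) ->
  (forall i j s, b i (existT _ j (sval s)) = f i (att n (existT _ j s))) ->
  exists F : I -> {x | skel n.+1 x} -> R, [/\ fam_smooth (skp n.+1) F,
    (forall i x, F i (subincl (skmono n) x) = f i x) & forall i q, F i (chr n q) = b i q].
Proof.
move=> Hf Hb bf; have [_ _ _ _ univ] := skel_pushout R X n.
have ff x : finite_set [set i | f i x != 0].
  by apply: (fam_finite (skp n)) => //; exact: (cw_const (sval x)).
have fb x : finite_set [set i | b i x != 0].
  case: x => j q; apply: (@fam_finite _ _ _ (Disk_plots R n (mm n j)) (fun i q => b i (existT _ j q)) q) => //.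
  exact: Disk_plots_const.
have op k U P : skp n k U P -> open U by exact: cw_plot_open.
have op1 k U P : skp n.+1 k U P -> open U by exact: cw_plot_open.
have [|||u [us uf ub _]] := univ (finsupp I) (finsupp_plots I) (finsupp_diffeology I)
  (fun x => exist _ (fun i => f i x) (ff x)) (fun x => exist _ (fun i => b i x) (fb x)).
- by apply/smooth_finsupp.
- by apply/smooth_finsupp => [k U P []//|]; exact: fam_smooth_coprod.
- apply/funext => -[j s]; apply: sval_sub_eq => /=; apply/funext => i.
  by rewrite -bf.
exists (fun i x => sval (u x) i); split.
- exact: ((smooth_finsupp _ u op1).1 us).
- by move=> i x; have /(congr1 (@^~ x)) /= -> := uf.
- by move=> i q; have /(congr1 (@^~ q)) /= -> := ub.
Qed.

(** Every pair of a cell and an index gets its own tube. Multiplying each function by its own cutoff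
    does not affect local finiteness, so no uniform width is required. *)
Lemma skel_extend {I : Type} n (e e' : R) (f : I -> {x | skel n x} -> R) (O : I -> set T) :
  0 <= e' -> e < e' -> (forall i, Dopen p (O i)) ->
  fam_smooth (skp n) f -> (forall i x, e < f i x -> O i (sval x)) ->
  exists F : I -> {x | skel n.+1 x} -> R, [/\ fam_smooth (skp n.+1) F,
    (forall i x, F i (subincl (skmono n) x) = f i x) &
    forall i x, e' < F i x -> O i (sval x)].
Proof.
move=> e'0 ee' dO Hf fO.
have Hext (j : cells n) : exists E : I -> Disk R n (mm n j) -> R,
    fam_smooth (Disk_plots R n (mm n j)) E /\
    forall i s, E i (sval s) = f i (att n (existT _ j s)).
  apply: (disk_family_extend (fun i s => f i (att n (existT _ j s)))).
  apply: (fam_smooth_comp _ (skp n) _ f _ Hf) => k U P pP.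
  apply: (@attach_smooth R X n k U (fun y => existT _ j (P y))).
  by apply: (coprod_inj_smooth (fun j : cells n => Sph_plots R n (mm n j)) j _ k U P pP) => k' U' P' [].
pose E j := projT1 (cid (Hext j)).
have ES j : fam_smooth (Disk_plots R n (mm n j)) (E j) by case: (projT2 (cid (Hext j))).
have Ef j i s : E j i (sval s) = f i (att n (existT _ j s)).
  by case: (projT2 (cid (Hext j))) => _; exact.
have Htube j i : exists d, [/\ 0 < d, d < 1 & forall q : Disk R n (mm n j),
    1 - d <= enorm R (sval q).1 -> O i (sval (chr n (existT _ j q))) \/ E j i q < e'].
  apply: (Dopen_tube ((fun q => sval (chr n (existT _ j q))) @^-1` (O i) `|` (E j i) @^-1` [set t | t < e'])).
    apply: Dopen_setU; first exact: (Dopen_preimage _ _ _ _ (chr_cell_smooth n j) (dO i)).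
    by apply: Dopen_real; [exact: (ES j).1|exact: open_lt].
  move=> q Sq; have [Eq|Eq] := ltP (E j i q) e'; first by right.
  left; rewrite /= -[q]/(sval (exist _ q Sq : Sph R n (mm n j))) chr_att /=.
  by apply: fO; rewrite -Ef /=; exact: lt_le_trans Eq.
pose d j i := projT1 (cid (Htube j i)).
have d0 j i : 0 < d j i by case: (projT2 (cid (Htube j i))).
have d1 j i : d j i < 1 by case: (projT2 (cid (Htube j i))).
have dE j i (q : Disk R n (mm n j)) : 1 - d j i <= enorm R (sval q).1 ->
    O i (sval (chr n (existT _ j q))) \/ E j i q < e'.
  by case: (projT2 (cid (Htube j i))) => _ _; exact.
pose b i (z : {j : cells n & Disk R n (mm n j)}) := rim_cutoff (d (projT1 z) i) (projT2 z) * E (projT1 z) i (projT2 z).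
have [||F [FS Ff Fb]] := pushout_glue n f b Hf.
- move=> j; apply: (fam_smooth_mul _ (E j) (fun i q => rim_cutoff (d j i) q)) => // i.
  exact: rim_cutoff_smooth.
- move=> i j s; rewrite /b /= rim_cutoff_outer ?mul1r ?Ef //; exact: (svalP s).
exists F; split=> // i x; have [[y ->]|[j [q ->]]] := skel_cases n x.
  by rewrite Ff => fe; apply: fO; exact: lt_trans fe.
rewrite Fb /b /= => be.
have c0 := rim_cutoff_ge0 (d j i) q; have c1 := rim_cutoff_le1 (d j i) q.
(* The product exceeds [e' >= 0], so [E] is positive and a cutoff at most 1 can only have lowered
   it. *)
have Epos : 0 < E j i q by rewrite ltNge; apply/negP => E0; have := mulr_ge0_le0 c0 E0; lra.
have Ee : e' < E j i q by apply: lt_le_trans be _; rewrite ger_pMl.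
have [dq|dq] := leP (1 - d j i) (enorm R (sval q).1).
  by have [//|] := dE j i q dq; lra.
by move: be; rewrite rim_cutoff_inner // ?mul0r; [lra|exact: ltW].
Qed.

Lemma skel_le n k : skel n `<=` skel (k + n).
Proof. by elim: k => // k IH x /IH; exact: skel_mono. Qed.

Lemma skel_tower {I : Type} N (f : I -> {x | skel N x} -> R) (O : I -> set T) :
  (forall i, Dopen p (O i)) -> fam_smooth (skp N) f ->
  (forall i x, 0 < f i x -> O i (sval x)) ->
  exists F : I -> T -> R, [/\ fam_smooth p F, (forall i x, F i (sval x) = f i x) &
    forall i x, 1 <= F i x -> O i x].
Proof.
move=> dO Hf fO.
(* [skel_extend] loses a little of the threshold at each skeleton; these never exceed 1. *)
pose e k : R := 1 - k.+1%:R^-1.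
have e0 k : 0 <= e k by rewrite subr_ge0 invf_le1 ?ler1n.
have ee k : e k < e k.+1 by rewrite /e ltrD2l ltrN2 ltf_pV2 ?posrE ?ltr_nat.
have e1 k : e k < 1 by rewrite gtrBl invr_gt0.
(* With [k + N] in this order, [k.+1 + N] is the successor of [k + N] by computation, as
   [skel_extend] requires. *)
pose S k := {G : I -> {x | skel (k + N) x} -> R |
  fam_smooth (skp (k + N)) G /\ forall i x, e k < G i x -> O i (sval x)}.
have stepP k (G : S k) := skel_extend (k + N) (e k) (e k.+1) (sval G) O (e0 _) (ee _) dO (svalP G).1 (svalP G).2.
pose step k (G : S k) : S k.+1 := exist _ (projT1 (cid (stepP k G)))
  (let H := projT2 (cid (stepP k G)) in conj (and3_rec (fun a _ _ => a) H) (and3_rec (fun _ _ a => a) H)).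
have G0P : fam_smooth (skp (0 + N)) f /\ forall i x, e 0%N < f i x -> O i (sval x).
  by split=> // i x fx; apply: fO; exact: le_lt_trans fx.
pose G : forall k, S k := nat_rect S (exist _ f G0P) step.
have GS k i x : sval (G k.+1) i (subincl (skmono (k + N)) x) = sval (G k) i x.
  by have [_ H _] := projT2 (cid (stepP k (G k))); exact: H.
have Gfin k x : finite_set [set i | sval (G k) i x != 0].
  by apply: (fam_finite (skp (k + N))); [exact: (cw_const (sval x))|exact: (svalP (G k)).1].
(* The colimit asks for a map on every skeleton, also below [N]: [skel k] is sent into the larger
   [skel (k + N)], where the [k]-th extension lives. *)
pose incl k : {x | skel k x} -> {x | skel (k + N) x} :=
  fun x => exist _ (sval x) (eq_ind _ (fun a => skel a (sval x)) (skel_le k N _ (svalP x)) _ (addnC N k)).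
have op n k U P : skp n k U P -> open U by exact: cw_plot_open.
have [||u [us ug _]] := skel_colimit R X (finsupp I) (finsupp_plots I) (finsupp_diffeology I)
  (fun k x => exist _ (fun i => sval (G k) i (incl k x)) (Gfin k (incl k x))).
- move=> k; apply/smooth_finsupp; first exact: op.
  exact: (fam_smooth_comp (skp k) (skp (k + N)) (incl k) (sval (G k)) _ (svalP (G k)).1).
- move=> k x; apply: sval_sub_eq => /=; apply/funext => i; rewrite -GS; congr (sval _ i _).
  exact: sval_sub_eq.
have key l i x (z : {x | skel (l + N) x}) : sval z = sval x -> sval (G l) i z = f i x.
  elim: l z => [|l IH] z zx; first by congr (f i _); exact: sval_sub_eq.
  have xl : skel (l + N) (sval x) by apply: skel_le; exact: svalP.
  have -> : z = subincl (skmono (l + N)) (exist _ (sval x) xl) by apply: sval_sub_eq.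
  by rewrite GS; apply: IH.
exists (fun i x => sval (u x) i); split.
- exact: ((smooth_finsupp _ u cw_plot_open).1 us).
- by move=> i x; rewrite ug /=; exact: key.
- move=> i x; have [k xk] := cw_exhausted x.
  have := ug k (exist _ x xk); rewrite /= => -> /= F1.
  exact: ((svalP (G k)).2 i (incl k (exist _ x xk)) (lt_le_trans (e1 k) F1)).
Qed.

End Skeleta.

(** * Partitions of unity from countably many families *)

Section FiniteSums.
Context {R : realType}.
Local Notation Plots := (Plots R).
Local Notation smooth := (smooth R).
Local Notation real_plots := (real_plots R).
Local Notation Dopen := (Dopen R).

Lemma smooth_cst {T : Type} (p : Plots T) (c : R) :
  (forall k U P, p k U P -> open U) -> smooth p real_plots (fun=> c).
Proof. by move=> op k U P /op oU; split; [exact: oU|exact: Cinf_cst]. Qed.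

Lemma smooth_sum {T I : Type} (p : Plots T) (r : seq I) (f : I -> T -> R) :
  (forall k U P, p k U P -> open U) -> (forall i, smooth p real_plots (f i)) ->
  smooth p real_plots (fun x => \sum_(i <- r) f i x).
Proof.
move=> op Hf k U P pP; have oU := op _ _ _ pP; split; first exact: oU.
by apply: (Cinf_sum U r predT (fun i y => f i (P y)) oU) => i; have [] := Hf i _ _ _ pP.
Qed.

Lemma smooth_prod {T I : Type} (p : Plots T) (r : seq I) (f : I -> T -> R) :
  (forall k U P, p k U P -> open U) -> (forall i, smooth p real_plots (f i)) ->
  smooth p real_plots (fun x => \prod_(i <- r) f i x).
Proof.
move=> op Hf k U P pP; have oU := op _ _ _ pP; split; first exact: oU.
by apply: (Cinf_prod U r predT (fun i y => f i (P y)) oU) => i; have [] := Hf i _ _ _ pP.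
Qed.

Lemma smooth_comp1 {T : Type} (p : Plots T) (f : T -> R) (h : R -> R) :
  (forall L, Ck1 L setT h) -> smooth p real_plots f -> smooth p real_plots (fun x => h (f x)).
Proof.
move=> Hh Hf k U P pP; have [oU Uf] := Hf _ _ _ pP; split; first exact: oU.
exact: (Cinf_comp1 U setT _ h oU Hh Uf (fun _ _ => Logic.I)).
Qed.

Lemma fam_smooth_comp1 {T I : Type} (p : Plots T) (f : I -> T -> R) (h : R -> R) :
  (forall L, Ck1 L setT h) -> h 0 = 0 -> fam_smooth p f -> fam_smooth p (fun i x => h (f i x)).
Proof.
move=> Hh h0 [Hf Lf]; split=> [i|k U P pP y Uy]; first exact: smooth_comp1.
have [A fA HA] := Lf _ _ _ pP y Uy; exists A => //.
by apply: filterS HA => z HA i /HA ->.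
Qed.

Lemma smooth_fsum {T : Type} {I : choiceType} (p : Plots T) (f : I -> T -> R) :
  (forall k U P, p k U P -> open U) -> fam_smooth p f ->
  smooth p real_plots (fun x => \sum_(i \in [set: I]) f i x).
Proof.
move=> op [Hf Lf] k U P pP; have oU := op _ _ _ pP; split; first exact: oU.
apply: Cinf_local => y Uy; have [A fA HA] := Lf _ _ _ pP y Uy.
have NU : nbhs y U := open_nbhs_nbhs (conj oU Uy).
have : nbhs y ([set z | forall i, ~ A i -> f i (P z) = 0] `&` U) by apply: filterI.
rewrite nbhsE => -[V [oV Vy] HV]; exists V; first exact: Vy.
have [_ Us] := smooth_sum p (finmap.enum_fset (fset_set A)) f op Hf k U P pP.
have VU : V `<=` U by move=> z /HV[].
apply: (Cinf_ext _ _ _ oV _ (Cinf_subset _ _ _ VU Us)) => z /HV[Hz _] /=.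
by rewrite (fsbigTE (fset_set A)) // => i; rewrite in_fset_set // notin_setE => /Hz.
Qed.

End FiniteSums.

(** * Normalizing a locally finite family *)

Section Assembly.
Context {R : realType} {T : Type} (p : Plots R T).
Local Notation smooth := (smooth R).
Local Notation real_plots := (real_plots R).
Local Notation Dopen := (Dopen R p).
Hypothesis dp : is_diffeology R p.

Lemma diffeology_open k U P : p k U P -> open U.
Proof. by case: dp => H _ _ _ _; exact: H. Qed.

Lemma diffeology_cst (x : T) : p 0%N setT (fun=> x).
Proof. by case: dp => _ _ H _ _; apply: H; exact: openT. Qed.

Definition locfin {K : Type} (C : K -> set T) : Prop :=
  forall k U P, p k U P -> forall y, U y ->
    exists2 A : set K, finite_set A & \forall z \near y, forall i, ~ A i -> ~ C i (P z).

Lemma near_seq {S : Type} {K : eqType} (F : set_system S) {FF : Filter F} (r : seq K) (Q : K -> S -> Prop) :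
  (forall i, i \in r -> \forall z \near F, Q i z) -> \forall z \near F, forall i, i \in r -> Q i z.
Proof.
elim: r => [|j r IH] H; first by apply: filterE => z i; rewrite in_nil.
have H1 : \forall z \near F, Q j z by apply: H; exact: mem_head.
have H2 : \forall z \near F, forall i, i \in r -> Q i z.
  by apply: IH => i ir; apply: H; rewrite in_cons ir orbT.
by apply: filterS2 H1 H2 => z Hj Hr i; rewrite in_cons => /predU1P[->//|/Hr].
Qed.

(** D-openness is tested on plots, and near a given parameter of a plot only finitely many [C i]
    occur; so local finiteness along plots is enough for D-closed unions. *)
Lemma locfin_Dclosed {K : choiceType} (C : K -> set T) (B : set K) : locfin C ->
  (forall i, Dopen (~` C i)) -> Dopen [set x | forall i, B i -> ~ C i x].
Proof.
move=> lC cC k U P pP; have oU := diffeology_open _ _ _ pP.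
rewrite openE => y [Uy HB]; have [A fA HA] := lC _ _ _ pP y Uy.
have NU : nbhs y U := open_nbhs_nbhs (conj oU Uy).
have H2 : \forall z \near y, forall i, i \in finmap.enum_fset (fset_set A) -> B i -> ~ C i (P z).
  apply: (@near_seq _ _ (nbhs y) _ _ (fun i z => B i -> ~ C i (P z))) => i _; have [Bi|nBi] := pselect (B i).
    have : nbhs y (U `&` P @^-1` (~` C i)).
      by apply: open_nbhs_nbhs; split; [exact: cC|split; [|exact: HB]].
    by move=> H; apply: (@filterS _ (nbhs y) _ _ _ _ H) => z [_ HC] _.
  by apply: (@filterE _ (nbhs y)) => z /nBi.
apply: filterS3 NU HA H2 => z Uz HA H2; split; first exact: Uz.
move=> i Bi; have [Ai|nAi] := pselect (A i); last exact: HA.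
by apply: H2 => //; rewrite in_fset_set // inE.
Qed.

Lemma locfin_finite {K : Type} (C : K -> set T) x : locfin C -> finite_set [set i | C i x].
Proof.
move=> /(_ _ _ _ (diffeology_cst x) 0 Logic.I)[A fA /nbhs_singleton HA].
by apply: sub_finite_set fA => i /= Ci; apply: contrapT => /HA.
Qed.

(** The functions [g k] are grouped by their label [V k] and divided by the total sum. The D-closed
    sets [C k] stand in for supports: the union of those with label [U] is D-closed, so it contains
    the support of [rho U]. *)
Lemma partition_of_locfin {K : choiceType} (UU : set (set T)) (g : K -> T -> R) (C V : K -> set T) :
  fam_smooth p g -> (forall k x, 0 <= g k x) -> (forall x, exists k, 0 < g k x) ->
  (forall k x, g k x != 0 -> C k x) -> (forall k, C k `<=` V k) -> (forall k, UU (V k)) ->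
  locfin C -> (forall k, Dopen (~` C k)) ->
  exists rho : set T -> T -> R, smooth_partition_of_unity_subordinate R p UU rho.
Proof.
move=> Hg g0 gpos gC CV UV lC cC.
pose S x := \sum_(k \in [set: K]) g k x.
pose h U k x := (V k == U)%:R * g k x.
pose rho U x := (\sum_(k \in [set: K]) h U k x) / S x.
have hfam U : fam_smooth p (h U).
  apply: (fam_smooth_mul p g (fun k _ => (V k == U)%:R) _ Hg) => k.
  exact: (smooth_cst p _ diffeology_open).
pose E x := finmap.enum_fset (fset_set [set k | C k x]).
have gE x k : k \notin E x -> g k x = 0.
  rewrite in_fset_set ?notin_setE; last exact: locfin_finite.
  by move=> nC; apply/eqP; apply: contraT => /gC.
have SE x : S x = \sum_(k <- E x) g k x by rewrite /S (fsbigTE (fset_set [set k | C k x])) // => k /gE.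
have hE U x : \sum_(k \in [set: K]) h U k x = \sum_(k <- E x) h U k x.
  by rewrite (fsbigTE (fset_set [set k | C k x])) // => k /gE; rewrite /h => ->; rewrite mulr0.
have S0 x : 0 < S x.
  have [k gk] := gpos x.
  have kE : k \in E x by apply: contraTT gk => /gE ->; rewrite ltxx.
  rewrite SE (big_rem k kE) /= ltr_pwDl // sumr_ge0 //.
have h0 U k x : 0 <= h U k x by rewrite /h mulr_ge0.
have rhoC U x : rho U x != 0 -> exists2 k, V k = U & C k x.
  rewrite /rho hE => H; apply: contrapT => nH; move/negP: H; apply; rewrite big1 ?mul0r // => k _.
  rewrite /h; have [VU|_] := eqVneq; last by rewrite mul0r.
  have [->|/gC Ck] := eqVneq (g k x) 0; first by rewrite mulr0.
  by exfalso; apply: nH; exists k.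
have suppC U x : Dsupport R p (rho U) x -> exists2 k, V k = U & C k x.
  move=> sx; apply: contrapT => nH.
  have [|y [Oy]] := sx [set x | forall k, V k = U -> ~ C k x] (locfin_Dclosed C [set k | V k = U] lC cC).
    by move=> k VU Ck; apply: nH; exists k.
  by move=> /= /rhoC[k VU]; exact: Oy.
exists rho; split.
- move=> U _ k W P pP; have oW := diffeology_open _ _ _ pP; split; first exact: oW.
  have [_ HU] := smooth_fsum p (h U) diffeology_open (hfam U) _ _ _ pP.
  have [_ HS] := smooth_fsum p g diffeology_open Hg _ _ _ pP.
  apply: (Cinf_mul _ _ _ oW HU (Cinf_inv _ _ oW HS _)) => y _.
  by rewrite gt_eqF //; exact: S0.
- move=> U x _; rewrite /rho divr_ge0 ?(ltW (S0 x)) ?hE ?sumr_ge0 //=.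
  rewrite ler_pdivrMr // mul1r SE; apply: ler_sum => k _.
  by rewrite /h; case: (_ == _); rewrite ?mul1r ?mul0r.
- by move=> U _ x /suppC[k <-]; exact: CV.
(* On this D-open set only those [C k] occur that contain [x], so only finitely many labels are
   left. *)
- move=> x; exists [set y | forall k, ~ C k x -> ~ C k y]; split.
  + exact: (locfin_Dclosed C [set k | ~ C k x]).
  + by [].
  + apply: (@sub_finite_set _ _ (V @` [set k | C k x])).
      move=> U [_ [y [Oy /suppC[k VU Cy]]]]; exists k => //.
      by apply: contrapT => /Oy.
    exact/finite_image/locfin_finite.
(* Several indices may share a label; [undup] gives the injective enumeration. *)
- move=> x; pose s : seq (set T) := undup [seq V k | k <- E x].
  have us : uniq s by exact: undup_uniq.
  exists (size s), (fun i => nth set0 s i); split.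
  + by move=> i j /eqP; rewrite nth_uniq // => /eqP/val_inj.
  + move=> i; have : nth set0 s i \in s by exact: mem_nth.
    by rewrite mem_undup => /mapP[k _ ->].
  + move=> U _; rewrite /rho hE => H.
    have Us : U \in s.
      apply: contraT => nU; move/negP: H; case; rewrite big_seq big1 ?mul0r // => k kE.
      rewrite /h; have [VU|_] := eqVneq; last by rewrite mul0r.
      by move: nU; rewrite mem_undup -VU map_f.
    have iU : (index U s < size s)%N by rewrite index_mem.
    by exists (Ordinal iU); rewrite /= nth_index.
  + rewrite -(big_mkord xpredT (fun i => rho (nth set0 s i) x)) -(big_nth set0 xpredT (fun U => rho U x)).
    rewrite /rho -mulr_suml; under eq_bigr do rewrite hE.
    rewrite exchange_big /=; apply: (@mulIf _ (S x)); first by rewrite gt_eqF.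
    rewrite mulfVK ?gt_eqF // mul1r SE; apply: eq_big_seq => k kE.
    have Vs : V k \in s by rewrite mem_undup map_f.
    rewrite (bigD1_seq (V k)) //= /h eqxx mul1r big1 ?addr0 // => U nU.
    by rewrite eq_sym (negbTE nU) mul0r.
Qed.

End Assembly.

(** * Making countably many families jointly locally finite *)

Section CountableFamilies.
Context {R : realType}.
Local Notation Plots := (Plots R).
Local Notation smooth := (smooth R).
Local Notation real_plots := (real_plots R).
Local Notation ell := (ell R).

Lemma Dopen_local {T : Type} (p : Plots T) (O : set T) :
  (forall x, O x -> exists W, [/\ Dopen R p W, W x & W `<=` O]) ->
  (forall k U P, p k U P -> open U) -> Dopen R p O.
Proof.
move=> H op k U P pP; have oU := op _ _ _ pP; rewrite openE => y [Uy Oy].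
have [W [dW Wy WO]] := H _ Oy.
have N : nbhs y (U `&` P @^-1` W) by apply: open_nbhs_nbhs; split; [exact: dW|split].
apply: (@filterS _ (nbhs y) _ _ _ _ N) => z [Uz Wz]; split; [exact: Uz|exact: WO].
Qed.

Lemma fsum_gt0 {I : choiceType} (f : I -> R) (i : I) :
  finite_set [set j | f j != 0] -> (forall j, 0 <= f j) -> 0 < f i ->
  0 < \sum_(j \in [set: I]) f j.
Proof.
move=> ff f0 fi; rewrite (fsbigTE (fset_set [set j | f j != 0])); last first.
  by move=> j; rewrite in_fset_set // notin_setE => /negP; rewrite negbK => /eqP.
have iE : i \in finmap.enum_fset (fset_set [set j | f j != 0]).
  by rewrite in_fset_set // inE /= gt_eqF.
by rewrite (big_rem i iE) /= ltr_pwDl // sumr_ge0.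
Qed.

Context {T : Type} (p : Plots T) (UU : set (set T)).
Hypothesis dp : is_diffeology R p.
Variables (I : nat -> choiceType) (F : forall a, I a -> T -> R) (V : forall a, I a -> set T).
Hypotheses (HF : forall a, fam_smooth p (F a)) (UV : forall a i, UU (V a i))
  (FV : forall a i x, 1 <= F a i x -> V a i x) (Fpos : forall x, exists a i, 1 < F a i x).

Let op := diffeology_open p dp.
Let f a i x := ell (1 * F a i x + -1).
Let G a x := \sum_(i \in [set: I a]) f a i x.
(** The factor with index [b] is 0 exactly where [a * G b >= 1]. As [a] grows these factors cut the
    families off on ever more of the set where an earlier [G b] is positive. *)
Let w a x := \prod_(b < a) ell (- a%:R * G b x + 1).
Let K : choiceType := {a : nat & I a}.
Let g (k : K) x := w (projT1 k) x * f (projT1 k) (projT2 k) x.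
(** Non-strict versions of the conditions under which [g k] is nonzero; they make the set D-closed
    while [F >= 1] still places it inside [V]. *)
Let C (k : K) := [set x | 1 <= F (projT1 k) (projT2 k) x /\
  forall b, (b < projT1 k)%N -> (projT1 k)%:R * G b x <= 1].

Let fam_f a : fam_smooth p (f a).
Proof.
apply: (fam_smooth_comp1 p (F a) (fun t => ell (1 * t + -1)) _ _ (HF a)).
  by move=> L; exact: Ck1_affine Ck1_ell.
by rewrite mulr0 add0r ell_le0 // oppr_le0.
Qed.

Let f_ge0 a i x : 0 <= f a i x.
Proof. exact: ell_ge0. Qed.

Let f_gt0 a i x : (0 < f a i x) = (1 < F a i x).
Proof. by rewrite /f ell_gt0 mul1r subr_gt0. Qed.

Let G_smooth a : smooth p real_plots (G a).
Proof. exact: smooth_fsum. Qed.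

Let G_ge0 a x : 0 <= G a x.
Proof. by apply: fsumr_ge0 => i _; exact: f_ge0. Qed.

Let G_gt0 a i x : 1 < F a i x -> 0 < G a x.
Proof.
rewrite -f_gt0 => fi; apply: (fsum_gt0 (fun i => f a i x) i) => //.
by apply: (fam_finite p (f a)) => //; exact: diffeology_cst.
Qed.

Let w_ge0 a x : 0 <= w a x.
Proof. by apply: prodr_ge0 => b _; exact: ell_ge0. Qed.

Let gC k x : g k x != 0 -> C k x.
Proof.
case: k => a i; rewrite /g /= mulf_eq0 negb_or => /andP[w0 fi]; split => /=.
  by apply/ltW; rewrite -f_gt0 lt0r fi f_ge0.
move=> b ba; rewrite leNgt; apply/negP => H; move/negP: w0; apply.
rewrite /w; apply/prodf_eq0; exists (Ordinal ba) => //=; apply/eqP/ell_le0.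
by rewrite mulNr; lra.
Qed.

Let C_locfin : locfin p C.
Proof.
move=> k U P pP y Uy; have oU := op _ _ _ pP.
have [a0 [i0 Fi0]] := Fpos (P y); have G0 := G_gt0 _ _ _ Fi0.
(* Near [y], families with index at least [M] violate the condition on [G a0]; finitely many
   families remain, and each is locally finite along the plot. *)
pose M := maxn a0.+1 (Num.truncn (G a0 (P y))^-1).+1.
have MG : 1 < M%:R * G a0 (P y).
  rewrite -ltr_pdivrMr // div1r; apply: lt_le_trans (truncnS_gt _) _.
  by rewrite ler_nat leq_maxr.
have aM : (a0 < M)%N by exact: leq_maxl.
have N1 : \forall z \near y, 1 < M%:R * G a0 (P z).
  have dG : Dopen R p ((fun x => M%:R * G a0 x) @^-1` [set t | 1 < t]).
    apply: Dopen_real; last exact: open_gt.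
    move=> k' U' P' pP'; have [oU' GU'] := G_smooth a0 _ _ _ pP'; split; first exact: oU'.
    exact: (Cinf_mul _ _ _ oU' (Cinf_cst _ _) GU').
  have N := open_nbhs_nbhs (conj (dG _ _ _ pP) (conj Uy MG) : open_nbhs y _).
  by apply: (@filterS _ (nbhs y) _ _ _ _ N) => z [].
have HA a : exists A : set (I a), finite_set A /\ \forall z \near y, forall i, ~ A i -> F a i (P z) = 0.
  by have [A fA HA] := (HF a).2 _ _ _ pP y Uy; exists A.
pose A a := projT1 (cid (HA a)).
have fA a : finite_set (A a) by case: (projT2 (cid (HA a))).
have NA a : \forall z \near y, forall i, ~ A a i -> F a i (P z) = 0 by case: (projT2 (cid (HA a))).
exists (\bigcup_(a in [set a | (a < M)%N]) ((fun i => existT _ a i : K) @` A a)).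
  apply: bigcup_finite => [|a _]; first exact: finite_II.
  exact: finite_image.
have N2 : \forall z \near y, forall a, a \in iota 0 M -> forall i, ~ A a i -> F a i (P z) = 0.
  by apply: (@near_seq _ _ (nbhs y) _ _ (fun a z => forall i, ~ A a i -> F a i (P z) = 0)) => a _; exact: NA.
apply: (@filterS2 _ (nbhs y) _ _ _ _ _ N1 N2) => z H1 H2 [a i] nA [/= F1 HG].
have [aM'|Ma] := ltnP a M.
  have : F a i (P z) = 0.
    by apply: H2; [rewrite mem_iota add0n|move=> Ai; apply: nA; exists a => //; exists i].
  by move=> F0; move: F1; rewrite F0 ler10.
have /HG aG : (a0 < a)%N by exact: leq_trans Ma.
have : M%:R * G a0 (P z) <= a%:R * G a0 (P z) by rewrite ler_wpM2r ?G_ge0 ?ler_nat.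
lra.
Qed.

Let C_closed k : Dopen R p (~` C k).
Proof.
case: k => a i; apply: Dopen_local => // x /not_andP[/= F1|/= /existsNP[b /not_implyP[ba Gb]]].
  exists (F a i @^-1` [set t | t < 1]); split.
  - by apply: Dopen_real; [exact: (HF a).1|exact: open_lt].
  - by rewrite /= ltNge; apply/negP.
  - by move=> z /= Fz [/= F1z _]; lra.
exists ((fun x => a%:R * G b x) @^-1` [set t | 1 < t]); split.
- apply: Dopen_real; last exact: open_gt.
  move=> k' U' P' pP'; have [oU' GU'] := G_smooth b _ _ _ pP'; split; first exact: oU'.
  exact: (Cinf_mul _ _ _ oU' (Cinf_cst _ _) GU').
- by rewrite /= ltNge; apply/negP.
- by move=> z /= Gz [_ /(_ b ba)] /=; lra.
Qed.

Let g_fam : fam_smooth p g.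
Proof.
split=> [[a i]|] k U P pP.
  have oU := op _ _ _ pP; split; first exact: oU.
  have [_ Uf] := (fam_f a).1 i _ _ _ pP.
  have [_ Uw] : real_plots k U (w a \o P).
    apply: (smooth_prod p (index_enum 'I_a) (fun (b : 'I_a) x => ell (- a%:R * G b x + 1)) op _ k U P pP) => b.
    apply: (smooth_comp1 p (G b) (fun t => ell (- a%:R * t + 1)) _ (G_smooth b)) => L.
    exact: Ck1_affine Ck1_ell.
  exact: (Cinf_mul _ _ _ oU Uw Uf).
move=> y /(C_locfin _ _ _ pP)[A fA HA]; exists A => //.
apply: (@filterS _ (nbhs y) _ _ _ _ HA) => z Hz i /Hz nC.
by apply/eqP; apply: contraT => /gC.
Qed.

(** At the least [a] for which some [F a i x] exceeds 1 all earlier [G b x] are 0, and each factor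
    of [w] is [ell 1]. *)
Let g_gt0 x : exists k, 0 < g k x.
Proof.
have Hex : exists a, `[< exists i, 1 < F a i x >] by have [a Ha] := Fpos x; exists a; exact/asboolP.
case: (ex_minnP Hex) => a /asboolP[i Fi] amin; exists (existT _ a i : K).
rewrite /g /= mulr_gt0 ?f_gt0 //; apply: prodr_gt0 => b _.
have -> : G b x = 0.
  apply: fsbig1 => j _; apply/eqP; rewrite eq_le f_ge0 andbT leNgt f_gt0; apply/negP => Fj.
  have /amin : `[< exists i, 1 < F b i x >] by apply/asboolP; exists j.
  by rewrite leqNgt ltn_ord.
by rewrite mulr0 add0r ell_gt0.
Qed.

Lemma partition_of_countable_families :
  exists rho : set T -> T -> R, smooth_partition_of_unity_subordinate R p UU rho.
Proof.
apply: (partition_of_locfin p dp UU g C (fun k => V (projT1 k) (projT2 k)) g_fam _ g_gt0 gC _ _ C_locfin C_closed).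
- by move=> k x; exact: mulr_ge0 (w_ge0 _ _) (f_ge0 _ _ _).
- by move=> [a i] x [/= /FV].
- by move=> [a i]; exact: UV.
Qed.

End CountableFamilies.

(** * Bump functions on open cells *)

Section DiskBumps.
Context {R : realType}.
Local Notation ell := (ell R).

Lemma Cinf_nsq_sub {k n} (U : set 'rV[R]_k) (F : 'rV[R]_k -> 'rV[R]_n) (c : 'rV[R]_n) : open U ->
  Cinf R U F -> Cinf R U (fun y => nsq (F y - c)).
Proof.
move=> oU /(Cinf_vecP _ _ oU) HF; apply: (Cinf_nsq _ _ oU); apply/(Cinf_vecP _ _ oU) => j.
by apply: (Cinf_ext _ _ _ oU _ (Cinf_sub _ _ _ oU (HF j) (Cinf_cst _ (c 0 j)))) => y _; rewrite !mxE.
Qed.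

Lemma nsqD_le {n} (u v : 'rV[R]_n) : nsq (u + v) <= 2 * nsq u + 2 * nsq v.
Proof.
rewrite /nsq !mulr_sumr -big_split; apply: ler_sum => i _ /=; rewrite mxE.
have := sqr_ge0 (u 0 i - v 0 i); nra.
Qed.

Lemma nsqN {n} (u : 'rV[R]_n) : nsq (- u) = nsq u.
Proof. by apply: eq_bigr => i _; rewrite mxE sqrrN. Qed.

Lemma nsq_rat_approx {n} (u : 'rV[R]_n) (e : R) : 0 < e ->
  exists c : 'rV[rat]_n, nsq (u - map_mx ratr c) < e.
Proof.
move=> e0; pose d := Num.sqrt (e / n.+1%:R).
have d0 : 0 < d by rewrite sqrtr_gt0 divr_gt0.
have /choice[c Hc] : forall i, exists q : rat, (u 0 i - ratr q) ^+ 2 <= e / n.+1%:R.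
  move=> i; have [|q] := @rat_in_itvoo _ (u 0 i - d) (u 0 i + d); first by lra.
  rewrite in_itv /= => /andP[q1 q2]; exists q.
  rewrite -[leRHS]sqr_sqrtr; last by rewrite divr_ge0 // ltW.
  by rewrite -/d; nra.
exists (\row_i c i); apply: (@le_lt_trans _ _ (\sum_(i < n) e / n.+1%:R)).
  by apply: ler_sum => i _; rewrite !mxE.
rewrite sumr_const card_ord -[ltLHS]mulr_natr -mulrA gtr_pMr // mulrC ltr_pdivrMr // mul1r.
by rewrite ltr_nat.
Qed.

Context {n m : nat}.
Local Notation Disk := (Disk R n m).

(** The first [ell] kills the sphere, so the function extends by 0 over the skeleton below; the
    second localizes, with [r] a squared radius; the scale [l] lifts the value at the chosen point
    above 1. *)
Definition disk_bump (c : 'rV[R]_n) (c' : 'rV[R]_m) (r l : R) (q : Disk) : R :=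
  l * (ell (1 - nsq (sval q).1) * ell (r - nsq ((sval q).1 - c) - nsq ((sval q).2 - c'))).

Lemma disk_bump_smooth c c' r l : smooth R (Disk_plots R n m) (real_plots R) (disk_bump c c' r l).
Proof.
move=> k U P [oU P1 P2]; split; first exact: oU.
apply: (Cinf_mul _ _ _ oU (Cinf_cst _ _)); apply: (Cinf_mul _ _ _ oU).
  have H := Cinf_sub _ _ _ oU (Cinf_cst _ 1) (Cinf_nsq _ _ oU P1).
  exact: (Cinf_comp1 U setT _ ell oU Ck1_ell H (fun _ _ => Logic.I)).
have H := Cinf_sub _ _ _ oU (Cinf_sub _ _ _ oU (Cinf_cst _ r) (Cinf_nsq_sub _ _ c oU P1)) (Cinf_nsq_sub _ _ c' oU P2).
exact: (Cinf_comp1 U setT _ ell oU Ck1_ell H (fun _ _ => Logic.I)).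
Qed.

Lemma disk_bump_outer c c' r l q : Sset R n m q -> disk_bump c c' r l q = 0.
Proof.
rewrite /Sset /disk_bump => q1; rewrite [ell (1 - _)]ell_le0 ?mul0r ?mulr0 //.
by rewrite subr_le0 -enorm_sq exprn_ege1.
Qed.

(** Rational centres and natural parameters make the bumps countable, so each has a code in [nat].
    Positivity only inside [O] is stronger than a threshold and lets the tower start at 0. *)
Lemma disk_bump_base (O : set Disk) (p : Disk) : Dopen R (Disk_plots R n m) O -> O p ->
  ~ Sset R n m p -> exists (c : 'rV[rat]_n) (c' : 'rV[rat]_m) (r l : nat),
    1 < disk_bump (map_mx ratr c) (map_mx ratr c') r.+1%:R^-1 l%:R p /\
    forall q, 0 < disk_bump (map_mx ratr c) (map_mx ratr c') r.+1%:R^-1 l%:R q -> O q.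
Proof.
move=> dO Op pS; have := Dopen_near O p dO Op.
move: (erefl (sval p)); case: {2 3}(sval p) => u v pE [[A B] /= [/rV_nearP[a a0 HA] /rV_nearP[b b0 HB]] AB].
pose d := Num.min a b; have d0 : 0 < d by rewrite lt_min a0.
(* With [e = 1 / (r + 1)], centres within [e / 2] of the point and bumps of squared radius [e] give,
   by [nsqD_le], a squared distance below [3 * e], hence below [d ^+ 2]. *)
pose r := Num.truncn (4 / d ^+ 2).
have [e eE] : exists e : R, e = r.+1%:R^-1 by exists r.+1%:R^-1.
have e0 : 0 < e by rewrite eE invr_gt0.
have ed : 4 * e <= d ^+ 2.
  rewrite eE ler_pdivrMr // mulrC -ler_pdivrMr ?exprn_gt0 //.
  exact/ltW/truncnS_gt.
have [c Hc] := nsq_rat_approx u (e / 2) (divr_gt0 e0 (ltr0Sn _ 1)).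
have [c' Hc'] := nsq_rat_approx v (e / 2) (divr_gt0 e0 (ltr0Sn _ 1)).
pose t := disk_bump (map_mx ratr c) (map_mx ratr c') e 1 p.
have t0 : 0 < t.
  rewrite /t /disk_bump mul1r pE /= mulr_gt0 ?ell_gt0 //; last by lra.
  move/negP: pS; rewrite /Sset pE /= -ltNge => u1.
  rewrite subr_gt0 -enorm_sq expr_lt1 //; exact: enorm_ge0.
exists c, c', r, (Num.truncn t^-1).+1; rewrite -eE; split.
  have -> : disk_bump (map_mx ratr c) (map_mx ratr c') e (Num.truncn t^-1).+1%:R p
      = (Num.truncn t^-1).+1%:R * t by rewrite /t /disk_bump mul1r.
  by rewrite -ltr_pdivrMr // div1r; exact: truncnS_gt.
move=> q; rewrite /disk_bump => H.
have q2 : 0 < e - nsq ((sval q).1 - map_mx ratr c) - nsq ((sval q).2 - map_mx ratr c').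
  rewrite ltNge; apply/negP => H0; move: H; rewrite (ell_le0 _ H0) !mulr0 ltxx //.
have := nsq_ge0 ((sval q).1 - map_mx ratr c); have := nsq_ge0 ((sval q).2 - map_mx ratr c') => n1 n2.
have close k (x y z : 'rV[R]_k) : nsq (x - z) < e / 2 -> nsq (y - z) < e -> `|x - y| < d.
  move=> h1 h2; apply: le_lt_trans (norm_le_enorm _) _.
  rewrite -(@ltr_pXn2r _ 2) ?nnegrE ?enorm_ge0 //; last by lra.
  have := nsqD_le (x - z) (- (y - z)); rewrite nsqN opprB addrA subrK enorm_sq; lra.
apply: (AB (sval q)); last by [].
split; [apply: HA|apply: HB].
  by apply: lt_le_trans (close _ _ _ (map_mx ratr c) Hc _) _; [lra|rewrite ge_min lexx].
by apply: lt_le_trans (close _ _ _ (map_mx ratr c') Hc' _) _; [lra|rewrite ge_min lexx orbT].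
Qed.

End DiskBumps.

(** * One family for each dimension and each bump code *)

Section CellFamilies.
Context {R : realType} (X : fatCW R).
Local Notation T := (cw_carrier R X).
Local Notation p := (cw_plots R X).
Local Notation cells := (cells R X).
Local Notation mm := (cell_m R X).
Local Notation skp n := (sub_plots R p (skel R X n)).
Local Notation Dk n j := (Disk_plots R n (mm n j)).
Local Notation chr n j q := (sval (@charmap R X n (existT _ j q))).

(** Vanishing on the sphere allows extension by 0 over the previous skeleton. A plot of the
    coproduct stays locally in one cell, and a cell carries only its own index, so the family is
    locally finite at once; [skel_tower] does the rest. *)
Lemma cell_family n (b : forall j : cells n, Disk R n (mm n j) -> R) (V : cells n -> set T) :
  (forall j, smooth R (Dk n j) (real_plots R) (b j)) ->
  (forall j q, Sset R n (mm n j) q -> b j q = 0) -> (forall j, Dopen R p (V j)) ->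
  (forall j q, 0 < b j q -> V j (chr n j q)) ->
  exists F : cells n -> T -> R, [/\ fam_smooth p F, (forall j q, F j (chr n j q) = b j q) &
    forall j x, 1 <= F j x -> V j x].
Proof.
move=> Hb b0 dV bV.
(* The test is on the type [cells n], hence the classical case analysis. *)
pose B (i : cells n) (z : {j : cells n & Disk R n (mm n j)}) : R :=
  if pselect (projT1 z = i) then b (projT1 z) (projT2 z) else 0.
have op N k U P : skp N k U P -> open U by exact: cw_plot_open.
have Hf0 : fam_smooth (skp n) (fun (_ : cells n) _ => 0).
  split=> [i|k U P pP y Uy]; first exact: (smooth_cst _ 0 (op n)).
  by exists set0 => //; apply: (@filterE _ (nbhs y)).
have [||F [FS F0 FB]] := pushout_glue X n (fun (_ : cells n) _ => 0) B Hf0.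
- move=> j; split=> [i|] k U P pP.
    rewrite /B /=; case: pselect => ji; first exact: Hb.
    by apply: smooth_cst pP => k' U' P' [].
  move=> y Uy; exists [set j] => //; apply: (@filterE _ (nbhs y)) => z i ij.
  by rewrite /B /=; case: pselect => // ji; case: ij.
- move=> i j s; rewrite /B /=; case: pselect => [ji|//]; apply: b0; exact: (svalP s).
have [|G [GS GF GV]] := skel_tower X n.+1 F V dV FS.
  move=> i x; have [[y ->]|[j [q ->]]] := skel_cases X n x; first by rewrite F0 ltxx.
  rewrite FB /B /=; case: pselect => ji /=; last by rewrite ltxx.
  by rewrite -ji; exact: bV.
exists G; split=> // j q; rewrite GF FB /B /=; by case: pselect.
Qed.

Variable UU : set (set T).
Hypothesis cov : Dopen_cover R p UU.

(** The type of bump parameters depends on the cell through [mm n j], so all cells share a natural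
    number [a], which each decodes in its own type. A cell uses the decoded bump only if a single
    member of the cover contains its positivity set. *)
Lemma cell_bump_family (U0 : set T) n (a : nat) : UU U0 ->
  exists (F : cells n -> T -> R) (V : cells n -> set T),
  [/\ fam_smooth p F, (forall j, UU (V j)), (forall j x, 1 <= F j x -> V j x) &
    forall j (c : 'rV[rat]_n) (c' : 'rV[rat]_(mm n j)) (r l : nat) U, a = pickle (c, c', r, l) -> UU U ->
      (forall q, 0 < disk_bump (map_mx ratr c) (map_mx ratr c') r.+1%:R^-1 l%:R q -> U (chr n j q)) ->
      forall q, F j (chr n j q) = disk_bump (map_mx ratr c) (map_mx ratr c') r.+1%:R^-1 l%:R q].
Proof.
move=> UU0; have [Uop _] := cov.
pose bp j (e : 'rV[rat]_n * 'rV[rat]_(mm n j) * nat * nat) : Disk R n (mm n j) -> R :=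
  disk_bump (map_mx ratr e.1.1.1) (map_mx ratr e.1.1.2) e.1.2.+1%:R^-1 e.2%:R.
have Hex j : exists bV : (Disk R n (mm n j) -> R) * set T,
    [/\ smooth R (Dk n j) (real_plots R) bV.1, (forall q, Sset R n (mm n j) q -> bV.1 q = 0),
      UU bV.2, (forall q, 0 < bV.1 q -> bV.2 (chr n j q)) &
      forall e, a = pickle e -> (exists2 U, UU U & forall q, 0 < bp j e q -> U (chr n j q)) -> bV.1 = bp j e].
  have [[e [ae [U UUU HU]]]|nH] := pselect (exists e, a = pickle e /\
      exists2 U, UU U & forall q, 0 < bp j e q -> U (chr n j q)).
    exists (bp j e, U); split; [exact: disk_bump_smooth|move=> q; exact: disk_bump_outer|by []|exact: HU|].
    by move=> e' ae' _; congr (bp j _); apply: (pcan_inj pickleK); rewrite -ae.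
  (* Otherwise the zero function is used, with [U0] as a formal label. *)
  exists (fun=> 0, U0); split=> //=.
  - by apply: smooth_cst => k U P [].
  - by move=> q; rewrite ltxx.
  - by move=> e ae eU; exfalso; apply: nH; exists e.
pose b j := (projT1 (cid (Hex j))).1; pose V j := (projT1 (cid (Hex j))).2.
have [||||F [FS Fb FV]] := cell_family n b V.
- by move=> j; rewrite /b; case: (projT2 (cid (Hex j))).
- by move=> j; rewrite /b; case: (projT2 (cid (Hex j))).
- by move=> j; apply: Uop; rewrite /V; case: (projT2 (cid (Hex j))).
- by move=> j; rewrite /b /V; case: (projT2 (cid (Hex j))).
exists F, V; split=> //; first by move=> j; rewrite /V; case: (projT2 (cid (Hex j))).
move=> j c c' r l U ae UUU HU q; rewrite Fb.
have : b j = bp j (c, c', r, l).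
  by rewrite /b; case: (projT2 (cid (Hex j))) => _ _ _ _ H; apply: H => //; exists U.
by move=> ->.
Qed.

Lemma cw_open_cell (x : T) : exists n j q, x = chr n j q /\ ~ Sset R n (mm n j) q.
Proof.
have [N HN] := cw_exhausted X x.
have Hex : exists n, `[< skel R X n x >] by exists N; exact/asboolP.
(* In the first skeleton that contains [x] the point comes from a cell; from the sphere of that cell
   it would already have been attached to the previous skeleton. *)
case: (ex_minnP Hex) => -[|n] /asboolP xn nmin; first by move: xn; rewrite skel0.
have nx : ~ skel R X n x by move=> /asboolP/nmin; rewrite ltnn.
have [[y xy]|[j [q xq]]] := skel_cases X n (exist _ x xn).
  by case: nx; have /= -> := congr1 sval xy; exact: (svalP y).
exists n, j, q; split; first by have := congr1 sval xq.
move=> Sq; apply: nx; have /= -> := congr1 sval xq.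
rewrite -[q]/(sval (exist _ q Sq : Sph R n (mm n j))) chr_att /=; exact: (svalP (attach R X n _)).
Qed.

End CellFamilies.

Theorem theorem6p1 (R : realType) (X : fatCW R)
  (UU : set (set (cw_carrier R X))) :
  Dopen_cover R (cw_plots R X) UU ->
  exists rho : set (cw_carrier R X) -> cw_carrier R X -> R,
    smooth_partition_of_unity_subordinate R (cw_plots R X) UU rho.
Proof.
move=> cov; have dX := cw_diffeology R X; have [Uop Ucov] := cov.
(* A point is needed to get a member [U0] of the cover, the label of the zero functions; on the
   empty space there is nothing to prove. *)
have [x0|nx] := pselect (exists x : cw_carrier R X, True); last first.
  exists (fun _ _ => 0); split.
  - move=> U _; apply: smooth_cst; exact: cw_plot_open.
  - by move=> U x; case: nx; exists x.
  - by move=> U _ x; case: nx; exists x.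
  - by move=> x; case: nx; exists x.
  - by move=> x; case: nx; exists x.
have [U0 [UU0 _]] : exists U, UU U /\ True by case: x0 => x _; have [U [HU _]] := Ucov x; exists U.
(* A single number codes the dimension and the bump. Numbers that code no pair fall back to
   [(0, 0)], which gives a legitimate family as well. *)
pose dec (a : nat) : nat * nat := odflt (0, 0)%N (unpickle a).
pose I a : choiceType := {classic cells R X (dec a).1}.
have Hex a := cell_bump_family X UU cov U0 (dec a).1 (dec a).2 UU0.
pose F a := projT1 (cid (Hex a)); have HF a := projT2 (cid (Hex a)).
pose V a := projT1 (cid (HF a)); have HV a := projT2 (cid (HF a)).
apply: (partition_of_countable_families (cw_plots R X) UU dX I F V).
- by move=> a; case: (HV a).
- by move=> a; case: (HV a).
- by move=> a; case: (HV a).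
move=> x; have [n [j [q [xq Sq]]]] := cw_open_cell X x.
have [U [UUU Ux]] := Ucov x.
have dO := Dopen_preimage _ _ _ U (chr_cell_smooth X n j) (Uop U UUU).
have [|c [c' [r [l [bq bU]]]]] := disk_bump_base _ q dO _ Sq; first by rewrite /preimage /= -xq.
pose a := pickle (n, pickle (c, c', r, l)).
have da : dec a = (n, pickle (c, c', r, l)) by rewrite /dec pickleK.
exists a; have [_ _ _] := HV a; rewrite -/(F a) /I.
(* The type of [F a] depends on [dec a], so it is generalized before [dec a] is rewritten. *)
move: (F a); rewrite da /= => Fa HFa; exists j.
by rewrite xq (HFa j c c' r l U).
Qed.
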